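(* Let $\overline{X}=(X_0,X_1)$ be a compatible (quasi-)Banach couple and let $0<\theta_0<\theta_1<1$. Let $E,E_0,E_1,F_0,F_1$ be r.i. spaces and let $a_0,a_1,b,b_0,b_1\in SV$ be such that $\|b_0\|_{\widetilde{E}_0(1,\infty)}<\infty$ and $\|b_1\|_{\widetilde{E}_1(1,\infty)}<\infty$. Put $$\rho(u)=u^{\theta_1-\theta_0}\frac{a_0(u)\|b_0\|_{\widetilde{E}_0(u,\infty)}}{a_1(u)\|b_1\|_{\widetilde{E}_1(u,\infty)}},\qquad u>0.$$ (a) If $0<\theta<1$, then $$\big(\overline{X}^{\mathcal L}_{\theta_0,b_0,E_0,a_0,F_0},\overline{X}^{\mathcal L}_{\theta_1,b_1,E_1,a_1,F_1}\big)_{\theta,b,E}=\overline{X}_{\tilde\theta,B_\theta,E},$$ where $\tilde\theta=(1-\theta)\theta_0+\theta\theta_1$ and $B_\theta(u)=\big(a_0(u)\|b_0\|_{\widetilde{E}_0(u,\infty)}\big)^{1-\theta}\big(a_1(u)\|b_1\|_{\widetilde{E}_1(u,\infty)}\big)^{\theta}\,b(\rho(u))$, $u>0$. (b) If $\theta=0$ and $\|b\|_{\widetilde{E}(1,\infty)}<\infty$, then $$\big(\overline{X}^{\mathcal L}_{\theta_0,b_0,E_0,a_0,F_0},\overline{X}^{\mathcal L}_{\theta_1,b_1,E_1,a_1,F_1}\big)_{0,b,E}=\overline{X}^{\mathcal L}_{\theta_0,B_0,E,a_0,F_0}\cap\overline{X}^{\mathcal L,\mathcal L}_{\theta_0,b\circ\rho,E,b_0,E_0,a_0,F_0},$$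 where $B_0(u)=\|b_0\|_{\widetilde{E}_0(u,\infty)}\,b(\rho(u))$, $u>0$. (c) If $\theta=1$ and $\|b\|_{\widetilde{E}(0,1)}<\infty$, then $$\big(\overline{X}^{\mathcal L}_{\theta_0,b_0,E_0,a_0,F_0},\overline{X}^{\mathcal L}_{\theta_1,b_1,E_1,a_1,F_1}\big)_{1,b,E}=\overline{X}^{\mathcal L,\mathcal R}_{\theta_1,b\circ\rho,E,b_1,E_1,a_1,F_1}.$$
   Context: R.i. spaces: an ''r.i. space'' $E$ is a rearrangement invariant Banach function space on $(0,\infty)$ (Lebesgue measure) with the Fatou property. $\widetilde{E}$ denotes the corresponding r.i. space with respect to the measure $dt/t$ on $(0,\infty)$: if $E=\mathcal F(L_1,L_\infty)$ for an interpolation functor $\mathcal F$, then $\widetilde{E}=\mathcal F(\widetilde L_1,L_\infty)$ with $\widetilde L_1=L_1((0,\infty),dt/t)$; concretely $\|f\|_{\widetilde E}=\|f^\star\|_E$, where $f^\star$ is the non-increasing rearrangement of $f$ with respect to $dt/t$. For an interval $I\subset(0,\infty)$, $\|f\|_{\widetilde E(I)}=\|f\chi_I\|_{\widetilde E}$. Slowly varying functions: a positive (finite) measurable function $b$ on $(0,\infty)$ belongs to $SV$ if for every $\varepsilon>0$, $t^{\varepsilon}b(t)$ is equivalent to a non-decreasing function and $t^{-\varepsilon}b(t)$ is equivalent to a non-increasing function on $(0,\infty)$ (equivalent: each bounded by a constant multiple of the other). Spaces: for a compatible (quasi-)Banach couple $\overline X=(X_0,X_1)$, $K(t,f)=\inf\{\|f_0\|_{X_0}+t\|f_1\|_{X_1}: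 f=f_0+f_1,\ f_i\in X_i\}$. The following spaces consist of all $f\in X_0+X_1$ for which the indicated (quasi-)norm is finite (the innermost norm is taken in the variable $s$, the next in $t$, the outermost in $u$, when present): - $\overline X_{\theta,b,E}$ (also written $(X_0,X_1)_{\theta,b,E}$): $\|t^{-\theta}b(t)K(t,f)\|_{\widetilde E}$, $0\le\theta\le1$; - $\overline X^{\mathcal L}_{\theta,b,E,a,F}$: $\big\|b(t)\|s^{-\theta}a(s)K(s,f)\|_{\widetilde F(0,t)}\big\|_{\widetilde E}$; - $\overline X^{\mathcal L,\mathcal L}_{\theta,c,E,b,F,a,G}$: $\Big\|c(u)\big\|b(t)\|s^{-\theta}a(s)K(s,f)\|_{\widetilde G(0,t)}\big\|_{\widetilde F(0,u)}\Big\|_{\widetilde E}$; - $\overline X^{\mathcal L,\mathcal R}_{\theta,c,E,b,F,a,G}$: $\Big\|c(u)\big\|b(t)\|s^{-\theta}a(s)K(s,f)\|_{\widetilde G(u,t)}\big\|_{\widetilde F(u,\infty)}\Big\|_{\widetilde E}$. Equality of spaces means equality as sets with equivalent (quasi-)norms; an intersection carries the maximum of the two (quasi-)norms. *)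

(* Defs.v *)
From HB Require Import structures.
From mathcomp Require Import all_boot all_order all_algebra.
From mathcomp Require Import all_classical all_reals all_analysis.
From mathcomp Require Import measurable_realfun.
Import Order.TTheory GRing.Theory Num.Theory.
Import numFieldNormedType.Exports.

Set Implicit Arguments.
Unset Strict Implicit.
Unset Printing Implicit Defensive.

Local Open Scope classical_set_scope.
Local Open Scope ring_scope.
Local Open Scope ereal_scope.

(* Functions on (0,oo) are functions on R of which only the values on (0,oo)
   matter. The sigma-algebra is that of the Lebesgue measurable sets, not the
   Borel one: [lebesgueType R] is R with the domain of [leb]. *)
Definition lebesgueType (R : realType) := caratheodory_type (wlength (@idfun R))^*%mu.

Definition leb {R : realType} : {measure set (lebesgueType R) -> \bar R} :=
  @completed_lebesgue_measure R.

Definition pos {R : realType} : set R := `]0%R, +oo[.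

Definition mpos (R : realType) (f : R -> \bar R) : Prop :=
  measurable_fun (pos : set (lebesgueType R)) f /\
  (forall t : R, (0 < t)%R -> 0 <= f t).

Definition equimeasurable (R : realType) (f g : R -> \bar R) : Prop :=
  forall s : R, (0 <= s)%R ->
    leb (pos `&` [set t | s%:E < f t]) = leb (pos `&` [set t | s%:E < g t]).

(* A Banach function space in the sense of Bennett and Sharpley, given by its
   function norm on the nonnegative measurable functions: the space is
   { f measurable | norm of |f| is finite }. *)
Record ri_space (R : realType) := RiSpace {
  ri_norm :> (R -> \bar R) -> \bar R ;
  ri_ge0 : forall f, mpos f -> 0 <= ri_norm f ;
  ri_eq0 : forall f, mpos f ->
    (ri_norm f = 0 <-> {ae leb, forall t : R, (0 < t)%R -> f t = 0}) ;
  ri_homogeneous : forall (a : R) f, (0 <= a)%R -> mpos f ->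
    ri_norm (fun t => a%:E * f t) = a%:E * ri_norm f ;
  ri_triangle : forall f g, mpos f -> mpos g ->
    ri_norm (fun t => f t + g t) <= ri_norm f + ri_norm g ;
  ri_monotone : forall f g, mpos f -> mpos g ->
    {ae leb, forall t : R, (0 < t)%R -> f t <= g t} -> ri_norm f <= ri_norm g ;
  ri_Fatou : forall (f_ : nat -> R -> \bar R) f,
    (forall n, mpos (f_ n)) -> mpos f ->
    {ae leb, forall t : R, (0 < t)%R ->
      nondecreasing_seq (fun n => f_ n t) /\ f_ n t @[n --> \oo] --> f t} ->
    nondecreasing_seq (fun n => ri_norm (f_ n)) /\
    ri_norm (f_ n) @[n --> \oo] --> ri_norm f ;
  ri_indic : forall A : set (lebesgueType R),
    measurable A -> A `<=` pos -> leb A < +oo ->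
    ri_norm (fun t => (\1_A t)%:E) < +oo ;
  ri_integral : forall A : set (lebesgueType R),
    measurable A -> A `<=` pos -> leb A < +oo ->
    exists2 C : R, (0 < C)%R & forall f, mpos f ->
      \int[leb]_(t in A) f t <= C%:E * ri_norm f ;
  ri_invariant : forall f g, mpos f -> mpos g ->
    equimeasurable f g -> ri_norm f = ri_norm g
}.

(* The measure dt/t on (0,oo). *)
Definition haar {R : realType} (A : set R) : \bar R :=
  \int[leb]_(t in (A `&` pos : set (lebesgueType R))) ((t : R)^-1)%:E.

Definition haar_rearrangement (R : realType) (f : R -> \bar R) (t : R) : \bar R :=
  ereal_inf [set s%:E | s in
    [set s : R | (0 <= s)%R /\ haar [set x | s%:E < `|f x|] <= t%:E]].

(* The norm of f in the space associated with E on the interval I; the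
   restriction f \_ I is 0 outside I. *)
Definition tnorm (R : realType) (E : ri_space R) (I : set R) (f : R -> \bar R) :
    \bar R :=
  E (haar_rearrangement (f \_ I)).

(* In [tail_norm] the norm is finite for all u > 0 when b is slowly varying and
   its norm on (1,oo) is finite. *)
Definition tail_norm (R : realType) (E : ri_space R) (b : R -> R) (u : R) : R :=
  fine (tnorm E `]u, +oo[ (EFin \o b)).

Definition equivalent (R : realType) (f g : R -> R) : Prop :=
  exists2 C : R, (0 < C)%R & forall t : R, (0 < t)%R ->
    (f t <= C * g t)%R /\ (g t <= C * f t)%R.

Definition SV (R : realType) (b : R -> R) : Prop :=
  [/\ forall t : R, (0 < t)%R -> (0 < b t)%R,
      measurable_fun (pos : set (lebesgueType R)) b &
      forall e : R, (0 < e)%R ->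
        (exists2 g : R -> R, {in pos &, {homo g : x y / (x <= y)%R}} &
           equivalent (fun t => t `^ e * b t)%R g) /\
        (exists2 g : R -> R, {in pos &, {homo g : x y /~ (x <= y)%R}} &
           equivalent (fun t => t `^ (- e) * b t)%R g)].

(* A quasi-normed subspace of V is given by its quasi-norm, extended by +oo
   outside the subspace. Scalars are real; a complex couple is covered by
   restriction of scalars, which changes neither the K-functional nor the
   spaces built from it. *)
Definition dom (R : realType) (V : lmodType R) (N : V -> \bar R) : set V :=
  [set x | N x < +oo].

Record quasi_Banach (R : realType) (V : lmodType R) (N : V -> \bar R) : Prop := {
  qB_ge0 : forall x, 0 <= N x ;
  qB_eq0 : forall x, N x = 0 <-> x = 0%R ;
  qB_homogeneous : forall (a : R) x, N (a *: x)%R = `|a|%:E * N x ;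
  qB_triangle : exists2 C : R, (1 <= C)%R &
    forall x y, N (x + y)%R <= C%:E * (N x + N y) ;
  qB_complete : forall x_ : nat -> V, (forall n, dom N (x_ n)) ->
    (forall e : R, (0 < e)%R -> exists n0 : nat, forall m n : nat,
       (n0 <= m)%N -> (n0 <= n)%N -> N (x_ m - x_ n)%R < e%:E) ->
    exists2 x, dom N x & forall e : R, (0 < e)%R -> exists n0 : nat,
      forall n : nat, (n0 <= n)%N -> N (x_ n - x)%R < e%:E
}.

Definition continuously_embedded (R : realType) (V : topologicalLmodType R)
    (N : V -> \bar R) : Prop :=
  forall U : set V, nbhs (0%R : V) U ->
    exists2 d : R, (0 < d)%R & [set x | N x < d%:E] `<=` U.

Record compatible_couple (R : realType) (V : topologicalLmodType R)
    (X0 X1 : V -> \bar R) : Prop := {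
  couple_hausdorff : hausdorff_space V ;
  couple_qB0 : quasi_Banach X0 ;
  couple_qB1 : quasi_Banach X1 ;
  couple_emb0 : continuously_embedded X0 ;
  couple_emb1 : continuously_embedded X1
}.

Section interpolation.
Variables (R : realType) (V : lmodType R).
Implicit Types (E F G : ri_space R) (a b c : R -> R).

Definition sum_space (X0 X1 : V -> \bar R) : set V :=
  [set f0 + f1 | f0 in dom X0 & f1 in dom X1]%R.

Definition Kfun (X0 X1 : V -> \bar R) (t : R) (f : V) : \bar R :=
  ereal_inf [set X0 fs.1 + t%:E * X1 fs.2 | fs in
    [set fs : V * V | [/\ dom X0 fs.1, dom X1 fs.2 & f = (fs.1 + fs.2)%R]]].

Definition on_sum (X0 X1 N : V -> \bar R) : V -> \bar R :=
  fun f => if f \in sum_space X0 X1 then N f else +oo.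

Definition interp (X0 X1 : V -> \bar R) (theta : R) b E : V -> \bar R :=
  on_sum X0 X1 (fun f =>
    tnorm E pos (fun t => (t `^ (- theta) * b t)%:E * Kfun X0 X1 t f)).

Definition interpL (X0 X1 : V -> \bar R) (theta : R) b E a F :
    V -> \bar R :=
  on_sum X0 X1 (fun f =>
    tnorm E pos (fun t => (b t)%:E *
      tnorm F `]0%R, t[ (fun s => (s `^ (- theta) * a s)%:E * Kfun X0 X1 s f))).

Definition interpLL (X0 X1 : V -> \bar R) (theta : R) c E b F a G :
    V -> \bar R :=
  on_sum X0 X1 (fun f =>
    tnorm E pos (fun u => (c u)%:E *
      tnorm F `]0%R, u[ (fun t => (b t)%:E *
        tnorm G `]0%R, t[ (fun s =>
          (s `^ (- theta) * a s)%:E * Kfun X0 X1 s f)))).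

Definition interpLR (X0 X1 : V -> \bar R) (theta : R) c E b F a G :
    V -> \bar R :=
  on_sum X0 X1 (fun f =>
    tnorm E pos (fun u => (c u)%:E *
      tnorm F `]u, +oo[ (fun t => (b t)%:E *
        tnorm G `]u, t[ (fun s =>
          (s `^ (- theta) * a s)%:E * Kfun X0 X1 s f)))).

Definition inter_space (N N' : V -> \bar R) : V -> \bar R :=
  fun f => Order.max (N f) (N' f).

Definition same_space (N N' : V -> \bar R) : Prop :=
  dom N = dom N' /\
  exists2 C : R, (0 < C)%R & forall f, dom N f ->
    N f <= C%:E * N' f /\ N' f <= C%:E * N f.

End interpolation.

(* Main.v *)
(* All functions involved are, up to constants, constant on the cells
   [e^k, e^(k+1)[, which have measure 1 for dt/t. Hence every norm of the theorem
   is equivalent to a norm of the sequence k_i = K(e^i, f): if the values of a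
   sequence x are copied onto disjoint unit intervals, then the norm of the
   resulting function in E is the norm in the space associated with E of the
   function equal to x_i on the i-th cell, and rearrangement invariance makes it
   invariant under shifts and contractive under injective reindexing.

   A decomposition f = f0 + f1 that is almost optimal for K(e^k, f) gives a
   Holmstedt formula for the couple of the two limiting spaces: K(rho(e^k), f) is
   equivalent to P_k + B_k Q_k + rho_k S_k, where Q_k is the F0-norm of
   e^(- theta0 i) a0_i k_i over i <= k, P_k the E0-norm of b0_j Q_j over j <= k,
   B_k the E0-norm of b0_j over j >= k, and S_k the E1-norm over j >= k of b1_j
   times the F1-norm of e^(- theta1 i) a1_i k_i over k <= i <= j. Since rho grows
   like a positive power up to slow variation, rho(e^k) replaces e^k in the outer
   norm. Hardy inequalities, which here reduce to geometric series and the shift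
   invariance of the norm, then discard the dominated terms: all but one single
   value k_k if 0 < theta < 1, the last one if theta = 0, the first two if
   theta = 1. *)
Require Import Defs.
From HB Require Import structures.
From mathcomp Require Import all_boot all_order all_algebra.
From mathcomp Require Import all_classical all_reals all_analysis.
From mathcomp Require Import measurable_realfun.
From mathcomp Require Import zify ring lra.
Import Order.TTheory GRing.Theory Num.Theory.
Import numFieldNormedType.Exports.

Local Open Scope classical_set_scope.
Local Open Scope ring_scope.
Set Implicit Arguments.
Unset Strict Implicit.
Unset Printing Implicit Defensive.

(** * Lebesgue measure and the measure dt/t on exponential cells *)

Section lebesgue.
Variable R : realType.
Local Open Scope ereal_scope.

(** After the change of variable the outer weight has, on the logarithmic scale, the exponent c = -
    theta (theta1 - theta0). Hardy towards smaller indices requires c < 0, that is theta > 0; Hardy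
    towards larger indices, applied to the term that carries rho, requires c + (theta1 - theta0) >
    0, that is theta < 1. Each endpoint loses one of the two, and the terms it would have absorbed
    are the ones that survive in (b) and (c). The bounds 0 < theta0 and theta1 < 1 enter through the
    decomposition at e^k: on one side of k nothing better is known than K(e^j, f0) <= 2 K(e^k, f)
    and K(e^j, f1) <= 2 e^(j - k) K(e^k, f), and these bounds make the corresponding weighted sums
    geometric. Two obstacles shape the estimates. Values may be +oo, so inequalities are proved in
    [0, +oo] with constants uniform in f, and finiteness is only used to see that a decomposition is
    admissible. The couple is quasi-normed, so K is subadditive up to a constant only, and a
    decomposition within a factor 2 of the optimum is guaranteed only if 0 < K < +oo. *)

Lemma measurable_leb (A : set R) :
  measurable (A : set (measurableTypeR R)) -> measurable (A : set (lebesgueType R)).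
Proof. by move=> mA; apply: sub_caratheodory; exact: mA. Qed.

Lemma measurable_fun_leb (D : set R) (f : R -> \bar R) :
  measurable (D : set (measurableTypeR R)) ->
  measurable_fun (D : set (measurableTypeR R)) f ->
  measurable_fun (D : set (lebesgueType R)) f.
Proof. by move=> mD mf _ Y mY; apply: measurable_leb; exact: mf. Qed.

(** The identity is measurable from the Lebesgue to the Borel sigma-algebra and pushes [leb] forward
    to [lebesgue_measure]. This gives access to the fundamental theorem of calculus in
    [integral_hcell]. *)
Lemma integral_leb (D : set R) (f : R -> \bar R) :
  measurable (D : set (measurableTypeR R)) -> measurable_fun D f ->
  (forall x, D x -> 0 <= f x) ->
  \int[leb]_(x in (D : set (lebesgueType R))) f x =
  \int[lebesgue_measure]_(x in D) f x.
Proof.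
move=> mD mf f0.
have mid : measurable_fun [set: lebesgueType R] (idfun : lebesgueType R -> measurableTypeR R).
  by move=> _ Y mY; rewrite setTI; exact: measurable_leb.
have := @ge0_integral_pushforward _ _ (lebesgueType R) (measurableTypeR R) R idfun mid leb D f mD mf.
rewrite /= => <-; last by move=> y /set_mem; exact: f0.
by apply: eq_measure_integral.
Qed.

Definition lcell (n : nat) : set R := pos `&` `[(n%:R : R), (n.+1%:R : R)[.
Definition hcell (k : int) : set R := `[expR k%:~R, expR (k + 1)%:~R[.
Definition logfloor (t : R) : int := Num.floor (ln t).

Lemma lcellP n t : lcell n t <-> (0 < t)%R /\ Num.truncn t = n.
Proof.
rewrite /lcell /pos /= !in_itv/= andbT; split=> [[t0 nt]|[t0 <-]].
  by split => //; apply/eqP; rewrite truncn_eq ?(ltW t0).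
split => //; exact: truncn_itv (ltW t0).
Qed.

Lemma hcellP k t : hcell k t <-> (0 < t)%R /\ logfloor t = k.
Proof.
rewrite /hcell /logfloor /= in_itv/=; split=> [/andP[kt tk]|[t0 <-]].
  have t0 : (0 < t)%R by apply: lt_le_trans kt; exact: expR_gt0.
  split => //; apply/eqP; rewrite floor_eq; apply/andP; split.
    by rewrite -ler_expR lnK.
  by rewrite -ltr_expR lnK.
have /andP[] := floor_itv (ln t).
by rewrite -ler_expR -ltr_expR lnK// => -> ->.
Qed.

Lemma measurable_lcell n : measurable (lcell n : set (lebesgueType R)).
Proof. by apply: measurable_leb; apply: measurableI; exact: measurable_itv. Qed.

Lemma measurable_hcell k : measurable (hcell k : set (lebesgueType R)).
Proof. by apply: measurable_leb; exact: measurable_itv. Qed.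

Lemma leb_lcell n : leb (lcell n : set (lebesgueType R)) = 1.
Proof.
rewrite -[LHS]/(lebesgue_measure (lcell n)); apply/eqP; rewrite eq_le; apply/andP; split.
  apply: (@le_trans _ _ (lebesgue_measure (`[(n%:R : R), (n.+1%:R : R)[ : set R))).
    apply: le_measure; rewrite ?inE; first by apply: measurableI; exact: measurable_itv.
      exact: measurable_itv.
    by move=> t [].
  by rewrite lebesgue_measure_itv/= lte_fin ltr_nat ltnSn -EFinB -natrB// subSnn.
apply: (@le_trans _ _ (lebesgue_measure (`](n%:R : R), (n.+1%:R : R)[ : set R))).
  by rewrite lebesgue_measure_itv/= lte_fin ltr_nat ltnSn -EFinB -natrB// subSnn.
apply: le_measure; rewrite ?inE; first exact: measurable_itv.
  by apply: measurableI; exact: measurable_itv.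
move=> t; rewrite /lcell /pos /= !in_itv/= => /andP[nt tn]; split.
  by rewrite andbT (le_lt_trans _ nt).
by rewrite (ltW nt).
Qed.

Lemma hcell_pos k : hcell k `<=` pos.
Proof. by move=> t /hcellP[t0 _]; rewrite /pos/= in_itv/= t0. Qed.

Lemma measurable_inv_pos : measurable_fun (pos : set (measurableTypeR R)) (fun t : R => (t^-1)%:E).
Proof.
apply/measurable_EFinP.
apply: open_continuous_measurable_fun; first by exact: interval_open.
by move=> x /set_mem; rewrite /pos /= in_itv/= andbT => x0; apply: inv_continuous; rewrite gt_eqF.
Qed.

Lemma integral_hcell k :
  \int[leb]_(t in (hcell k : set (lebesgueType R))) ((t : R)^-1)%:E = 1.
Proof.
have mh : measurable (hcell k : set (measurableTypeR R)) by exact: measurable_itv.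
have mf : measurable_fun (hcell k : set (measurableTypeR R)) (fun t : R => (t^-1)%:E).
  by apply: measurable_funS measurable_inv_pos; [exact: measurable_itv|exact: hcell_pos].
rewrite integral_leb//; last first.
  by move=> t /hcellP[t0 _]; rewrite lee_fin invr_ge0 ltW.
have ab : (expR k%:~R < expR (k + 1)%:~R :> R)%R by rewrite ltr_expR ltr_int; lia.
have P x : (expR k%:~R <= x :> R)%R -> (0 < x)%R by apply: lt_le_trans; exact: expR_gt0.
rewrite /hcell integral_itv_bndo_bndc//.
rewrite (@continuous_FTC2 _ _ (@ln R))//.
- by rewrite !expRK -EFinB -intrB addrC addKr.
- apply: continuous_in_subspaceT => x /set_mem/=; rewrite in_itv/= => /andP[/P x0 _].
  by apply: inv_continuous; rewrite gt_eqF.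
- split.
  + move=> x; rewrite in_itv/= => /andP[/ltW/P x0 _]; apply: ex_derive; exact: is_derive1_ln.
  + by apply: cvg_at_right_filter; apply: continuous_ln; exact: expR_gt0.
  + by apply: cvg_at_left_filter; apply: continuous_ln; exact: expR_gt0.
- move=> x; rewrite in_itv/= => /andP[/ltW/P x0 _].
  by rewrite derive1E; apply: derive_val; exact: is_derive1_ln.
Qed.

End lebesgue.

(** * Level sets and counting measure on the integers *)

Section counting.
Variable R : realType.
Local Open Scope ereal_scope.

Definition countz (S : set int) : \bar R := \esum_(k in S) 1.

Lemma count_nat (S : set int) :
  countz S = \sum_(n <oo | n \in (@pickle int @` S)) (1 : \bar R).
Proof.
rewrite nneseries_esum// set_mem_set esum_image//.
by move=> i j _ _; exact: (pcan_inj pickleK).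
Qed.

Lemma count_inj (S : set int) (m : int -> int) :
  {in S &, injective m} -> countz (m @` S) = countz S.
Proof. by move=> mi; rewrite /countz esum_image. Qed.

Lemma leb_count (S : set int) :
  leb (pos `&` [set t : R | exists2 k, S k & pickle k = Num.truncn t]) = countz S.
Proof.
have -> : pos `&` [set t : R | exists2 k, S k & pickle k = Num.truncn t]
    = \bigcup_(n in @pickle int @` S) (@lcell R n).
  apply/seteqP; split=> t /=.
    move=> [t0 [k Sk kt]]; exists (pickle k); first by exists k.
    by apply/lcellP; split=> //; move: t0; rewrite /pos/= in_itv/= andbT.
  by move=> [_ [k Sk <-]] /lcellP[t0 tk]; split; [rewrite /pos/= in_itv/= t0|exists k].
rewrite count_nat measure_bigcup.
- by apply: eq_eseriesr => n _; exact: leb_lcell.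
- by move=> n _; exact: measurable_lcell.
- by move=> i j _ _ [t [/lcellP[_ <-] /lcellP[_ <-]]].
Qed.

Lemma haar_count (S : set int) :
  haar [set t : R | S (logfloor t)] = countz S.
Proof.
rewrite /haar.
(* [g] inverts [pickle]; its default 0 never matters, since [F] is empty at codes outside the image
   of S. *)
pose g n : int := odflt 0%R (pickle_inv n).
have gK (k : int) : g (pickle k) = k by rewrite /g pickleK_inv.
pose F n : set (lebesgueType R) := if n \in (@pickle int @` S) then @hcell R (g n) else set0.
have mF n : measurable (F n) by rewrite /F; case: ifP => // _; exact: measurable_hcell.
have -> : [set t : R | S (logfloor t)] `&` pos = \bigcup_n F n.
  apply/seteqP; split=> t /=.
    move=> [St t0]; exists (pickle (logfloor t)) => //.
    rewrite /F mem_set ?gK; last by exists (logfloor t).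
    by apply/hcellP; split=> //; move: t0; rewrite /pos/= in_itv/= andbT.
  move=> [n _]; rewrite /F; case: ifPn => // /set_mem[k Sk <-].
  by rewrite gK => /hcellP[t0 tk]; split; [rewrite tk|rewrite /pos/= in_itv/= t0].
have Fpos : \bigcup_n F n `<=` pos.
  by move=> t [n _]; rewrite /F; case: ifPn => // _; exact: hcell_pos.
rewrite count_nat ge0_integral_bigcup//.
- rewrite [RHS]eseries_mkcond; apply: eq_eseriesr => n _; rewrite /F.
  by case: ifPn => nS; [exact: integral_hcell|rewrite integral_set0].
- apply: measurable_funS Fpos _; first by apply: measurable_leb; exact: measurable_itv.
  apply: measurable_fun_leb; first exact: measurable_itv.
  exact: measurable_inv_pos.
- by move=> t /Fpos; rewrite /pos/= in_itv/= andbT => t0; rewrite lee_fin invr_ge0 ltW.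
- move=> i j _ _ [t []]; rewrite /F; case: ifPn => // /set_mem[k _ <-].
  case: ifPn => // /set_mem[l _ <-].
  by rewrite !gK => /hcellP[_ <-] /hcellP[_ <-].
Qed.

(* The integral of a nonnegative function is a supremum over simple functions,
   hence monotone even on sets that are not measurable. *)
Lemma haar_mono (A B : set R) : A `&` pos `<=` B `&` pos -> haar A <= haar B.
Proof.
move=> AB; rewrite /haar integral_mkcond [leRHS]integral_mkcond.
rewrite !ge0_integralTE//; last 2 first.
  by move=> t; rewrite patchE; case: ifPn => // /set_mem[_]; rewrite /pos/= in_itv/= andbT => t0; rewrite lee_fin invr_ge0 ltW.
  by move=> t; rewrite patchE; case: ifPn => // /set_mem[_]; rewrite /pos/= in_itv/= andbT => t0; rewrite lee_fin invr_ge0 ltW.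
apply: le_ereal_sup => _ [h hle <-]; exists h => // t.
apply: (le_trans (hle t)); rewrite !patchE; case: ifPn => [/set_mem/AB/mem_set -> //|_].
by case: ifPn => // /set_mem[_]; rewrite /pos/= in_itv/= andbT => t0; rewrite lee_fin invr_ge0 ltW.
Qed.

End counting.

(** * Discretization of the norm of an r.i. space *)

Section bridge.
Variable R : realType.
Local Open Scope ereal_scope.
Implicit Types (f g : R -> \bar R) (x y : int -> \bar R) (E : ri_space R).

Lemma haar_rearrangement_ge0 f t : 0 <= haar_rearrangement f t.
Proof. by apply: le_ereal_inf_tmp => _ [s [s0 _] <-]; rewrite lee_fin. Qed.

Lemma haar_rearrangement_noninc f t u : (t <= u)%R ->
  haar_rearrangement f u <= haar_rearrangement f t.
Proof.
move=> tu; apply: ereal_inf_le_tmp => _ [s [s0 st] <-]; exists s => //.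
by split => //; apply: (le_trans st); rewrite lee_fin.
Qed.

Lemma mpos_haar_rearrangement f : mpos (haar_rearrangement f).
Proof.
split; last by move=> t _; exact: haar_rearrangement_ge0.
apply: measurable_fun_leb; first exact: measurable_itv.
move=> mD; apply: (measurability _ (ErealGenOInfty.measurableE R)) => //.
move=> _ [_ [r ->] <-]; apply: is_interval_measurable => s t /=.
rewrite /pos/= !in_itv/= !andbT => -[s0 fs] [t0 ft] u /andP[su ut].
split; first by rewrite ?in_itv/= ?andbT (lt_le_trans s0).
by rewrite in_itv/= andbT; apply: (lt_le_trans ft); exact: haar_rearrangement_noninc.
Qed.

Lemma haar_rearrangement_mono f g :
  (forall t : R, (0 < t)%R -> `|f t| <= `|g t|) ->
  forall t, haar_rearrangement f t <= haar_rearrangement g t.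
Proof.
move=> fg t; apply: ereal_inf_le_tmp => _ [s [s0 st] <-]; exists s => //; split=> //.
apply: le_trans st; apply: haar_mono => u [/= su u0]; split=> //=.
by apply: (lt_le_trans su); apply: fg; move: u0; rewrite /pos/= in_itv/= andbT.
Qed.

Lemma tnorm_mono E (I J : set R) f g :
  (forall t : R, (0 < t)%R -> `|(f \_ I) t| <= `|(g \_ J) t|) ->
  tnorm E I f <= tnorm E J g.
Proof.
move=> fg; apply: ri_monotone; try exact: mpos_haar_rearrangement.
apply: aeW => t _; exact: haar_rearrangement_mono.
Qed.

Lemma tnorm_ge0 E (I : set R) f : 0 <= tnorm E I f.
Proof. by apply: ri_ge0; exact: mpos_haar_rearrangement. Qed.

Lemma leb_lt_pos (D : \bar R) : 0 <= D ->
  leb (pos `&` [set t : R | t%:E < D]) = D.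
Proof.
rewrite -[leb _]/(lebesgue_measure (pos `&` [set t : R | t%:E < D])).
case: D => [r| |]// D0.
  have -> : pos `&` [set t : R | t%:E < r%:E] = `]0%R, r[%classic.
    by apply/seteqP; split => t; rewrite /pos/= !in_itv/= lte_fin andbT; [move=> [-> ->]|move=> /andP[]].
  rewrite lebesgue_measure_itv/= lte_fin; case: ifPn => [|]; first by rewrite sube0.
  by rewrite -leNgt => r0; congr (_%:E); apply/eqP; rewrite eq_le r0 andbT.
have -> : pos `&` [set t : R | t%:E < +oo] = (pos : set R).
  by apply/seteqP; split => t; [case|move=> ?; split => //=; exact: ltry].
by rewrite /pos lebesgue_measure_itv/= ltry.
Qed.

(** Right continuity of the distribution function: a finite set of indices already witnesses the
    count, and finitely many strict inequalities leave room above s. It is needed because the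
    rearrangement is an infimum, which has to stay strictly above s. *)
Lemma count_right_cont x (s t : R) :
  t%:E < countz R [set k | s%:E < x k] ->
  exists2 s' : R, (s < s')%R & t%:E < countz R [set k | s'%:E < x k].
Proof.
move=> /ereal_sup_gt[_ [X [finX Xs] <-] tX].
have [s' ss' Xs'] : exists2 s' : R, (s < s')%R & forall k, X k -> s'%:E < x k.
  have /finite_seqP[r Xr] := finX.
  have : forall k, k \in r -> s%:E < x k.
    by move=> k kr; apply: Xs; rewrite Xr.
  suff : (forall k, k \in r -> s%:E < x k) -> exists2 s' : R, (s < s')%R & forall k, k \in r -> s'%:E < x k.
    by move=> /[apply] -[s' ss' H]; exists s' => // k; rewrite Xr; exact: H.
  elim: r {Xr} => [_|k r IH kr]; first by exists (s + 1)%R => //; rewrite ltrDl.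
  have [|s1 ss1 H1] := IH; first by move=> l lr; apply: kr; rewrite inE lr orbT.
  have [s2 ss2 H2] : exists2 s2 : R, (s < s2)%R & s2%:E < x k.
    have : s%:E < x k by apply: kr; rewrite inE eqxx.
    case: (x k) => [r'| |]//.
      by rewrite lte_fin => sr; exists ((s + r') / 2)%R; rewrite ?lte_fin; lra.
    by move=> _; exists (s + 1)%R; [rewrite ltrDl|exact: ltry].
  exists (Num.min s1 s2); first by rewrite lt_min ss1.
  move=> l; rewrite inE => /orP[/eqP ->|/H1].
    by apply: le_lt_trans H2; rewrite lee_fin ge_min lexx orbT.
  apply: le_lt_trans.
  by rewrite lee_fin ge_min lexx.
exists s' => //; apply: (lt_le_trans tX); apply: esum_ge; exists X => //.
Qed.

Lemma count_mono (S T : set int) : S `<=` T -> countz R S <= countz R T.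
Proof.
move=> ST; apply: le_ereal_sup => _ [X [finX XS] <-]; exists X => //; split=> //.
exact: subset_trans ST.
Qed.

Lemma count_ge0 (S : set int) : 0 <= countz R S.
Proof. exact: esum_ge0. Qed.

(* The value x k is put on the unit interval numbered [pickle k]. *)
Definition spread x (t : R) : \bar R :=
  maxe 0 (oapp x 0 (pickle_inv (Num.truncn t))).

Lemma spread_super x (s : R) : (0 <= s)%R ->
  leb (pos `&` [set t | s%:E < spread x t]) = countz R [set k | s%:E < x k].
Proof.
move=> s0; rewrite -leb_count; congr (leb _); apply/seteqP; split=> t /= [t0 xt]; split=> //.
  move: xt; rewrite /spread lt_max => /orP[|]; first by rewrite lte_fin ltNge s0.
  case: pickle_inv (@pickle_invK int (Num.truncn t)) => [k|]/=; last by rewrite lte_fin ltNge s0.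
  by move=> <- sk; exists k.
by case: xt => k sk kt; rewrite /spread lt_max -kt pickleK_inv/= sk orbT.
Qed.

Lemma mpos_spread x : mpos (spread x).
Proof.
split; last by move=> t _; rewrite /spread le_max lexx.
move=> mD Y mY.
have -> : pos `&` spread x @^-1` Y =
    \bigcup_(n in [set n | Y (maxe 0 (oapp x 0 (pickle_inv n)))]) @lcell R n.
  apply/seteqP; split=> t /=.
    move=> [t0 Yt]; exists (Num.truncn t) => //; apply/lcellP.
    by move: t0; rewrite /pos/= in_itv/= andbT.
  by move=> [n Yn] /lcellP[t0 tn]; rewrite /spread tn; split=> //; rewrite /pos/= in_itv/= t0.
by apply: bigcup_measurable => n _; exact: measurable_lcell.
Qed.

(** Because [spread] truncates at 0 and vanishes on intervals whose number is not a code, its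
    argument is admissible for E whatever x is, so most lemmas about [snorm] carry no positivity
    hypothesis. *)
Definition snorm E x : \bar R := E (spread x).

Lemma snorm_equi E x y : (forall s : R, (0 <= s)%R ->
  countz R [set k | s%:E < x k] = countz R [set k | s%:E < y k]) -> snorm E x = snorm E y.
Proof.
move=> xy; apply: ri_invariant; try exact: mpos_spread.
by move=> s s0; rewrite !spread_super// xy.
Qed.

(** Both functions have the same distribution function: with D the number of k such that x k > s,
    the rearrangement exceeds s exactly on ]0, D[, by [count_right_cont], and [spread x] exceeds s
    on D unit intervals. *)
Lemma tnorm_step E x : (forall k, 0 <= x k) ->
  tnorm E pos (x \o @logfloor R) = snorm E x.
Proof.
move=> x0; apply: ri_invariant; [exact: mpos_haar_rearrangement|exact: mpos_spread|].
move=> s s0; rewrite spread_super//.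
set f := _ \_ _.
have fE (r : R) : (0 <= r)%R -> haar [set u | r%:E < `|f u|] = countz R [set k | r%:E < x k].
  move=> r0; rewrite -haar_count; apply/eqP; rewrite eq_le; apply/andP; split; apply: haar_mono;
    move=> u [/= ru u0]; split=> //=; move: ru; rewrite /f patchE mem_set//= gee0_abs//.
rewrite -[RHS]leb_lt_pos ?count_ge0//; congr (leb _); apply/seteqP; split=> t /= [t0 b]; split=> //.
  rewrite ltNge; apply/negP => dt; move: b; apply/negP; rewrite -leNgt.
  by apply: ereal_inf_lbound; exists s => //; split=> //; rewrite fE.
have [s' ss' ts'] := count_right_cont b.
apply: (@lt_le_trans _ _ s'%:E); first by rewrite lte_fin.
apply: le_ereal_inf_tmp => _ [r [r0 rt] <-]; rewrite lee_fin leNgt; apply/negP => rs'.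
move: rt; rewrite fE// leNgt => /negP; apply; apply: (lt_le_trans ts').
by apply: count_mono => k /=; apply: lt_trans; rewrite lte_fin.
Qed.

End bridge.

(** * Properties of the sequence norm *)

Section snorm.
Variable R : realType.
Local Open Scope ereal_scope.
Implicit Types (x y : int -> \bar R) (E : ri_space R).

Lemma snorm_ge0 E x : 0 <= snorm E x.
Proof. by apply: ri_ge0; exact: mpos_spread. Qed.

Lemma snorm_mono E x y : (forall k, x k <= y k) -> snorm E x <= snorm E y.
Proof.
move=> xy; apply: ri_monotone; try exact: mpos_spread.
apply: aeW => t _; rewrite /spread.
by case: pickle_inv => [k|]//=; rewrite ge_max !le_max lexx/= xy orbT.
Qed.

Lemma snormZ E (c : R) x : (0 <= c)%R ->
  snorm E (fun k => c%:E * x k) = c%:E * snorm E x.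
Proof.
move=> c0; rewrite /snorm -ri_homogeneous//; last exact: mpos_spread.
congr (ri_norm E _); apply/funext => t; rewrite /spread maxe_pMr// mule0.
by case: pickle_inv => [k|]//=; rewrite mule0.
Qed.

Lemma snormD E x y : snorm E (fun k => x k + y k) <= snorm E x + snorm E y.
Proof.
apply: le_trans (ri_triangle E (mpos_spread x) (mpos_spread y)).
apply: ri_monotone; [exact: mpos_spread| |].
  split; last by move=> t t0; apply: adde_ge0; rewrite /spread le_max lexx.
  by apply: emeasurable_funD; [have [] := mpos_spread x|have [] := mpos_spread y].
apply: aeW => t _; rewrite /spread.
case: pickle_inv => [k|]/=; last by rewrite maxxx adde0.
rewrite ge_max; apply/andP; split; first by apply: adde_ge0; rewrite le_max lexx.
by apply: leeD; rewrite le_max lexx orbT.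
Qed.

Lemma snorm_sum E (I : Type) (r : seq I) (x_ : I -> int -> \bar R) :
  snorm E (fun k => \sum_(i <- r) x_ i k) <= \sum_(i <- r) snorm E (x_ i).
Proof.
elim: r => [|i r IH].
  rewrite big_nil; apply: (@le_trans _ _ (snorm E (fun k => 0%:E * 0))).
    by apply: snorm_mono => k; rewrite big_nil mul0e.
  by rewrite snormZ// mul0e.
rewrite big_cons; apply: le_trans (leeD (lexx _) IH).
apply: le_trans (snormD _ _ _); apply: snorm_mono => k.
by rewrite big_cons.
Qed.

(** The Fatou property, applied to the partial sums, turns finite subadditivity into countable
    subadditivity. *)
Lemma snorm_series E (x_ : nat -> int -> \bar R) : (forall n k, 0 <= x_ n k) ->
  snorm E (fun k => \sum_(n <oo) x_ n k) <= \sum_(n <oo) snorm E (x_ n).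
Proof.
move=> x0.
have [] := @ri_Fatou R E (fun N => spread (fun k => \sum_(0 <= n < N) x_ n k))
  (spread (fun k => \sum_(n <oo) x_ n k)).
- by move=> N; exact: mpos_spread.
- exact: mpos_spread.
- apply: aeW => t _; rewrite /spread.
  case: pickle_inv => [k|]/=; last by split; [|rewrite maxxx; exact: cvg_cst].
  have max0 (a : \bar R) : 0 <= a -> maxe 0 a = a by move/max_idPr.
  have s0 N : 0 <= \sum_(0 <= n < N) x_ n k by apply: sume_ge0.
  rewrite max0 ?nneseries_ge0//; split.
    move=> N M NM; rewrite !max0//; exact: ereal_nondecreasing_series.
  under eq_cvg do rewrite max0//.
  exact: is_cvg_nneseries.
move=> _ cv; rewrite [leLHS]/snorm -(cvg_lim _ cv)//; apply: lime_le; first by apply/cvg_ex; eexists; exact: cv.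
apply: nearW => N; apply: le_trans (nneseries_lim_ge N _); last by move=> *; exact: snorm_ge0.
exact: snorm_sum.
Qed.

Definition cut (p : pred int) x (k : int) : \bar R := if p k then x k else 0.

(** On p the map m is a bijection from each superlevel set of the left-hand sequence onto the one of
    x cut to the image of p, so the two sequences are equimeasurable. *)
Lemma snorm_inj E (p : pred int) (m : int -> int) x :
  {in p &, injective m} -> snorm E (cut p (x \o m)) <= snorm E (maxe 0 \o x).
Proof.
move=> mi; pose q k := `[< exists2 j, p j & m j = k >].
apply: (@le_trans _ _ (snorm E (cut q x))); last first.
  by apply: snorm_mono => k; rewrite /cut/=; case: ifP => _; rewrite le_max lexx ?orbT.
rewrite le_eqVlt; apply/orP; left; apply/eqP; apply: snorm_equi => s s0.
rewrite -(@count_inj R [set k | s%:E < cut p (x \o m) k] m).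
  congr countz; apply/seteqP; split=> k /=.
    move=> [j]; rewrite /cut; case: ifPn => [pj sj <-|]; last by rewrite lte_fin ltNge s0.
    by rewrite /q asboolT//; exists j.
  rewrite /cut; case: ifPn; last by rewrite lte_fin ltNge s0.
  by move=> /asboolP[j pj <-] sj; exists j; rewrite /cut ?pj.
have pin j : s%:E < cut p (x \o m) j -> p j.
  by rewrite /cut; case: ifPn => //; rewrite lte_fin ltNge s0.
by move=> i j /set_mem/= /pin ip /set_mem/= /pin jp; exact: mi.
Qed.

(* The norm of a single cell, which by rearrangement invariance does not depend
   on the cell. *)
Definition unit_norm E : R := fine (snorm E (fun k => if k == 0%R :> int then 1 else 0)).

Lemma unit_normE E : snorm E (fun k => if k == 0%R :> int then 1 else 0) = (unit_norm E)%:E.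
Proof.
rewrite fineK// ge0_fin_numE ?snorm_ge0//.
apply: le_lt_trans (@ri_indic _ E (@lcell R (pickle (0%R : int))) _ _ _).
- apply: ri_monotone; first exact: mpos_spread.
    split; last by move=> t _; rewrite lee_fin.
    by apply/measurable_EFinP; apply: measurable_indic; exact: measurable_lcell.
  apply: aeW => t t0; rewrite /spread indicE.
  case: pickle_inv (@pickle_invK int (Num.truncn t)) => [k|]/=; last by rewrite maxxx lee_fin.
  case: eqP => [->|_]; last by rewrite maxxx lee_fin.
  by move=> tk; rewrite mem_set ?ge_max ?lee_fin ?lexx ?ler01//; apply/lcellP.
- exact: measurable_lcell.
- by move=> t [].
- by rewrite leb_lcell ltry.
Qed.

Lemma unit_norm_gt0 E : (0 < unit_norm E)%R.
Proof.
rewrite -lte_fin -unit_normE lt_neqAle snorm_ge0 andbT eq_sym; apply/eqP.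
move=> /(ri_eq0 E (mpos_spread _)) [A [mA A0 sA]].
have : leb (@lcell R (pickle (0%R : int)) : set (lebesgueType R)) <= leb A.
  apply: le_measure; rewrite ?inE//; first exact: measurable_lcell.
  move=> t /lcellP[t0 tk]; apply: sA => /= /(_ t0).
  rewrite /spread tk pickleK_inv/= => /eqP; rewrite max_r ?lee_fin//.
  by rewrite eqe oner_eq0.
by rewrite leb_lcell A0 lee_fin ler10.
Qed.

Lemma snorm_delta E (k : int) (c : R) : (0 <= c)%R ->
  snorm E (fun j => if j == k then c%:E else 0) = (c * unit_norm E)%:E.
Proof.
move=> c0; rewrite EFinM -unit_normE -snormZ//.
apply/eqP; rewrite eq_le; apply/andP; split.
  apply: le_trans (le_trans (@snorm_inj E predT (fun j => j - k)%R
      (fun j => c%:E * (if j == 0%R :> int then 1 else 0)) _) _).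
  - by apply: snorm_mono => j; rewrite /cut/= subr_eq0; case: eqP => _; rewrite ?mule1 ?mule0.
  - by move=> i j _ _ /addIr.
  - apply: snorm_mono => j /=; case: eqP => _; rewrite ?mule1 ?mule0 ?maxxx//.
    by rewrite ge_max lexx lee_fin c0.
apply: le_trans (le_trans (@snorm_inj E predT (fun j => j + k)%R
    (fun j => if j == k then c%:E else 0) _) _).
- apply: snorm_mono => j; rewrite /cut/=.
  have -> : (j + k == k)%R = (j == 0%R) by rewrite -[LHS]subr_eq0 addrK.
  by case: eqP => _; rewrite ?mule1 ?mule0.
- by move=> i j _ _ /addIr.
- apply: snorm_mono => j /=; case: eqP => _; rewrite ?maxxx//.
  by rewrite ge_max lexx lee_fin c0.
Qed.

(** Proved first for reals c <= x k by comparison with a one-cell sequence; if x k = +oo, the choice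
    c = r / [unit_norm E] shows that the norm is at least any r. *)
Lemma le_snorm E x k : x k * (unit_norm E)%:E <= snorm E x.
Proof.
have H (c : R) : c%:E <= x k -> (c * unit_norm E)%:E <= snorm E x.
  move=> cx; have [c0|c0] := leP 0%R c; last first.
    apply: (@le_trans _ _ 0); last exact: snorm_ge0.
    by rewrite lee_fin nmulr_rle0// ltW// unit_norm_gt0.
  rewrite -(snorm_delta E k)//; rewrite /snorm; apply: ri_monotone; try exact: mpos_spread.
  apply: aeW => t _; rewrite /spread; case: pickle_inv => [j|]//=.
  by rewrite ge_max !le_max lexx/=; case: eqP => [->|_]; rewrite ?cx ?lexx ?orbT.
case xk : (x k) H => [r| |] H.
- exact: H.
- rewrite gt0_mulye ?lte_fin ?unit_norm_gt0// leye_eq; apply/eqP/eqyP => r r0.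
  have d0 := unit_norm_gt0 E.
  by have := H (r / unit_norm E)%R (leey _); rewrite divfK// gt_eqF.
- by rewrite gt0_mulNye ?lte_fin ?unit_norm_gt0// leNye.
Qed.

End snorm.

(** * Weights of power type up to slow variation *)

Section regular.
Variable R : realType.
Implicit Types (W V : R -> R) (a b c e r x y : R).

(* Weights are read on the logarithmic scale, W x = w (expR x); then
   [regular a W] says that t `^ (- a) * w t is slowly varying. *)
Definition regular a W := (forall x, 0 < W x) /\
  forall e, 0 < e -> exists2 C : R, 0 < C &
    forall x y, W x <= C * expR (a * (x - y) + e * `|x - y|) * W y.

Lemma regularM a b W V : regular a W -> regular b V ->
  regular (a + b) (fun x => W x * V x).
Proof.
move=> [W0 hW] [V0 hV]; split=> [x|e e0]; first by rewrite mulr_gt0.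
have e2 : 0 < e / 2 by rewrite divr_gt0.
have [C C0 HC] := hW _ e2; have [D D0 HD] := hV _ e2.
exists (C * D) => [|x y]; first by rewrite mulr_gt0.
apply: (le_trans (ler_pM (ltW (W0 x)) (ltW (V0 x)) (HC x y) (HD x y))).
rewrite le_eqVlt; apply/orP; left; apply/eqP.
rewrite [in RHS](_ : _ + _ = (a * (x - y) + e / 2 * `|x - y|) + (b * (x - y) + e / 2 * `|x - y|)); last by field.
by rewrite [in RHS]expRD; ring.
Qed.

Lemma regularV a W : regular a W -> regular (- a) (fun x => (W x)^-1).
Proof.
move=> [W0 hW]; split=> [x|e e0]; first by rewrite invr_gt0.
have [C C0 HC] := hW _ e0; exists C => // x y.
rewrite ler_pdivlMr// mulrC ler_pdivrMr//.
by have := HC y x; rewrite distrC (_ : a * (y - x) = - a * (x - y)); last by ring.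
Qed.

(** In logarithms the power is a multiplication by r; for r < 0 it reverses the inequality, which is
    then used with x and y exchanged. The [+ 1] in the choice of e keeps the divisor positive when r
    = 0. *)
Lemma regular_powR a r W : regular a W -> regular (r * a) (fun x => W x `^ r).
Proof.
move=> [W0 hW]; split=> [x|e e0]; first by rewrite powR_gt0.
have r1 : 0 < `|r| + 1 by rewrite ltr_wpDl.
have [C C0 HC] := hW _ (divr_gt0 e0 r1).
exists (expR (`|r| * `|ln C|)) => [|x y]; first exact: expR_gt0.
have lnW u v : ln (W u) <= ln C + (a * (u - v) + e / (`|r| + 1) * `|u - v|) + ln (W v).
  have := HC u v; rewrite -ler_ln ?posrE ?mulr_gt0 ?expR_gt0//.
  by rewrite !lnM ?posrE ?mulr_gt0 ?expR_gt0// expRK.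
rewrite -[leRHS]lnK ?posrE ?mulr_gt0 ?expR_gt0 ?powR_gt0//.
rewrite -[leLHS]lnK ?posrE ?powR_gt0// ler_expR.
rewrite !lnM ?posrE ?mulr_gt0 ?expR_gt0 ?powR_gt0// !expRK !ln_powR.
have Cle := ler_norm (ln C).
have H : `|r| / (`|r| + 1) <= 1 by rewrite ler_pdivrMr// mul1r lerDl.
have e1 : `|r| * (e / (`|r| + 1) * `|x - y|) <= e * `|x - y|.
  rewrite (_ : _ * _ = (`|r| / (`|r| + 1)) * (e * `|x - y|)); last by field; rewrite gt_eqF.
  by apply: ler_piMl => //; rewrite mulr_ge0// ltW.
have [r0|r0] := leP 0 r.
  have := ler_wpM2l r0 (lnW x y); move: e1; rewrite (ger0_norm r0).
  have := ler_wpM2l r0 Cle; nra.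
have := ler_wnM2l (ltW r0) (lnW y x); move: e1; rewrite (distrC y x) (ltr0_norm r0).
have := ler_wnM2l (ltW r0) Cle; nra.
Qed.

Lemma regular_expR a : regular a (fun x => expR (a * x)).
Proof.
split=> [x|e e0]; first exact: expR_gt0.
exists 1 => // x y; rewrite mul1r -expRD ler_expR.
have := mulr_ge0 (ltW e0) (normr_ge0 (x - y)); lra.
Qed.

Lemma regular_lip a W : regular a W ->
  exists2 C : R, 0 < C & forall x y, `|ln (W x) - ln (W y)| <= C * (1 + `|x - y|).
Proof.
move=> [W0 hW]; have [D D0 HD] := hW _ ltr01.
exists (`|ln D| + `|a| + 1) => [|x y]; first by rewrite ltr_wpDl.
have lnW u v : ln (W u) <= `|ln D| + `|a| * `|u - v| + `|u - v| + ln (W v).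
  have := HD u v; rewrite -ler_ln ?posrE ?mulr_gt0 ?expR_gt0//.
  rewrite !lnM ?posrE ?mulr_gt0 ?expR_gt0// expRK mul1r.
  have := ler_norm (ln D); have := ler_norm (a * (u - v)); rewrite normrM; lra.
have := lnW x y; have := lnW y x; rewrite (distrC y x).
have := normr_ge0 (ln D); have := normr_ge0 a; have := normr_ge0 (x - y).
rewrite ler_norml => *; apply/andP; split; nra.
Qed.

(** This is why b(rho(u)) is slowly varying: ln W is Lipschitz at large scale, so an exponent e / C
    for B becomes e (1 + |x - y|), whose constant part goes into the factor [expR e]. *)
Lemma regular_comp a W (B : R -> R) : regular a W -> regular 0 B ->
  regular 0 (fun x => B (ln (W x))).
Proof.
move=> /regular_lip [C C0 HC] [B0 hB]; split=> [x|e e0]; first exact: B0.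
have [D D0 HD] := hB _ (divr_gt0 e0 C0).
exists (D * expR e) => [|x y]; first by rewrite mulr_gt0 ?expR_gt0.
apply: (le_trans (HD (ln (W x)) (ln (W y)))); rewrite ler_pM2r// -mulrA -expRD ler_pM2l//.
rewrite ler_expR !mul0r !add0r.
apply: (@le_trans _ _ (e / C * (C * (1 + `|x - y|)))).
  by rewrite ler_wpM2l// ltW ?divr_gt0.
by rewrite mulrA divfK ?gt_eqF//; lra.
Qed.

Lemma regular_near a W (M : R) : regular a W -> exists2 C : R, 0 < C &
  forall x y, `|x - y| <= M -> W x <= C * W y.
Proof.
move=> [W0 hW]; have [D D0 HD] := hW _ ltr01.
exists (D * expR (`|a| * `|M| + `|M|)) => [|x y xy]; first by rewrite mulr_gt0 ?expR_gt0.
apply: (le_trans (HD x y)); rewrite ler_pM2r// ler_pM2l// ler_expR mul1r.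
have H : `|x - y| <= `|M| by apply: (le_trans xy); exact: ler_norm.
rewrite lerD//; apply: (le_trans (ler_norm _)); rewrite normrM ler_wpM2l//.
Qed.

Lemma regular_decay a W (s : int) : regular a W -> `|s| = 1 -> a * s%:~R < 0 ->
  exists2 C : R, 0 < C & exists2 r : R, 0 < r < 1 &
    forall (k : int) (l : nat), W (k + s * l)%:~R <= C * r ^+ l * W k%:~R.
Proof.
(* Half of the decay rate is given up to slow variation; the other half is the ratio
   [expR (- c)]. *)
move=> [W0 hW] s1 as0; set c := - (a * s%:~R) / 2.
have c0 : 0 < c by rewrite /c; lra.
have [C C0 HC] := hW _ c0; exists C => //; exists (expR (- c)).
  by rewrite expR_gt0 expR_lt1 oppr_lt0.
move=> k l; apply: (le_trans (HC _ k%:~R)); rewrite ler_pM2r// ler_pM2l//.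
rewrite -expRM_natl ler_expR intrD addrAC subrr add0r intrM normrM.
have -> : `|s%:~R| = 1 :> R by rewrite -intr_norm s1.
have -> : (l : int)%:~R = l%:R :> R by [].
rewrite mul1r ger0_norm// -mulr_natl mulrA -/c.
rewrite (_ : _ + _ = l%:R * (a * s%:~R + c)); last by ring.
by rewrite mulr1 (_ : a * s%:~R + c = - c)// /c; field.
Qed.

(** The almost monotone majorant of t^e b gives the bound for x <= y, the one of t^(-e) b gives it
    for y < x; [C * C + D * D] serves both cases. *)
Lemma SV_regular (b : R -> R) : SV b -> regular 0 (b \o expR).
Proof.
move=> [b0 _ hb]; split=> [x|e e0]; first by apply: b0; exact: expR_gt0.
have [[g gm [C C0 gC]] [h hm [D D0 hD]]] := hb _ e0.
have p t : expR t \in (pos : set R) by rewrite inE /pos/= in_itv/= expR_gt0.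
exists (C * C + D * D) => [|x y /=]; first by rewrite addr_gt0 ?mulr_gt0.
have powE u v : expR u `^ v = expR (v * u) by rewrite /powR gt_eqF ?expR_gt0// expRK.
rewrite mul0r add0r.
have E0 u := @expR_gt0 R u.
have b0' u := b0 _ (E0 u).
have [xy|yx] := leP x y.
  have /= := gm _ _ (p x) (p y); rewrite ler_expR => /(_ xy) gxy.
  have /= [g1 _] := gC _ (E0 x); have /= [_ g2] := gC _ (E0 y).
  rewrite !powE in g1 g2.
  rewrite ler0_norm ?subr_le0// opprB (_ : e * (y - x) = - (e * x) + e * y) ?expRD ?expRN; last by ring.
  rewrite -(ler_pM2l (E0 (e * x))); apply: (le_trans g1).
  apply: (@le_trans _ _ (C * C * (expR (e * y) * b (expR y)))).
    by rewrite -mulrA ler_pM2l//; apply: (le_trans gxy).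
  rewrite (_ : expR (e * x) * _ = (C * C + D * D) * (expR (e * y) * b (expR y))); last first.
    by field; rewrite gt_eqF.
  by rewrite ler_pM2r ?mulr_gt0// lerDl ltW ?mulr_gt0.
have /= := hm _ _ (p x) (p y); rewrite ler_expR => /(_ (ltW yx)) hxy.
have /= [g1 _] := hD _ (E0 x); have /= [_ g2] := hD _ (E0 y).
rewrite !powE in g1 g2.
rewrite gtr0_norm ?subr_gt0//.
rewrite (_ : e * (x - y) = - (- e * x) + (- e * y)) ?expRD ?expRN; last by ring.
rewrite -(ler_pM2l (E0 (- e * x))); apply: (le_trans g1).
apply: (@le_trans _ _ (D * D * (expR (- e * y) * b (expR y)))).
  by rewrite -mulrA ler_pM2l//; apply: (le_trans hxy).
rewrite [leRHS](_ : _ = (C * C + D * D) * (expR (- e * y) * b (expR y))); last first.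
  by field; rewrite gt_eqF.
by rewrite ler_pM2r ?mulr_gt0// lerDr ltW ?mulr_gt0.
Qed.

End regular.

(** * Norm estimates for sequences *)

Section lesssim.
Variables (R : realType) (T : Type).
Local Open Scope ereal_scope.
Implicit Types (u v w : T -> \bar R).

(** One constant serves all indices. The index type ranges over elements f, or pairs of an element
    and an integer, which is what allows an estimate to be put under a norm in the integer variable
    ([lesssim_snorm]). *)
Definition lesssim u v := exists2 C : R, (0 < C)%R & forall i, u i <= C%:E * v i.
Local Notation "u <~ v" := (lesssim u v) (at level 70).

Lemma ls_le u v : (forall i, u i <= v i) -> u <~ v.
Proof. by move=> uv; exists 1%R => // i; rewrite mul1e. Qed.

Lemma ls_trans v u w : u <~ v -> v <~ w -> u <~ w.
Proof.
move=> [C C0 uv] [D D0 vw]; exists (C * D)%R => [|i]; first by rewrite mulr_gt0.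
by apply: (le_trans (uv i)); rewrite EFinM -muleA lee_wpmul2l// lee_fin ltW.
Qed.

Lemma ls_add u v w : u <~ w -> v <~ w -> (fun i => u i + v i) <~ w.
Proof.
move=> [C C0 uw] [D D0 vw]; exists (C + D)%R => [|i]; first by rewrite addr_gt0.
by rewrite EFinD ge0_muleDl ?lee_fin ?(ltW C0) ?(ltW D0)// leeD.
Qed.

Lemma ls_addr u v w : (forall i, 0 <= w i) -> u <~ v -> u <~ (fun i => v i + w i).
Proof.
move=> w0 uv; apply: (ls_trans uv); apply: ls_le => i; exact: leeDl.
Qed.

Lemma ls_addl u v w : (forall i, 0 <= v i) -> u <~ w -> u <~ (fun i => v i + w i).
Proof.
move=> w0 uv; apply: (ls_trans uv); apply: ls_le => i; exact: leeDr.
Qed.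

Lemma lsM u v (f : T -> R) : (forall i, (0 <= f i)%R) -> u <~ v ->
  (fun i => (f i)%:E * u i) <~ (fun i => (f i)%:E * v i).
Proof.
move=> f0 [C C0 uv]; exists C => // i.
by rewrite muleCA lee_wpmul2l// lee_fin.
Qed.

Lemma lsMr (f g : T -> R) v : (forall i, 0 <= v i) ->
  (fun i => (f i)%:E) <~ (fun i => (g i)%:E) ->
  (fun i => (f i)%:E * v i) <~ (fun i => (g i)%:E * v i).
Proof.
move=> v0 [C C0 fg]; exists C => // i.
by rewrite muleA lee_wpmul2r.
Qed.

End lesssim.
Notation "u <~ v" := (lesssim u v) (at level 70).

Lemma ls_comp (R : realType) (S T : Type) (g : S -> T) (u v : T -> \bar R) :
  u <~ v -> (fun i => u (g i)) <~ (fun i => v (g i)).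
Proof. by move=> [C C0 uv]; exists C. Qed.

Section discrete.
Variables (R : realType).
Local Open Scope ereal_scope.
Implicit Types (E F : ri_space R) (x y : int -> \bar R) (w v : R -> R).

Lemma lesssim_snorm (T : Type) E (x y : T -> int -> \bar R) :
  (fun p : T * int => x p.1 p.2) <~ (fun p => y p.1 p.2) ->
  (fun i => snorm E (x i)) <~ (fun i => snorm E (y i)).
Proof.
move=> [C C0 xy]; exists C => // i; rewrite -snormZ ?(ltW C0)//.
by apply: snorm_mono => k; exact: (xy (i, k)).
Qed.

Lemma geometric_le (r : R) : (0 < r < 1)%R -> \sum_(l <oo) (r ^+ l)%:E <= ((1 - r)^-1)%:E.
Proof.
move=> /andP[r0 r1]; apply: lime_le.
  by apply: is_cvg_nneseries => n _ _; rewrite lee_fin exprn_ge0 ?ltW.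
apply: nearW => N; rewrite sumEFin lee_fin.
have r1' : (0 < 1 - r)%R by rewrite subr_gt0.
rewrite -[leRHS]mul1r ler_pdivlMr//.
have -> : ((\sum_(0 <= i < N) r ^+ i) * (1 - r) = 1 - r ^+ N)%R.
  by rewrite -[RHS]opprB subrX1 big_mkord; ring.
by rewrite gerBl exprn_ge0 ?ltW.
Qed.

Lemma geometric_mul (r : R) (A : \bar R) : (0 < r < 1)%R -> 0 <= A ->
  \sum_(l <oo) A * (r ^+ l)%:E <= A * ((1 - r)^-1)%:E.
Proof.
move=> r01; have [r0 r1] := andP r01; case: A => [c| |]// c0; last first.
  by rewrite gt0_mulye ?leey// lte_fin invr_gt0 subr_gt0.
rewrite nneseriesZl; last by move=> l _; rewrite lee_fin exprn_ge0 ?(ltW r0).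
by apply: lee_wpmul2l; [rewrite lee_fin|exact: geometric_le].
Qed.

(** The direction s is 1 or -1, so that sums above and below k share their proofs; the term at k is
    included. *)
Definition tailsum (s : int) x (k : int) : \bar R := \sum_(l <oo) x (k + s * Posz l)%R.

Lemma tailsum_weight (s : int) a w : regular a w -> (`|s| = 1)%R -> (a * s%:~R < 0)%R ->
  (fun k : int => tailsum s (fun j => (w j%:~R)%:E) k) <~ (fun k => (w k%:~R)%:E).
Proof.
move=> hw s1 as0; have [C C0 [r r01 H]] := regular_decay hw s1 as0.
have [/ltW r0 r1] := andP r01; have [w0 _] := hw.
exists (C / (1 - r))%R => [|k]; first by rewrite divr_gt0// subr_gt0.
apply: (@le_trans _ _ (\sum_(l <oo) (C * w k%:~R)%:E * (r ^+ l)%:E)).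
  apply: lee_nneseries => [l _ _|l _]; first by rewrite lee_fin ltW.
  by rewrite -EFinM lee_fin mulrAC.
rewrite nneseriesZl; last by move=> l _; rewrite lee_fin exprn_ge0.
rewrite -EFinM mulrAC [leRHS]EFinM; apply: lee_wpmul2l; last exact: geometric_le.
by rewrite lee_fin mulr_ge0// ltW.
Qed.

Lemma snorm_shift E x (m : int) : (forall k, 0 <= x k) ->
  snorm E (fun k => x (k + m)%R) = snorm E x.
Proof.
have H y n : (forall k, 0 <= y k) -> snorm E (fun k => y (k + n)%R) <= snorm E y.
  move=> y0; apply: le_trans (le_trans (@snorm_inj _ E predT (fun k => k + n)%R y _) _).
  - exact: snorm_mono.
  - by move=> i j _ _ /addIr.
  - by apply: snorm_mono => k /=; rewrite (max_idPr (y0 k)).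
move=> x0; apply/eqP; rewrite eq_le H//=.
apply: le_trans (H (fun k => x (k + m)%R) (- m)%R _) => //.
by apply: snorm_mono => k; rewrite subrK.
Qed.

(* On each residue class modulo r the map m is injective. *)
Lemma snorm_coarse E x (m : int -> int) (r : nat) : (forall k, 0 <= x k) ->
  (forall i j, m i = m j -> (`|i - j| < r%:Z)%R) ->
  snorm E (fun k => x (m k)) <= r%:R%:E * snorm E x.
Proof.
move=> x0 mr.
have r0 : (0 < r)%N by have := mr 0%R 0%R erefl; rewrite subrr normr0.
pose p (i : nat) : pred int := fun k => (k %% r)%Z == i :> int.
apply: (@le_trans _ _ (\sum_(0 <= i < r) snorm E (cut (p i) (x \o m)))).
  apply: le_trans (snorm_sum _ _ _); apply: snorm_mono => k.
  have [i ir ki] : exists2 i : nat, (i < r)%N & (k %% r)%Z = i.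
    have k0 : (0 <= (k %% r)%Z)%R by apply: modz_ge0; lia.
    exists `|(k %% r)%Z|%N; last by rewrite gez0_abs.
    by rewrite -ltz_nat gez0_abs// ltz_pmod.
  rewrite (bigD1_seq i) ?iota_uniq ?mem_index_iota//= {1}/cut /p ki eqxx leeDl//.
  by apply: sume_ge0 => j _; rewrite /cut; case: ifP => //= _; exact: x0.
apply: (@le_trans _ _ (\sum_(0 <= i < r) snorm E x)).
  apply: lee_sum => i _; apply: le_trans (snorm_inj E _ _) _.
    move=> j l; rewrite !unfold_in /p => /eqP ji /eqP li /mr jl.
    have : (r%:Z %| (j - l)%R)%Z by rewrite -eqz_mod_dvd ji li.
    case/dvdzP => q jlq; move: jl; rewrite jlq normrM.
    case: (eqVneq q 0%R) jlq => [->|q0] jlq; first by rewrite mul0r in jlq => _; lia.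
    have : (1 <= `|q|)%R by rewrite -gtz0_ge1 normr_gt0.
    nia.
  by apply: snorm_mono => k /=; rewrite (max_idPr (x0 k)).
by rewrite sumr_const_nat subn0 mule_natl.
Qed.

Lemma snorm_single E x k : 0 <= x k ->
  snorm E (fun j => if j == k then x k else 0) <= (unit_norm E)%:E * x k.
Proof.
case: (x k) => [c| |]// c0; first by rewrite snorm_delta// mulrC.
by rewrite gt0_muley ?leey// lte_fin unit_norm_gt0.
Qed.

(** The norm of E is dominated by the l1 norm: a sequence is the sum of its one-cell pieces, each of
    norm [unit_norm E] times its value. All inner norms can thus be replaced by sums before Hardy is
    applied. *)
Lemma cut_tailsum E x (p : pred int) s k : (forall k, 0 <= x k) ->
  (forall j, p j -> exists l : nat, j = (k + s * l%:Z)%R) ->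
  snorm E (cut p x) <= (unit_norm E)%:E * tailsum s x k.
Proof.
move=> x0 pl.
apply: (@le_trans _ _ (snorm E (fun j => \sum_(l <oo)
    (if j == (k + s * l%:Z)%R then x (k + s * l%:Z)%R else 0)))).
  apply: snorm_mono => j; rewrite /cut; case: ifPn => [/pl[l ->]|_]; last first.
    by apply: nneseries_ge0 => l _ _; case: ifP.
  (* The partial sum of [l.+1] terms is the first to contain the term with index l. *)
  apply: le_trans (nneseries_lim_ge l.+1 _); last by move=> i _ _; case: ifP.
  by rewrite big_nat_recr//= eqxx leeDr// sume_ge0// => i _; case: ifP.
apply: le_trans (snorm_series _ _) _; first by move=> l j; case: ifP.
rewrite /tailsum -nneseriesZl//; apply: lee_nneseries => [l _ _|l _]; first exact: snorm_ge0.
exact: snorm_single.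
Qed.

(** The l-th term of the tail sum is a shift of the weighted sequence times the quotient of v at k
    and at k + s l. As a s > 0, the weight 1 / v decays in direction s, so the quotient is O(r^l)
    with r < 1. *)
Lemma hardy (T : Type) E (s : int) a v (x : T * int -> \bar R) :
  regular a v -> (`|s| = 1)%R -> (0 < a * s%:~R)%R -> (forall p, 0 <= x p) ->
  (fun i => snorm E (fun k => (v k%:~R)%:E * tailsum s (fun j => x (i, j)) k)) <~
  (fun i => snorm E (fun k => (v k%:~R)%:E * x (i, k))).
Proof.
move=> hv s1 as0 x0; have [v0 _] := hv.
have as0' : (- a * s%:~R < 0)%R by rewrite mulNr oppr_lt0.
have [C C0 [r r01 H]] := regular_decay (regularV hv) s1 as0'.
have [/ltW r0 r1] := andP r01.
exists (C / (1 - r))%R => [|i]; first by rewrite divr_gt0// subr_gt0.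
pose g k := (v k%:~R)%:E * x (i, k).
have g0 k : 0 <= g k by rewrite mule_ge0// lee_fin ltW.
apply: (@le_trans _ _ (snorm E (fun k => \sum_(l <oo) (C * r ^+ l)%:E * g (k + s * l%:Z)%R))).
  apply: snorm_mono => k; rewrite /tailsum -nneseriesZl//.
  apply: lee_nneseries => [l _ _|l _]; first by rewrite mule_ge0// lee_fin ltW.
  rewrite muleA lee_wpmul2r// -EFinM lee_fin.
  by have := H k l; rewrite ler_pdivlMr// mulrC ler_pdivrMr// => h; rewrite (le_trans h)//; lra.
apply: le_trans (snorm_series _ _) _.
  by move=> l k; rewrite mule_ge0// lee_fin mulr_ge0 ?exprn_ge0// ltW.
apply: (@le_trans _ _ (\sum_(l <oo) (C%:E * snorm E g) * (r ^+ l)%:E)).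
  apply: lee_nneseries => [l _ _|l _]; first exact: snorm_ge0.
  rewrite snormZ; last by rewrite mulr_ge0 ?exprn_ge0// ltW.
  rewrite (snorm_shift E (s * l%:Z)%R g0) EFinM -!muleA (muleC (snorm E g)) lexx//.
apply: le_trans (geometric_mul r01 _) _; last by rewrite EFinM muleAC.
by rewrite mule_ge0 ?snorm_ge0// lee_fin ltW.
Qed.

End discrete.

(** * Weighted norms over ranges of indices *)

Section weighted.
Variables (R : realType).
Local Open Scope ereal_scope.
Implicit Types (E F : ri_space R) (x y : int -> \bar R) (w v : R -> R) (p q : pred int).

Lemma leeD_scale (c d : R) (x a b : \bar R) : (0 < c)%R -> (0 < d)%R ->
  a <= c%:E * x -> b <= d%:E * x -> a + b <= (c + d)%:E * x.
Proof.
move=> c0 d0 ax bx; rewrite EFinD ge0_muleDl ?lee_fin ?(ltW c0) ?(ltW d0)//.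
exact: leeD.
Qed.

Definition wnorm F w p x : \bar R := snorm F (cut p (fun j => (w j%:~R)%:E * x j)).

Lemma wnorm_ge0 F w p x : 0 <= wnorm F w p x.
Proof. exact: snorm_ge0. Qed.

Lemma wnorm_mono F w p q x y : (forall k, 0 < w k)%R -> (forall k, 0 <= y k) ->
  (forall k, p k -> q k) -> (forall k, p k -> x k <= y k) -> wnorm F w p x <= wnorm F w q y.
Proof.
move=> w0 y0 pq xy; apply: snorm_mono => k; rewrite /cut.
have wk : 0 <= (w k%:~R)%:E by rewrite lee_fin ltW.
case: ifPn => [pk|_]; first by rewrite (pq _ pk) lee_wpmul2l// xy.
by case: ifP => // _; rewrite mule_ge0.
Qed.

Lemma wnormZ F w p (c : R) x : (0 <= c)%R ->
  wnorm F w p (fun k => c%:E * x k) = c%:E * wnorm F w p x.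
Proof.
move=> c0; rewrite /wnorm -snormZ//; congr snorm; apply/funext => k.
by rewrite /cut; case: ifP => _; rewrite ?mule0// muleCA.
Qed.

Lemma wnormD F w p x y : (forall k, 0 < w k)%R -> (forall k, 0 <= x k) -> (forall k, 0 <= y k) ->
  wnorm F w p (fun k => x k + y k) <= wnorm F w p x + wnorm F w p y.
Proof.
move=> w0 x0 y0; apply: le_trans (snormD _ _ _); apply: snorm_mono => k.
by rewrite /cut; case: ifP => _; rewrite ?adde0// ge0_muleDr.
Qed.

Lemma wnorm_split F w p p1 p2 x : (forall k, 0 < w k)%R -> (forall k, 0 <= x k) ->
  (forall k, p k -> p1 k || p2 k) ->
  wnorm F w p x <= wnorm F w p1 x + wnorm F w p2 x.
Proof.
move=> w0 x0 pp; apply: le_trans (snormD _ _ _); apply: snorm_mono => k.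
have wk : 0 <= (w k%:~R)%:E * x k by rewrite mule_ge0// lee_fin ltW.
rewrite /cut; have := pp k; case: (p k); case: (p1 k); case: (p2 k) => //= H;
  rewrite ?adde0 ?add0e ?leeDl ?adde_ge0//.
by have := H isT.
Qed.

Lemma wnorm_term F w p x k : p k ->
  (w k%:~R)%:E * x k <= ((unit_norm F)^-1)%:E * wnorm F w p x.
Proof.
move=> pk; have u0 := unit_norm_gt0 F.
rewrite lee_pdivlMl//.
by have := le_snorm F (cut p (fun j => (w j%:~R)%:E * x j)) k; rewrite {1}/cut pk muleC.
Qed.

Lemma wnorm1_gt0 F w p : (forall k, 0 < w k)%R -> (exists k, p k) ->
  0 < wnorm F w p (fun=> 1).
Proof.
move=> w0 [k pk]; have u0 := unit_norm_gt0 F.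
have := wnorm_term F w (fun=> 1) pk; rewrite mule1; apply: contraTT; rewrite -!leNgt => W0.
rewrite -ltNge; apply: le_lt_trans (lee_wpmul2l _ W0) _; first by rewrite lee_fin ltW ?invr_gt0.
by rewrite mule0 lte_fin.
Qed.

(** Homogeneity that includes c = +oo, where both sides are infinite because one index of p already
    has positive weight. It is applied to constants such as [qnorm x k], not known to be finite. *)
Lemma wnorm_const F w p (c : \bar R) : 0 <= c -> (forall k, 0 < w k)%R ->
  (exists k, p k) -> wnorm F w p (fun=> c) = c * wnorm F w p (fun=> 1).
Proof.
move=> c0 w0 pk; case: c c0 => [c| |]// c0.
  by rewrite -wnormZ//; congr wnorm; apply/funext => k; rewrite mule1.
rewrite gt0_mulye ?wnorm1_gt0//; case: pk => k pk.
have u0 := unit_norm_gt0 F.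
have := wnorm_term F w (fun=> +oo) pk; rewrite gt0_muley ?lte_fin//.
have := wnorm_ge0 F w p (fun=> +oo).
by case: (wnorm F w p (fun=> +oo)) => [r| |].
Qed.

Lemma wnorm_weight F w p (g : R -> R) x :
  wnorm F w p (fun k => (g k%:~R)%:E * x k) = wnorm F (fun t => w t * g t)%R p x.
Proof.
by rewrite /wnorm; congr snorm; apply/funext => k; rewrite /cut EFinM muleA.
Qed.

Lemma wnorm_bound F w p (g : R -> R) (A : \bar R) x : (forall t, 0 < w t)%R -> (forall t, 0 < g t)%R ->
  0 <= A -> (exists k, p k) -> (forall k, p k -> x k <= (g k%:~R)%:E * A) ->
  wnorm F w p x <= A * wnorm F (fun t => w t * g t)%R p (fun=> 1).
Proof.
move=> wp gp A0 pk xA; rewrite -wnorm_const//; last by move=> k; rewrite mulr_gt0.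
rewrite -wnorm_weight; apply: wnorm_mono => // k; rewrite mule_ge0 ?lee_fin//.
exact: ltW.
Qed.

Lemma tailsum_weightM a w (s : int) : regular a w -> (`|s| = 1)%R -> (a * s%:~R < 0)%R ->
  exists2 C : R, (0 < C)%R & forall (A : \bar R) x k, 0 <= A -> (forall k, 0 <= x k) ->
    (forall k, x k <= (w k%:~R)%:E * A) ->
    tailsum s x k <= C%:E * ((w k%:~R)%:E * A).
Proof.
move=> hw s1 as0; have [w0 _] := hw; have [C C0 H] := tailsum_weight hw s1 as0.
exists C => // -[A| |] x k// A0 x0 xA; last first.
  by rewrite gt0_muley ?lte_fin// gt0_muley ?lte_fin// leey.
apply: (@le_trans _ _ (\sum_(l <oo) A%:E * (w (k + s * Posz l)%:~R)%:E)).
  by apply: lee_nneseries => // l _; rewrite muleC xA.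
rewrite nneseriesZl; last by move=> l _; rewrite lee_fin ltW.
by rewrite [leRHS]muleA [leRHS]muleC; apply: lee_wpmul2l => //; exact: H.
Qed.

Lemma wnorm_tailsum F w p x (s k : int) : (forall k, 0 < w k)%R -> (forall k, 0 <= x k) ->
  (forall j, p j -> exists l : nat, j = (k + s * l%:Z)%R) ->
  wnorm F w p x <= (unit_norm F)%:E * tailsum s (fun j => (w j%:~R)%:E * x j) k.
Proof. by move=> w0 x0; apply: cut_tailsum => j; rewrite mule_ge0// lee_fin ltW. Qed.

(** A weight of positive exponent grows geometrically, so its last value dominates; [wnorm_above] is
    the mirror image. *)
Lemma wnorm_below a F w : regular a w -> (0 < a)%R ->
  (fun k => wnorm F w (fun j => j <= k)%R (fun=> 1)) <~ (fun k : int => (w k%:~R)%:E).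
Proof.
move=> hw a0; have [w0 _] := hw.
have [||C C0 H] := tailsum_weight (s := -1) hw; rewrite ?mulrN1 ?oppr_lt0//.
exists (unit_norm F * C)%R => [|k]; first by rewrite mulr_gt0// unit_norm_gt0.
apply: le_trans (wnorm_tailsum (s := -1) (k := k) F w0 _ _) _ => //.
  by move=> j jk; exists `|k - j|%N; lia.
rewrite EFinM -muleA lee_wpmul2l//; first by rewrite lee_fin ltW ?unit_norm_gt0.
by apply: le_trans (H k); apply: lee_nneseries => [l _ _|l _]; rewrite mule1 ?lee_fin ?(ltW (w0 _)).
Qed.

Lemma wnorm_above a F w : regular a w -> (a < 0)%R ->
  (fun k => wnorm F w (fun j => k <= j)%R (fun=> 1)) <~ (fun k : int => (w k%:~R)%:E).
Proof.
move=> hw a0; have [w0 _] := hw.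
have [||C C0 H] := tailsum_weight (s := 1) hw; rewrite ?mulr1//.
exists (unit_norm F * C)%R => [|k]; first by rewrite mulr_gt0// unit_norm_gt0.
apply: le_trans (wnorm_tailsum (s := 1) (k := k) F w0 _ _) _ => //.
  by move=> j jk; exists `|j - k|%N; lia.
rewrite EFinM -muleA lee_wpmul2l//; first by rewrite lee_fin ltW ?unit_norm_gt0.
by apply: le_trans (H k); apply: lee_nneseries => [l _ _|l _]; rewrite mule1 ?lee_fin ?(ltW (w0 _)).
Qed.

Lemma hardy_below (T : Type) E F a v w (x : T -> int -> \bar R) :
  regular a v -> (a < 0)%R -> (forall k, 0 < w k)%R -> (forall i k, 0 <= x i k) ->
  (fun i => snorm E (fun k => (v k%:~R)%:E * wnorm F w (fun j => j <= k)%R (x i))) <~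
  (fun i => snorm E (fun k => (v k%:~R)%:E * ((w k%:~R)%:E * x i k))).
Proof.
move=> hv a0 w0 x0; have [v0 _] := hv.
have [|||C C0 H] := @hardy R T E (-1) a v (fun z => (w z.2%:~R)%:E * x z.1 z.2) hv.
- by [].
- by rewrite mulrN1 oppr_gt0.
- by move=> z; rewrite mule_ge0// lee_fin ltW.
exists (unit_norm F * C)%R => [|i]; first by rewrite mulr_gt0// unit_norm_gt0.
have u0 : (0 <= unit_norm F)%R by rewrite ltW ?unit_norm_gt0.
rewrite EFinM -muleA; apply: le_trans (lee_wpmul2l _ (H i)); last by rewrite lee_fin.
rewrite -snormZ//; apply: snorm_mono => k; rewrite muleCA lee_wpmul2l ?lee_fin ?(ltW (v0 _))//.
apply: (wnorm_tailsum (s := -1) (k := k) F w0) => // j jk.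
by exists `|k - j|%N; lia.
Qed.

End weighted.

(** * Discrete Holmstedt formula *)

(** Packing the sign condition with the sequence lets nonnegative sequences serve as an index type
    of [<~]. *)
Definition nnseq (R : realType) := {x : int -> \bar R | forall k, (0 <= x k)%E}.

Section holmstedt.
Variables (R : realType) (E0 E1 F0 F1 : ri_space R) (w0 w1 b0 b1 B0 B1 : R -> R).
Variables (t0 t1 : R).
Hypotheses (t0_gt0 : 0 < t0) (t01 : t0 < t1) (t1_lt1 : t1 < 1).
Hypotheses (hw0 : regular (- t0) w0) (hw1 : regular (- t1) w1).
Hypotheses (hb0 : regular 0 b0) (hb1 : regular 0 b1).
Hypotheses (hB0 : regular 0 B0) (hB1 : regular 0 B1).
Local Open Scope ereal_scope.
Local Notation ge k := (fun j : int => (k <= j)%R).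
Local Notation le k := (fun j : int => (j <= k)%R).
Local Notation btw k l := (fun j : int => (k <= j <= l)%R).
Local Notation at_ w k := ((w (k : int)%:~R)%:E).
Hypotheses (B0u : (fun k => wnorm E0 b0 (ge k) (fun=> 1)) <~ (fun k : int => at_ B0 k)).
Hypotheses (B0l : (fun k : int => at_ B0 k) <~ (fun k => wnorm E0 b0 (ge k) (fun=> 1))).
Hypotheses (B1u : (fun k => wnorm E1 b1 (ge k) (fun=> 1)) <~ (fun k : int => at_ B1 k)).
Hypotheses (B1l : (fun k : int => at_ B1 k) <~ (fun k => wnorm E1 b1 (ge k) (fun=> 1))).
Implicit Types (x : int -> \bar R) (k : int).

(** [qnorm], [p0norm] and [p1norm] are the quantities Q, P and S of the overview; [y0norm] and
    [y1norm] are the discrete quasi-norms of the two limiting spaces. *)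
Definition qnorm x k := wnorm F0 w0 (le k) x.
Definition p0norm x k := wnorm E0 b0 (le k) (qnorm x).
Definition p1norm x k := wnorm E1 b1 (ge k) (fun j => wnorm F1 w1 (btw k j) x).
Definition y0norm x := wnorm E0 b0 predT (qnorm x).
Definition y1norm x := wnorm E1 b1 predT (fun j => wnorm F1 w1 (le j) x).
(* The function rho of the theorem, on the logarithmic scale: the factor
   u `^ (theta1 - theta0) is part of w0 / w1. *)
Definition rho_log (t : R) : R := (w0 t * B0 t / (w1 t * B1 t))%R.
(* If x k = K(e^k, f), then holmstedt x k is equivalent to K(rho(e^k), f) for the
   couple of the two limiting spaces, see [holmstedt_le_K] and [K_le_holmstedt]. *)
Definition holmstedt x k := p0norm x k + at_ B0 k * qnorm x k + at_ rho_log k * p1norm x k.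

Let w0p t : (0 < w0 t)%R. Proof. by have [] := hw0. Qed.
Let w1p t : (0 < w1 t)%R. Proof. by have [] := hw1. Qed.
Let b0p t : (0 < b0 t)%R. Proof. by have [] := hb0. Qed.
Let b1p t : (0 < b1 t)%R. Proof. by have [] := hb1. Qed.
Let B0p t : (0 < B0 t)%R. Proof. by have [] := hB0. Qed.
Let B1p t : (0 < B1 t)%R. Proof. by have [] := hB1. Qed.

Lemma rho_log_gt0 t : (0 < rho_log t)%R.
Proof. by rewrite /rho_log divr_gt0 ?mulr_gt0. Qed.

Lemma regular_rho_log : regular (t1 - t0) rho_log.
Proof.
have := regularM (regularM hw0 hB0) (regularV (regularM hw1 hB1)).
by rewrite !addr0 opprK addrC.
Qed.

Lemma qnorm_ge0 x k : 0 <= qnorm x k. Proof. exact: wnorm_ge0. Qed.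
Let at_ge0 (w : R -> R) k : (forall t, 0 < w t)%R -> 0 <= at_ w k.
Proof. by move=> wp; rewrite lee_fin ltW. Qed.

Let ex_ge k : exists j, (ge k) j. Proof. by exists k. Qed.

Lemma b0_le : (fun k => at_ b0 k) <~ (fun k => at_ B0 k).
Proof.
apply: ls_trans B0u; exists (unit_norm E0)^-1%R; first by rewrite invr_gt0 unit_norm_gt0.
by move=> k; have := @wnorm_term _ E0 b0 (ge k) (fun=> 1) k (lexx k); rewrite mule1.
Qed.

Lemma b1_le : (fun k => at_ b1 k) <~ (fun k => at_ B1 k).
Proof.
apply: ls_trans B1u; exists (unit_norm E1)^-1%R; first by rewrite invr_gt0 unit_norm_gt0.
by move=> k; have := @wnorm_term _ E1 b1 (ge k) (fun=> 1) k (lexx k); rewrite mule1.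
Qed.

Lemma term_qnorm : (fun z : nnseq R * int => at_ w0 z.2 * sval z.1 z.2) <~
  (fun z => qnorm (sval z.1) z.2).
Proof.
exists (unit_norm F0)^-1%R; first by rewrite invr_gt0 unit_norm_gt0.
by move=> [x k]; exact: (@wnorm_term _ F0 w0 (le k) (sval x) k (lexx k)).
Qed.

(** Every inner range from k to j contains k, so the inner norm is bounded below by a constant
    independent of j, and the E1-norm of b1 over j >= k is comparable to B1. *)
Lemma term_p1norm : (fun z : nnseq R * int => at_ B1 z.2 * (at_ w1 z.2 * sval z.1 z.2)) <~
  (fun z => p1norm (sval z.1) z.2).
Proof.
have [C C0 H] := B1l; have u0 := unit_norm_gt0 F1.
exists (C * (unit_norm F1)^-1)%R => [|[[x x0] k]/=]; first by rewrite mulr_gt0 ?invr_gt0.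
have wx0 : 0 <= at_ w1 k * x k by rewrite mule_ge0 ?at_ge0.
apply: (@le_trans _ _ (C%:E * wnorm E1 b1 (ge k) (fun=> 1) * (at_ w1 k * x k))).
  by apply: lee_wpmul2r => //; exact: H.
rewrite EFinM -!muleA; apply: lee_wpmul2l; first by rewrite lee_fin ltW.
rewrite muleC -wnorm_const// -wnormZ ?invr_ge0 ?(ltW u0)//.
apply: wnorm_mono => // [j|j kj]; first by rewrite mule_ge0 ?wnorm_ge0// lee_fin invr_ge0 ltW.
by apply: wnorm_term; rewrite lexx.
Qed.

(** Bound the inner norm by a sum and interchange: the term at k + l is present exactly for j >= k +
    l, so its outer norm is the tail norm B1 at k + l. *)
Lemma p1norm_tailsum : (fun z : nnseq R * int => p1norm (sval z.1) z.2) <~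
  (fun z => tailsum 1 (fun j => at_ B1 j * (at_ w1 j * sval z.1 j)) z.2).
Proof.
have [C C0 H] := B1u; have u0 := unit_norm_gt0 F1.
exists (unit_norm F1 * C)%R => [|[[x x0] k]/=]; first by rewrite mulr_gt0.
have wx0 j : 0 <= at_ w1 j * x j by rewrite mule_ge0 ?at_ge0.
pose X l := at_ w1 (k + 1 * Posz l)%R * x (k + 1 * Posz l)%R.
apply: (@le_trans _ _ ((unit_norm F1)%:E *
    snorm E1 (fun j => \sum_(l <oo) (cut (ge (k + 1 * Posz l)%R) (fun j => at_ b1 j * X l) j)))).
  rewrite -snormZ ?(ltW u0)//; apply: snorm_mono => j; rewrite /cut; case: ifPn => kj; last first.
    by rewrite mule_ge0 ?lee_fin ?(ltW u0)// nneseries_ge0// => l _ _; case: ifP => // _; rewrite !mule_ge0 ?at_ge0.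
  (* The condition i <= j is kept in the sequence instead of the range: at i = k + l it becomes the
     cut j >= k + l in the outer variable. *)
  have -> : wnorm F1 w1 (btw k j) x = snorm F1 (cut (btw k j) (cut (le j) (fun i => at_ w1 i * x i))).
    by congr snorm; apply/funext => i; rewrite /cut; case: ifP => // /andP[_ ->].
  have cut0 i : 0 <= cut (le j) (fun i => at_ w1 i * x i) i by rewrite /cut; case: ifP.
  have h : snorm F1 (cut (btw k j) (cut (le j) (fun i => at_ w1 i * x i))) <=
      (unit_norm F1)%:E * tailsum 1 (cut (le j) (fun i => at_ w1 i * x i)) k.
    by apply: cut_tailsum => // i /andP[ki _]; exists `|i - k|%N; lia.
  apply: le_trans (lee_wpmul2l (at_ge0 j b1p) h) _.
  rewrite muleCA; apply: lee_wpmul2l; first by rewrite lee_fin ltW.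
  rewrite /tailsum -nneseriesZl//; apply: lee_nneseries => [l _ _|l _].
    by rewrite mule_ge0 ?at_ge0.
  by rewrite /cut; case: ifP; rewrite ?mule0.
rewrite EFinM -muleA; apply: lee_wpmul2l; first by rewrite lee_fin ltW.
apply: le_trans (snorm_series _ _) _.
  by move=> l j; rewrite /cut; case: ifP => // _; rewrite mule_ge0 ?at_ge0// wx0.
rewrite /tailsum -nneseriesZl; last by move=> l _; rewrite mule_ge0 ?at_ge0// wx0.
apply: lee_nneseries => [l _ _|l _]; first exact: snorm_ge0.
rewrite -[leLHS]/(wnorm E1 b1 _ (fun=> X l)) wnorm_const//; last exact: wx0.
rewrite muleA [leRHS]muleC; apply: lee_wpmul2l; first exact: wx0.
exact: H.
Qed.

Lemma p0norm_y0 : (fun z : nnseq R * int => p0norm (sval z.1) z.2) <~ (fun z => y0norm (sval z.1)).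
Proof.
by apply: ls_le => -[x k]/=; apply: wnorm_mono => // j; exact: qnorm_ge0.
Qed.

(** [qnorm x] is nondecreasing, hence at least [qnorm x k] on j >= k, where the norm of b0 is
    comparable to B0. *)
Lemma qnorm_y0 : (fun z : nnseq R * int => at_ B0 z.2 * qnorm (sval z.1) z.2) <~ (fun z => y0norm (sval z.1)).
Proof.
have [C C0 H] := B0l; exists C => // -[[x x0] k]/=.
apply: (@le_trans _ _ (C%:E * (qnorm x k * wnorm E0 b0 (ge k) (fun=> 1)))).
  by rewrite (muleC (qnorm x k)) muleA; apply: lee_wpmul2r; [exact: qnorm_ge0|exact: H].
apply: lee_wpmul2l; first by rewrite lee_fin ltW.
rewrite -wnorm_const ?qnorm_ge0//; apply: wnorm_mono => // [j|j kj]; first exact: qnorm_ge0.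
by apply: wnorm_mono => // i /= ik; exact: le_trans kj.
Qed.

Lemma term_y0 : (fun z : nnseq R * int => at_ B0 z.2 * (at_ w0 z.2 * sval z.1 z.2)) <~ (fun z => y0norm (sval z.1)).
Proof.
apply: ls_trans qnorm_y0; apply: lsM term_qnorm => z; exact: ltW.
Qed.

Lemma term_y1 : (fun z : nnseq R * int => at_ B1 z.2 * (at_ w1 z.2 * sval z.1 z.2)) <~ (fun z => y1norm (sval z.1)).
Proof.
apply: (ls_trans term_p1norm); apply: ls_le => -[[x x0] k]/=.
apply: wnorm_mono => // [j|j kj]; first exact: wnorm_ge0.
by apply: wnorm_mono => // i /andP[].
Qed.

Lemma p1norm_y1 : (fun z : nnseq R * int => p1norm (sval z.1) z.2) <~ (fun z => y1norm (sval z.1)).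
Proof.
apply: ls_le => -[[x x0] k]/=.
apply: wnorm_mono => // [j|j kj]; first exact: wnorm_ge0.
by apply: wnorm_mono => // i /andP[].
Qed.

(** By [term_y0] each term B1 w1 x at j is at most a constant times [y0norm x] / rho at j. As 1 /
    rho has exponent t0 - t1 < 0, its tail sum from k is comparable to 1 / rho at k. *)
Lemma p1norm_y0 : (fun z : nnseq R * int => at_ rho_log z.2 * p1norm (sval z.1) z.2) <~ (fun z => y0norm (sval z.1)).
Proof.
have [C C0 H] := term_y0.
have V := regularV regular_rho_log.
have [||D D0 HD] := tailsum_weightM (s := 1) V; rewrite ?mulr1 ?oppr_lt0 ?subr_gt0//.
apply: (ls_trans (lsM _ p1norm_tailsum)); first by move=> z; rewrite ltW ?rho_log_gt0.
exists (D * C)%R => [|[[x x0] k]/=]; first by rewrite mulr_gt0.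
have rk := rho_log_gt0 k%:~R.
rewrite -lee_pdivlMl//.
apply: le_trans (HD (C%:E * y0norm x) _ k _ _ _) _; last by rewrite muleCA EFinM -!muleA.
- by rewrite mule_ge0 ?wnorm_ge0// lee_fin ltW.
- by move=> j; rewrite !mule_ge0 ?at_ge0.
move=> j; rewrite lee_pdivlMl ?rho_log_gt0//; apply: le_trans (H (exist _ x x0, j)).
rewrite /= !muleA -!EFinM; apply: lee_wpmul2r => //; rewrite lee_fin /rho_log.
rewrite le_eqVlt; apply/orP; left; apply/eqP.
by field; rewrite !gt_eqF.
Qed.

Lemma bound_y1 : exists2 C : R, (0 < C)%R & forall x, (forall k, 0 <= x k) -> forall k,
   x k <= C%:E * (((w1 k%:~R * B1 k%:~R)^-1)%:E * y1norm x).
Proof.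
have [C C0 H] := term_y1; exists C => // x x0 k.
rewrite muleCA lee_pdivlMl ?mulr_gt0//.
by have := H (exist _ x x0, k); rewrite /= EFinM muleA (muleC (at_ B1 k)).
Qed.

(** The pointwise bound [bound_y1] turns the weight w0 into w0 / (w1 B1), of exponent t1 - t0 > 0,
    so the sum over j <= k is governed by its last term. [p0norm_y1] repeats this with the
    additional weight b0 <= C B0. *)
Lemma qnorm_y1 : (fun z : nnseq R * int => qnorm (sval z.1) z.2) <~
   (fun z => at_ (fun t => w0 t / (w1 t * B1 t))%R z.2 * y1norm (sval z.1)).
Proof.
have [C C0 H] := bound_y1.
have V := regularM hw0 (regularV (regularM hw1 hB1)).
have [|D D0 HD] := wnorm_below F0 V.
  by rewrite addr0 opprK addrC subr_gt0.
exists (C * D)%R => [|[[x x0] k]/=]; first by rewrite mulr_gt0.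
apply: (@le_trans _ _ (C%:E * y1norm x * wnorm F0 (fun t => w0 t / (w1 t * B1 t))%R (le k) (fun=> 1))).
  apply: wnorm_bound => //.
  - by move=> j; rewrite invr_gt0 mulr_gt0.
  - by rewrite mule_ge0 ?wnorm_ge0// lee_fin ltW.
  - by exists k.
  - by move=> j _; rewrite muleCA; exact: H.
rewrite EFinM -!muleA; apply: lee_wpmul2l; first by rewrite lee_fin ltW.
by rewrite muleC muleA; apply: lee_wpmul2r; [exact: wnorm_ge0|exact: HD].
Qed.

Lemma B0qnorm_y1 : (fun z : nnseq R * int => at_ B0 z.2 * qnorm (sval z.1) z.2) <~
   (fun z => at_ rho_log z.2 * y1norm (sval z.1)).
Proof.
apply: (ls_trans (lsM (f := fun z : nnseq R * int => B0 z.2%:~R) _ qnorm_y1)); first by move=> z; exact: ltW.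
apply: ls_le => -[[x x0] k]/=; rewrite muleA -EFinM.
by rewrite /rho_log mulrCA mulrA.
Qed.

Lemma p0norm_y1 : (fun z : nnseq R * int => p0norm (sval z.1) z.2) <~
   (fun z => at_ rho_log z.2 * y1norm (sval z.1)).
Proof.
have [C C0 H] := qnorm_y1.
have V := regularM hb0 (regularM hw0 (regularV (regularM hw1 hB1))).
have [|D D0 HD] := wnorm_below E0 V.
  by rewrite add0r addr0 opprK addrC subr_gt0.
have [D' D'0 HD'] := b0_le.
exists (C * D * D')%R => [|[[x x0] k]/=]; first by rewrite !mulr_gt0.
apply: (@le_trans _ _ (C%:E * y1norm x * wnorm E0 (fun t => b0 t * (w0 t / (w1 t * B1 t)))%R (le k) (fun=> 1))).
  apply: wnorm_bound => //.
  - by move=> j; rewrite divr_gt0 ?mulr_gt0.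
  - by rewrite mule_ge0 ?wnorm_ge0// lee_fin ltW.
  - by exists k.
  - by move=> j _; rewrite muleCA; exact: (H (exist _ x x0, j)).
rewrite (muleC C%:E) -muleA [leRHS]muleA [leRHS]muleC; apply: lee_wpmul2l; first exact: wnorm_ge0.
rewrite !EFinM -!muleA; apply: lee_wpmul2l; first by rewrite lee_fin ltW.
apply: (le_trans (HD k)); apply: lee_wpmul2l; first by rewrite lee_fin ltW.
have := HD' k; rewrite -!EFinM !lee_fin /rho_log => h.
rewrite [leRHS](_ : _ = (D' * B0 k%:~R) * (w0 k%:~R / (w1 k%:~R * B1 k%:~R)))%R; last by ring.
by rewrite ler_pM2r// divr_gt0 ?mulr_gt0.
Qed.

Lemma holmstedt_y0 : (fun z : nnseq R * int => holmstedt (sval z.1) z.2) <~ (fun z => y0norm (sval z.1)).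
Proof. by apply: ls_add; [apply: ls_add; [exact: p0norm_y0|exact: qnorm_y0]|exact: p1norm_y0]. Qed.

Lemma holmstedt_y1 : (fun z : nnseq R * int => holmstedt (sval z.1) z.2) <~ (fun z => at_ rho_log z.2 * y1norm (sval z.1)).
Proof.
apply: ls_add; [apply: ls_add; [exact: p0norm_y1|exact: B0qnorm_y1]|].
by apply: lsM p1norm_y1 => z; rewrite ltW ?rho_log_gt0.
Qed.

(** Up to constants, y is the sequence of the part f0 of f split at e^k. Since w0 has exponent - t0
    < 0, the constant bound x k beyond k adds only w0 k x k, hence [qnorm y] stops growing at k, and
    the norm of b0 over j >= k contributes the factor B0. *)
Lemma y0norm_le_holmstedt : exists2 C : R, (0 < C)%R & forall x y k,
  (forall j, 0 <= x j) -> (forall j, 0 <= y j) ->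
  (forall j, (j <= k)%R -> y j <= x j) -> (forall j, (k <= j)%R -> y j <= x k) ->
  y0norm y <= C%:E * holmstedt x k.
Proof.
have nt0 : (- t0 < 0)%R by rewrite oppr_lt0.
have [D D0 HD] := wnorm_above F0 hw0 nt0.
have [D1 D10 HD1] := term_qnorm.
have [D2 D20 HD2] := B0u.
pose C := (1 + D * D1)%R.
have C0 : (0 < C)%R by rewrite addr_gt0 ?mulr_gt0.
exists (1 + C * D2)%R => [|x y k x0 y0 yx yk]; first by rewrite addr_gt0 ?mulr_gt0.
have q1 j : (k <= j)%R -> qnorm y j <= C%:E * qnorm x k.
  move=> kj; apply: le_trans (wnorm_split F0 (p1 := le k) (p2 := ge k) w0p y0 _) _.
    by move=> i _; case: (leP i k) => // /ltW.
  apply: leeD_scale; rewrite ?mulr_gt0 ?mul1e//.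
    by apply: wnorm_mono.
  apply: (@le_trans _ _ (x k * wnorm F0 w0 (ge k) (fun=> 1))).
    by rewrite -wnorm_const//; apply: wnorm_mono.
  apply: le_trans (lee_wpmul2l (x0 k) (HD k)) _.
  rewrite muleCA EFinM -!muleA; apply: lee_wpmul2l; first by rewrite lee_fin ltW.
  by rewrite muleC; exact: (HD1 (exist _ x x0, k)).
apply: le_trans (wnorm_split E0 (p1 := le k) (p2 := ge k) b0p _ _) _.
- by move=> j; exact: qnorm_ge0.
- by move=> i _; case: (leP i k) => // /ltW.
have h0 : 0 <= holmstedt x k.
  by rewrite /holmstedt !adde_ge0 ?mule_ge0 ?wnorm_ge0 ?at_ge0//; exact: rho_log_gt0.
apply: leeD_scale; rewrite ?mulr_gt0 ?mul1e//.
  apply: (@le_trans _ _ (p0norm x k)).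
    apply: wnorm_mono => // [j|j jk]; first exact: qnorm_ge0.
    by apply: wnorm_mono => // i ij; apply: yx; exact: le_trans jk.
  rewrite /holmstedt -addeA leeDl// adde_ge0// mule_ge0 ?wnorm_ge0 ?at_ge0//; exact: rho_log_gt0.
apply: (@le_trans _ _ (C%:E * (qnorm x k * wnorm E0 b0 (ge k) (fun=> 1)))).
  rewrite -wnorm_const ?qnorm_ge0// -wnormZ ?(ltW C0)//.
  apply: wnorm_mono => // j; rewrite mule_ge0 ?qnorm_ge0// lee_fin; exact: ltW.
rewrite EFinM -muleA; apply: lee_wpmul2l; first by rewrite lee_fin ltW.
apply: le_trans (lee_wpmul2l (qnorm_ge0 x k) (HD2 k)) _.
rewrite muleCA; apply: lee_wpmul2l; first by rewrite lee_fin ltW.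
rewrite muleC /holmstedt -addeA addeCA leeDl// adde_ge0 ?wnorm_ge0// mule_ge0 ?wnorm_ge0 ?at_ge0//; exact: rho_log_gt0.
Qed.

(** Up to constants, z is the sequence of the part f1 of f split at e^k. Since t1 < 1, the weight
    e^j w1 j has positive exponent; all indices below k together contribute at most a multiple of B1
    w1 x at k, which [term_p1norm] bounds by [p1norm x k]. *)
Lemma y1norm_le_p1norm : exists2 C : R, (0 < C)%R & forall x z k,
  (forall j, 0 <= x j) -> (forall j, 0 <= z j) ->
  (forall j, (k <= j)%R -> z j <= x j) ->
  (forall j, (j <= k)%R -> z j <= (expR (j%:~R - k%:~R))%:E * x k) ->
  y1norm z <= C%:E * p1norm x k.
Proof.
have V := regularM hw1 (regular_expR (1 : R)).
have t1' : (0 < - t1 + 1)%R by rewrite addrC subr_gt0.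
have [D D0 HD] := wnorm_below F1 V t1'.
have V2 := regularM hb1 V.
have t1'' : (0 < 0 + (- t1 + 1))%R by rewrite add0r.
have [D2 D20 HD2] := wnorm_below E1 V2 t1''.
have [D1 D10 HD1] := term_p1norm.
have [D3 D30 HD3] := b1_le.
have u0 := unit_norm_gt0 F1.
pose C := (D / unit_norm F1 + 1)%R.
have C0 : (0 < C)%R by rewrite addr_gt0 ?divr_gt0.
exists (D * D2 * D3 * D1 + C)%R => [|x z k x0 z0 zx zk]; first by rewrite addr_gt0 ?mulr_gt0.
(* The part of the bound on z that does not depend on j: below k one has z j <= e^j A. *)
pose A := (expR (- k%:~R))%:E * x k.
have A0 : 0 <= A by rewrite mule_ge0 ?lee_fin ?expR_ge0.
have zA i : (i <= k)%R -> z i <= (expR (1 * i%:~R))%:E * A.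
  by move=> ik; apply: (le_trans (zk _ ik)); rewrite /A muleA -EFinM -expRD mul1r.
have q1 j : (j <= k)%R -> wnorm F1 w1 (le j) z <= at_ (fun t => w1 t * expR (1 * t))%R j * (D%:E * A).
  move=> jk; apply: (@le_trans _ _ (A * wnorm F1 (fun t => w1 t * expR (1 * t))%R (le j) (fun=> 1))).
    apply: (wnorm_bound F1 (g := fun t => expR (1 * t))) => //.
    - by move=> t; exact: expR_gt0.
    - by exists j.
    - by move=> i ij; apply: zA; exact: le_trans jk.
  apply: le_trans (lee_wpmul2l A0 (HD j)) _.
  by rewrite muleC (muleC D%:E) -muleA.
have kE : at_ (fun t => w1 t * expR (1 * t))%R k * A = at_ w1 k * x k.
  by rewrite /A muleA -EFinM -mulrA -expRD mul1r subrr expR0 mulr1.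
have q2 j : (k <= j)%R -> wnorm F1 w1 (le j) z <= C%:E * wnorm F1 w1 (btw k j) x.
  move=> kj; apply: le_trans (wnorm_split F1 (p1 := le k) (p2 := btw k j) w1p z0 _) _.
    by move=> i ij; case: (leP i k) => //= /ltW ->; rewrite ij.
  apply: leeD_scale; rewrite ?divr_gt0 ?mul1e//; last first.
    by apply: wnorm_mono => // i /andP[ki _]; exact: zx.
  apply: (le_trans (q1 _ (lexx k))); rewrite muleCA kE EFinM -muleA.
  apply: lee_wpmul2l; first by rewrite lee_fin ltW.
  by apply: wnorm_term; rewrite lexx.
apply: le_trans (wnorm_split E1 (p1 := le k) (p2 := ge k) b1p _ _) _.
- by move=> j; exact: wnorm_ge0.
- by move=> i _; case: (leP i k) => // /ltW.
apply: leeD_scale; rewrite ?mulr_gt0//; last first.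
  rewrite /p1norm -wnormZ ?(ltW C0)//; apply: wnorm_mono => // j.
  by rewrite mule_ge0 ?wnorm_ge0// lee_fin ltW.
apply: (@le_trans _ _ (D%:E * A * wnorm E1 (fun t => b1 t * (w1 t * expR (1 * t)))%R (le k) (fun=> 1))).
  apply: (wnorm_bound E1 (g := fun t => (w1 t * expR (1 * t))%R)) => //.
  - by move=> t; rewrite mulr_gt0 ?expR_gt0.
  - by rewrite mule_ge0// lee_fin ltW.
  - by exists k.
apply: le_trans (lee_wpmul2l _ (HD2 k)) _; first by rewrite mule_ge0// lee_fin ltW.
apply: (@le_trans _ _ ((D * D2)%:E * (at_ b1 k * (at_ w1 k * x k)))).
  by rewrite muleACA -EFinM (muleC A) -kE [X in _ <= _ * X]muleA -EFinM lexx.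
rewrite [leRHS](_ : _ = (D * D2)%:E * (D3%:E * (D1%:E * p1norm x k))); last first.
  by rewrite !muleA -!EFinM.
apply: lee_wpmul2l; first by rewrite lee_fin ltW ?mulr_gt0.
apply: (@le_trans _ _ (D3%:E * (at_ B1 k * (at_ w1 k * x k)))).
  by rewrite [leRHS]muleA; apply: lee_wpmul2r; [rewrite mule_ge0 ?at_ge0|exact: HD3].
apply: lee_wpmul2l; first by rewrite lee_fin ltW.
exact: (HD1 (exist _ x x0, k)).
Qed.

(** * The outer norm of the Holmstedt terms *)

Section hol_norm.
Variables (E : ri_space R) (v : R -> R) (c : R).
Hypothesis hv : regular c v.

Let vp t : (0 < v t)%R. Proof. by have [] := hv. Qed.

(** The functional g is a parameter so that the three summands of [holmstedt] can be compared under
    the same outer norm. The exponent c of v will be - theta (theta1 - theta0). *)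
Definition vnorm (g : (int -> \bar R) -> int -> \bar R) (z : nnseq R) : \bar R :=
  snorm E (fun k => at_ v k * g (sval z) k).

Lemma vnorm_ge0 g z : 0 <= vnorm g z. Proof. exact: snorm_ge0. Qed.

Lemma vnorm_le g h : (fun z : nnseq R * int => g (sval z.1) z.2) <~ (fun z => h (sval z.1) z.2) ->
  vnorm g <~ vnorm h.
Proof.
move=> gh; apply: lesssim_snorm.
by apply: (lsM (f := fun z : nnseq R * int => v z.2%:~R) _ gh) => z; exact: ltW.
Qed.

Lemma vnorm_p0norm : (c < 0)%R -> vnorm p0norm <~ vnorm (fun x k => at_ B0 k * qnorm x k).
Proof.
move=> c0; apply: (@ls_trans _ _ (vnorm (fun x k => at_ b0 k * qnorm x k))).
  by apply: (hardy_below E E0 (x := fun z : nnseq R => qnorm (sval z)) hv c0 b0p) => z k; exact: qnorm_ge0.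
apply: vnorm_le; apply: lsMr; first by move=> z; exact: qnorm_ge0.
exact: (ls_comp (fun z : nnseq R * int => z.2) b0_le).
Qed.

Lemma vnorm_qnorm : (c < 0)%R ->
  vnorm (fun x k => at_ B0 k * qnorm x k) <~ vnorm (fun x k => at_ B0 k * (at_ w0 k * x k)).
Proof.
move=> c0; have V := regularM hv hB0; rewrite addr0 in V.
have [C C0 H] := hardy_below E F0 (x := fun z : nnseq R => sval z) V c0 w0p (fun z k => svalP z k).
exists C => // z; apply: le_trans (le_trans (H z) _); rewrite le_eqVlt; apply/orP; left; apply/eqP.
  by congr snorm; apply/funext => k; rewrite muleA -EFinM.
by congr (_ * snorm E _); apply/funext => k; rewrite [RHS]muleA -EFinM.
Qed.

(** Hardy towards larger indices for the weight v rho, of exponent c + (t1 - t0); then rho B1 w1 =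
    B0 w0 by definition of rho. *)
Lemma vnorm_p1norm : (0 < c + (t1 - t0))%R ->
  vnorm (fun x k => at_ rho_log k * p1norm x k) <~ vnorm (fun x k => at_ B0 k * (at_ w0 k * x k)).
Proof.
move=> c0; have V := regularM hv regular_rho_log.
apply: ls_trans.
  apply: (@vnorm_le _ (fun x k => at_ rho_log k * tailsum 1 (fun j => at_ B1 j * (at_ w1 j * x j)) k)).
  by apply: lsM p1norm_tailsum => z; rewrite ltW ?rho_log_gt0.
have [|||C C0 H] := @hardy R (nnseq R) E 1 _ _ (fun z => at_ B1 z.2 * (at_ w1 z.2 * sval z.1 z.2)) V.
- by [].
- by rewrite mulr1.
- by move=> [[x x0] k]; rewrite /= !mule_ge0 ?at_ge0.
exists C => // z; apply: le_trans (le_trans (H z) _); rewrite le_eqVlt; apply/orP; left; apply/eqP.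
  by congr snorm; apply/funext => k; rewrite muleA -EFinM.
congr (_ * snorm E _); apply/funext => k /=; rewrite !muleA -!EFinM; congr (_%:E * _).
by rewrite /rho_log; field; rewrite !gt_eqF.
Qed.

Lemma le_vnorm_qnorm :
  vnorm (fun x k => at_ B0 k * (at_ w0 k * x k)) <~ vnorm (fun x k => at_ B0 k * qnorm x k).
Proof.
by apply: vnorm_le; apply: lsM term_qnorm => z; exact: ltW.
Qed.

Lemma le_vnorm_p1norm :
  vnorm (fun x k => at_ B0 k * (at_ w0 k * x k)) <~ vnorm (fun x k => at_ rho_log k * p1norm x k).
Proof.
apply: vnorm_le.
apply: ls_trans (lsM (f := fun z : nnseq R * int => rho_log z.2%:~R) _ term_p1norm); last first.
  by move=> z; rewrite ltW ?rho_log_gt0.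
apply: ls_le => z; rewrite !muleA -!EFinM le_eqVlt; apply/orP; left; apply/eqP.
by congr (_%:E * _); rewrite /rho_log; field; rewrite !gt_eqF.
Qed.

Lemma vnorm_holmstedt : vnorm holmstedt <~
  (fun z => vnorm p0norm z + vnorm (fun x k => at_ B0 k * qnorm x k) z +
    vnorm (fun x k => at_ rho_log k * p1norm x k) z).
Proof.
apply: ls_le => z; apply: (@le_trans _ _ (snorm E (fun k =>
  (at_ v k * p0norm (sval z) k + at_ v k * (at_ B0 k * qnorm (sval z) k)) +
   at_ v k * (at_ rho_log k * p1norm (sval z) k)))).
  apply: snorm_mono => k; rewrite /holmstedt !ge0_muleDr//; rewrite ?adde_ge0 ?mule_ge0 ?wnorm_ge0 ?at_ge0//; exact: rho_log_gt0.
by apply: (le_trans (snormD _ _ _)); apply: leeD => //; exact: snormD.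
Qed.

Lemma hol_ge_p0 : vnorm p0norm <~ vnorm holmstedt.
Proof.
apply: vnorm_le; apply: ls_le => z; rewrite /holmstedt -addeA leeDl// adde_ge0 ?mule_ge0 ?wnorm_ge0 ?at_ge0//; exact: rho_log_gt0.
Qed.

Lemma hol_ge_q : vnorm (fun x k => at_ B0 k * qnorm x k) <~ vnorm holmstedt.
Proof.
apply: vnorm_le; apply: ls_le => z; rewrite /holmstedt addeAC leeDr// adde_ge0 ?mule_ge0 ?wnorm_ge0 ?at_ge0//; exact: rho_log_gt0.
Qed.

Lemma hol_ge_p1 : vnorm (fun x k => at_ rho_log k * p1norm x k) <~ vnorm holmstedt.
Proof.
by apply: vnorm_le; apply: ls_le => z; rewrite /holmstedt leeDr// adde_ge0 ?mule_ge0 ?wnorm_ge0 ?at_ge0.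
Qed.

Lemma vnorm_hol_mid : (c < 0)%R -> (0 < c + (t1 - t0))%R ->
  vnorm holmstedt <~ vnorm (fun x k => at_ B0 k * (at_ w0 k * x k)) /\
  vnorm (fun x k => at_ B0 k * (at_ w0 k * x k)) <~ vnorm holmstedt.
Proof.
move=> c0 c1; split; last exact: ls_trans le_vnorm_qnorm hol_ge_q.
apply: (ls_trans vnorm_holmstedt); apply: ls_add; last exact: vnorm_p1norm.
apply: ls_add; last exact: vnorm_qnorm.
exact: ls_trans (vnorm_p0norm c0) (vnorm_qnorm c0).
Qed.

(** Used with c = 0: only Hardy towards larger indices is available, and it absorbs the term with
    rho into the one with [qnorm]. *)
Lemma vnorm_hol_left : (0 < c + (t1 - t0))%R ->
  vnorm holmstedt <~ (fun z => vnorm (fun x k => at_ B0 k * qnorm x k) z + vnorm p0norm z) /\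
  (fun z => vnorm (fun x k => at_ B0 k * qnorm x k) z + vnorm p0norm z) <~ vnorm holmstedt.
Proof.
move=> c1; split; last by apply: ls_add; [exact: hol_ge_q|exact: hol_ge_p0].
apply: (ls_trans vnorm_holmstedt); apply: ls_add.
  by apply: ls_le => z; rewrite addeC.
apply: ls_addr; first by move=> z; exact: vnorm_ge0.
exact: ls_trans (vnorm_p1norm c1) le_vnorm_qnorm.
Qed.

(** Used with c + (t1 - t0) = 0: Hardy towards smaller indices reduces the first two terms to single
    values, which [p1norm] dominates pointwise. *)
Lemma vnorm_hol_right : (c < 0)%R ->
  vnorm holmstedt <~ vnorm (fun x k => at_ rho_log k * p1norm x k) /\
  vnorm (fun x k => at_ rho_log k * p1norm x k) <~ vnorm holmstedt.
Proof.
move=> c0; split; last exact: hol_ge_p1.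
have G : vnorm (fun x k => at_ B0 k * qnorm x k) <~ vnorm (fun x k => at_ rho_log k * p1norm x k).
  exact: ls_trans (vnorm_qnorm c0) le_vnorm_p1norm.
apply: (ls_trans vnorm_holmstedt); apply: ls_add; last exact: ls_le.
by apply: ls_add => //; exact: ls_trans (vnorm_p0norm c0) G.
Qed.

End hol_norm.
End holmstedt.

(** * From functions to sequences *)

Section bridge.
Variables (R : realType).
Local Open Scope ereal_scope.
Implicit Types (E F G : ri_space R) (h : R -> \bar R) (x : int -> \bar R) (s t : R).

Lemma tnorm_le_snorm (C : R) E (I : set R) h x : (0 < C)%R -> (forall k, 0 <= x k) ->
  (forall t, (0 < t)%R -> I t -> 0 <= h t <= C%:E * x (logfloor t)) ->
  tnorm E I h <= C%:E * snorm E x.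
Proof.
move=> C0 x0 hx; rewrite -snormZ ?(ltW C0)// -tnorm_step => [|k]; last first.
  by rewrite mule_ge0// lee_fin ltW.
apply: tnorm_mono => t t0; rewrite !patchE; case: ifPn => [/set_mem It|_]; last first.
  by rewrite abse0 abse_ge0.
rewrite mem_set; last by rewrite /pos/= in_itv/= t0.
by have /andP[ht hxt] := hx _ t0 It; rewrite (gee0_abs ht); exact: le_trans hxt (lee_abs _).
Qed.

(** Unlike in the converse estimate, every cell on which x is positive has to lie entirely in I.
    This forces the shifts of sequences in the applications to ]0, t[ and ]u, t[. *)
Lemma snorm_le_tnorm (C : R) E (I : set R) h x : (0 < C)%R -> (forall k, 0 <= x k) ->
  (forall t, (0 < t)%R -> 0 < x (logfloor t) -> I t /\ x (logfloor t) <= C%:E * h t) ->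
  snorm E x <= C%:E * tnorm E I h.
Proof.
move=> C0 x0 hx; rewrite -lee_pdivrMl// -snormZ ?invr_ge0 ?(ltW C0)//.
have x0' k : 0 <= (C^-1)%:E * x k by rewrite mule_ge0// lee_fin invr_ge0 ltW.
rewrite -tnorm_step//; apply: tnorm_mono => t t0.
rewrite [leLHS](_ : _ = (C^-1)%:E * x (logfloor t)); last first.
  by rewrite patchE mem_set/= ?gee0_abs// /pos/= in_itv/= t0.
have [xt|xt] := ltP 0 (x (logfloor t)); last first.
  by apply: le_trans (abse_ge0 _); rewrite lee_pdivrMl// mule0.
have [It xh] := hx _ t0 xt; rewrite patchE mem_set//.
by apply: le_trans (lee_abs _); rewrite lee_pdivrMl.
Qed.

Lemma logfloor_itv t : (0 < t)%R ->
  (expR (logfloor t)%:~R <= t)%R /\ (t < expR (logfloor t + 1)%:~R)%R.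
Proof.
move=> t0; have : hcell (logfloor t) t by apply/hcellP.
by rewrite /hcell/= in_itv/= => /andP.
Qed.

Lemma logfloor_mono s t : (0 < s)%R -> (s <= t)%R -> (logfloor s <= logfloor t)%R.
Proof. by move=> s0 st; apply: le_floor; rewrite ler_ln ?posrE// (lt_le_trans s0). Qed.

Lemma logfloor_lt s t : (0 < s)%R -> (0 < t)%R -> (logfloor s < logfloor t)%R -> (s < t)%R.
Proof. by move=> s0 t0; apply: contraTT; rewrite -!leNgt; exact: logfloor_mono. Qed.

Lemma logfloor_expR (k : int) : logfloor (expR k%:~R : R) = k.
Proof. by rewrite /logfloor expRK intrKfloor. Qed.

Lemma regular_cell (W : R -> R) a (m : int) : regular a (W \o expR) -> exists2 C : R, (0 < C)%R &
  forall t, (0 < t)%R -> (W t <= C * W (expR (logfloor t + m)%:~R))%R /\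
    (W (expR (logfloor t + m)%:~R) <= C * W t)%R.
Proof.
move=> hW; have [C C0 H] := regular_near (`|m|%:~R + 1)%R hW.
exists C => // t t0.
have d : (`|ln t - (logfloor t + m)%:~R| <= `|m|%:~R + 1)%R.
  have /andP[] := floor_itv (ln t); rewrite -/(logfloor t) !intrD intr_norm => l1 l2.
  have := ler_norm (m%:~R : R); have := ler_norm (- m%:~R : R).
  by rewrite normrN => *; rewrite ler_norml; apply/andP; split; lra.
have := H _ _ d; rewrite distrC in d; have := H _ _ d.
by rewrite /= lnK.
Qed.

Lemma scale_le (D C a b : R) (u v : \bar R) : (0 <= a)%R -> (a <= D * b)%R ->
  0 <= u -> u <= C%:E * v -> a%:E * u <= (D * C)%:E * (b%:E * v).
Proof.
move=> a0 ab u0 uv; rewrite EFinM muleACA -EFinM.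
by apply: lee_pmul => //; rewrite lee_fin.
Qed.

Section tame.
Variable T : Type.

(* The function h is determined up to constants by its discretization x. *)
Definition tame (h : T -> R -> \bar R) (x : T -> int -> \bar R) :=
  [/\ forall i k, 0 <= x i k, forall i t, (0 < t)%R -> 0 <= h i t &
  exists2 C : R, (0 < C)%R & forall i,
   [/\ forall t, (0 < t)%R -> h i t <= C%:E * x i (logfloor t),
     forall t, (0 < t)%R -> x i (logfloor t) <= C%:E * h i t &
     forall k, x i (k + 1)%R <= C%:E * x i k]].

Section weight.
Variables (h : T -> R -> \bar R) (x : T -> int -> \bar R) (W : R -> R) (a : R).
Hypotheses (hx : tame h x) (hW : regular a (W \o expR)).

Let Wp t : (0 < t)%R -> (0 < W t)%R.
Proof. by move=> t0; have [H _] := hW; have := H (ln t); rewrite /= lnK. Qed.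

Let wp t : (0 < (W \o expR) t)%R. Proof. by have [] := hW. Qed.

Let wx_ge0 i k : 0 <= ((W \o expR) k%:~R)%:E * x i k.
Proof. by have [x0 _ _] := hx; rewrite mule_ge0// lee_fin ltW. Qed.

Lemma tame_upper : exists2 C : R, (0 < C)%R & forall i t, (0 < t)%R ->
  0 <= (W t)%:E * h i t <= C%:E * (((W \o expR) (logfloor t)%:~R)%:E * x i (logfloor t)).
Proof.
have [x0 h0 [C C0 H]] := hx; have [D D0 HD] := regular_cell 0 hW.
exists (D * C)%R => [|i t t0]; first by rewrite mulr_gt0.
have [H1 _ _] := H i; have [] := HD _ t0; rewrite addr0 => d1 _.
rewrite mule_ge0 ?h0 ?lee_fin ?(ltW (Wp t0))//=.
by apply: scale_le; rewrite ?h0 ?H1// ltW// Wp.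
Qed.

(** The second bound, at the next cell, comes from the last clause of [tame] and pays for a shift by
    one cell. *)
Lemma tame_lower : exists2 C : R, (0 < C)%R & forall i t, (0 < t)%R ->
  ((W \o expR) (logfloor t)%:~R)%:E * x i (logfloor t) <= C%:E * ((W t)%:E * h i t) /\
  ((W \o expR) (logfloor t + 1)%:~R)%:E * x i (logfloor t + 1)%R <= C%:E * ((W t)%:E * h i t).
Proof.
have [x0 h0 [C C0 H]] := hx; have [D D0 HD] := regular_cell 0 hW.
have [D' D'0 HD'] := regular_cell 1 hW.
exists (D * C + D' * (C * C))%R => [|i t t0]; first by rewrite addr_gt0 ?mulr_gt0.
have Wh0 : 0 <= (W t)%:E * h i t by rewrite mule_ge0 ?h0// lee_fin ltW// Wp.
have [_ H1 H2] := H i; have [] := HD _ t0; rewrite addr0 => _ d1.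
have [_ d2] := HD' _ t0.
split.
  apply: (@le_trans _ _ ((D * C)%:E * ((W t)%:E * h i t))).
    by apply: scale_le; rewrite ?H1// ltW// wp.
  by apply: lee_wpmul2r => //; rewrite lee_fin lerDl ltW ?mulr_gt0.
apply: (@le_trans _ _ ((D' * (C * C))%:E * ((W t)%:E * h i t))).
  apply: scale_le => //; first by rewrite ltW// wp.
  apply: (le_trans (H2 _)); rewrite EFinM -muleA; apply: lee_wpmul2l; first by rewrite lee_fin ltW.
  exact: H1.
by apply: lee_wpmul2r => //; rewrite lee_fin lerDr ltW ?mulr_gt0.
Qed.

Lemma tame_pos F : (fun i => tnorm F pos (fun s => (W s)%:E * h i s)) <~
    (fun i => wnorm F (W \o expR) predT (x i)) /\
  (fun i => wnorm F (W \o expR) predT (x i)) <~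
    (fun i => tnorm F pos (fun s => (W s)%:E * h i s)).
Proof.
have [C C0 HC] := tame_upper; have [D D0 HD] := tame_lower.
split; [exists C => // i|exists D => // i].
  apply: tnorm_le_snorm => // [k|t t0 _]; first exact: wx_ge0.
  exact: HC.
apply: snorm_le_tnorm => // [k|t t0 _]; first exact: wx_ge0.
by split; [rewrite /pos/= in_itv/= t0|have [] := HD i t t0].
Qed.

(** Since the result is again [tame], iterated norms are discretized by applying this lemma
    repeatedly. *)
Lemma tame_below F : tame (fun i t => tnorm F `]0%R, t[ (fun s => (W s)%:E * h i s))
  (fun i k => wnorm F (W \o expR) (fun j => j <= k)%R (x i)).
Proof.
have [C C0 HC] := tame_upper; have [D D0 HD] := tame_lower.
split=> [i k|i t t0|]; [exact: wnorm_ge0|exact: tnorm_ge0|].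
(* The interval ]0, t[ does not contain the whole cell of t; shifting by one
   cell makes up for it. *)
have shift i (k : int) : wnorm F (W \o expR) (fun j => j <= k)%R (x i) =
    snorm F (cut (fun j => j + 1 <= k)%R
      (fun j => ((W \o expR) (j + 1)%:~R)%:E * x i (j + 1)%R)).
  rewrite /wnorm -(@snorm_shift _ F _ 1%R); first by congr snorm.
  by move=> j; rewrite /cut; case: ifP.
exists (C + D + D * C)%R; first by rewrite !addr_gt0 ?mulr_gt0.
have [C1 [D1 CD]] : (0 <= C)%R /\ (0 <= D)%R /\ (0 <= D * C)%R by rewrite mulr_ge0 ?(ltW C0) ?(ltW D0).
move=> i; split=> [t t0|t t0|k].
- apply: (@le_trans _ _ (C%:E * wnorm F (W \o expR) (fun j => j <= logfloor t)%R (x i))).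
    apply: tnorm_le_snorm => // [k|s s0].
      by rewrite /cut; case: ifP.
    rewrite /= in_itv/= => /andP[_ st].
    by rewrite /cut (logfloor_mono s0 (ltW st)); exact: HC.
  by apply: lee_wpmul2r; [exact: wnorm_ge0|rewrite lee_fin; lra].
- apply: (@le_trans _ _ (D%:E * tnorm F `]0%R, t[ (fun s => (W s)%:E * h i s))); last first.
    by apply: lee_wpmul2r; [exact: tnorm_ge0|rewrite lee_fin; lra].
  rewrite shift; apply: snorm_le_tnorm => // [k|s s0].
    by rewrite /cut; case: ifP.
  rewrite /cut; case: ifPn => //; rewrite ?ltxx// => st _; split; last by have [] := HD i s s0.
  by rewrite /= in_itv/= s0/= (logfloor_lt s0 t0)//; lia.
- apply: (@le_trans _ _ ((D * C)%:E * wnorm F (W \o expR) (fun j => j <= k)%R (x i))); last first.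
    by apply: lee_wpmul2r; [exact: wnorm_ge0|rewrite lee_fin; lra].
  rewrite shift -wnormZ//; apply: snorm_mono => j; rewrite /cut lerD2r.
  (* The values at j + 1 and j are compared through the function at the left end e^j of the cell
     j. *)
  case: ifPn => // jk; have e0 := expR_gt0 (j%:~R : R).
  have [_] := HD i _ e0; rewrite logfloor_expR => h1; apply: (le_trans h1).
  rewrite [leRHS]muleCA [X in _ <= X * _]EFinM -[leRHS]muleA; apply: lee_wpmul2l => //.
  by have /andP[_] := HC i _ e0; rewrite logfloor_expR.
Qed.

End weight.
End tame.
End bridge.

Section bridge_above.
Variables (R : realType).
Local Open Scope ereal_scope.
Implicit Types (E F G : ri_space R) (s t u : R).

Section tame_between.
Variable T : Type.
Variables (h : T -> R -> \bar R) (x : T -> int -> \bar R) (W b : R -> R) (a c : R).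
Hypotheses (hx : tame h x) (hW : regular a (W \o expR)) (hb : regular c (b \o expR)).
Hypothesis xmono : forall i k, x i k <= x i (k + 1)%R.

Let w := W \o expR.
Let wp t : (0 < w t)%R. Proof. by have [] := hW. Qed.
Let bp t : (0 < (b \o expR) t)%R. Proof. by have [] := hb. Qed.
Let bp' t : (0 < t)%R -> (0 < b t)%R.
Proof. by move=> t0; have := bp (ln t); rewrite /= lnK. Qed.
Let wx_ge0 i k : 0 <= (w k%:~R)%:E * x i k.
Proof. by have [x0 _ _] := hx; rewrite mule_ge0// lee_fin ltW. Qed.

(* As in [tame_below], the cells of u and t are only partly contained in
   ]u, t[: the outer sum is shifted by two cells, the inner one by one. *)
Lemma tame_between F G : tame
  (fun i u => tnorm F `]u, +oo[ (fun t => (b t)%:E *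
     tnorm G `]u, t[ (fun s => (W s)%:E * h i s)))
  (fun i k => wnorm F (b \o expR) (fun j => k <= j)%R
     (fun j => wnorm G w (fun l => k <= l <= j)%R (x i))).
Proof.
have [x0 h0 _] := hx.
have [C C0 HC] := tame_upper hx hW; have [D D0 HD] := tame_lower hx hW.
have [B B0 HB] := regular_cell 0 hb; have [B' B'0 HB'] := regular_cell (-2) hb.
have [M M0 HM] := regular_near 1 hW.
pose N i k j := wnorm G w (fun l => k <= l <= j)%R (x i).
have inner_up i u t : (0 < u)%R -> (u < t)%R ->
    tnorm G `]u, t[ (fun s => (W s)%:E * h i s) <= C%:E * N i (logfloor u) (logfloor t).
  move=> u0 ut; apply: tnorm_le_snorm => // [k|s s0].
    by rewrite /cut; case: ifP.
  rewrite /= in_itv/= => /andP[us st].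
  by rewrite /cut !logfloor_mono ?(ltW us) ?(ltW st)//=; exact: HC.
(* After the shift by one the index runs over the cells strictly between those of u and t, which is
   why the range stops at [logfloor t - 2]; monotonicity of x pays for the shift. *)
have inner_low i u t : (0 < u)%R -> (0 < t)%R ->
    N i (logfloor u) (logfloor t - 2)%R <= (M * D)%:E * tnorm G `]u, t[ (fun s => (W s)%:E * h i s).
  move=> u0 t0; rewrite /N /wnorm -(@snorm_shift _ G _ (-1)%R); last first.
    by move=> j; rewrite /cut; case: ifP.
  apply: snorm_le_tnorm => [|k|s s0]; first by rewrite mulr_gt0.
    by rewrite /cut; case: ifP.
  rewrite /cut; case: ifPn => [/andP[us st] _|_]; last by rewrite ltxx.
  have [us' st'] : (logfloor u < logfloor s)%R /\ (logfloor s < logfloor t)%R.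
    by move: us st; clear; lia.
  split; first by rewrite /= in_itv/= (logfloor_lt u0 s0 us') (logfloor_lt s0 t0 st').
  rewrite EFinM -muleA.
  apply: le_trans (lee_wpmul2l _ (HD i s s0).1); last by rewrite lee_fin ltW.
  have := @scale_le R M 1 (w (logfloor s - 1)%:~R) (w (logfloor s)%:~R) (x i (logfloor s - 1)%R) (x i (logfloor s)).
  rewrite mulr1; apply => //; first by rewrite ltW.
    by apply: HM; rewrite -intrB addrAC subrr add0r normrN1.
  by rewrite mul1e; have := xmono i (logfloor s - 1)%R; rewrite subrK.
split=> [i k|i u u0|]; [exact: wnorm_ge0|exact: tnorm_ge0|].
pose K := (B * C + B' * (M * D) + 1)%R.
have K0 : (0 < K)%R by rewrite !addr_gt0 ?mulr_gt0.
have K1 : (B * C <= K)%R by rewrite /K -addrA lerDl addr_ge0// ltW ?mulr_gt0.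
have K2 : (B' * (M * D) <= K)%R.
  by rewrite /K addrAC lerDr addr_ge0// ltW ?mulr_gt0.
have K3 : (1 <= K)%R by rewrite /K lerDr addr_ge0// ltW ?mulr_gt0.
exists K => // i; split => [u u0|u u0|k].
- apply: (@le_trans _ _ ((B * C)%:E * wnorm F (b \o expR) (fun j => logfloor u <= j)%R (N i (logfloor u)))); last first.
    by apply: lee_wpmul2r; [exact: wnorm_ge0|rewrite lee_fin].
  apply: tnorm_le_snorm => [|k|t t0]; first by rewrite mulr_gt0.
    by rewrite /cut; case: ifP => // _; rewrite mule_ge0 ?wnorm_ge0// lee_fin ltW.
  rewrite /= in_itv/= andbT => ut.
  rewrite mule_ge0 ?tnorm_ge0 ?lee_fin ?(ltW (bp' t0))//=.
  rewrite /cut logfloor_mono ?(ltW ut)//.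
  apply: scale_le => //; first by rewrite ltW ?bp'.
  + by have [] := HB _ t0; rewrite addr0.
  + exact: tnorm_ge0.
  + exact: inner_up.
- apply: (@le_trans _ _ ((B' * (M * D))%:E * tnorm F `]u, +oo[ (fun t => (b t)%:E *
     tnorm G `]u, t[ (fun s => (W s)%:E * h i s)))); last first.
    by apply: lee_wpmul2r; [exact: tnorm_ge0|rewrite lee_fin].
  have il t := @inner_low i u t u0; have Nu0 j : 0 <= N i (logfloor u) j by exact: wnorm_ge0.
  rewrite -[leLHS]/(wnorm F (b \o expR) (fun j => logfloor u <= j)%R (N i (logfloor u))).
  move: (N i (logfloor u)) il Nu0 => Nu il Nu0.
  rewrite /wnorm -(@snorm_shift _ F _ (-2)%R); last first.
    by move=> j; rewrite /cut; case: ifP => // _; rewrite mule_ge0// lee_fin ltW.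
  apply: snorm_le_tnorm => [|k|t t0]; first by rewrite !mulr_gt0.
    by rewrite /cut; case: ifP => // _; rewrite mule_ge0// lee_fin ltW.
  rewrite /cut; case: ifPn => [ut _|_]; last by rewrite ltxx.
  have ut' : (logfloor u < logfloor t)%R by move: ut; clear; lia.
  split; first by rewrite /= in_itv/= (logfloor_lt u0 t0 ut').
  apply: scale_le => //; first by rewrite ltW.
  + by have [] := HB' _ t0.
  + exact: il.
(* Both index ranges shrink as k grows, so constant 1 suffices. *)
- apply: (@le_trans _ _ (1%:E * wnorm F (b \o expR) (fun j => k <= j)%R (N i k))).
    rewrite mul1e; apply: wnorm_mono => // [j|j kj|j kj]; first exact: wnorm_ge0.
      by move: kj; clear; lia.
    by apply: wnorm_mono => // l; clear; lia.
  by apply: lee_wpmul2r; [exact: wnorm_ge0|rewrite lee_fin].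
Qed.

End tame_between.

(** * Slow variation of the tail norms *)

Section tail.
Variables (E : ri_space R) (b : R -> R).
Hypotheses (hb : regular 0 (b \o expR)) (bfin : tnorm E `]1%R, +oo[ (EFin \o b) < +oo).

Let w := b \o expR.
Let above (k : int) := wnorm E w (fun j => k <= j)%R (fun=> 1).
Let wp t : (0 < w t)%R. Proof. by have [] := hb. Qed.
Let bp t : (0 < t)%R -> (0 < b t)%R.
Proof. by move=> t0; have := wp (ln t); rewrite /w/= lnK. Qed.

(** The shift makes the range of indices independent of k, so that two tails can be compared term by
    term in [above_le]. *)
Let aboveE k : above k = snorm E (cut (fun j => 0 <= j)%R (fun j => (w (j + k)%:~R)%:E)).
Proof.
rewrite /above /wnorm -(@snorm_shift _ E _ k); last first.
  by move=> j; rewrite /cut mule1; case: ifP => // _; rewrite lee_fin ltW.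
congr snorm; apply/funext => j; rewrite /cut mule1.
by have -> : (k <= j + k)%R = (0 <= j)%R by lia.
Qed.

Let above_le e : (0 < e)%R -> exists2 C : R, (0 < C)%R & forall i j : int,
  above i <= (C * expR (e * `|i - j|%:~R))%:E * above j.
Proof.
move=> e0; have [_ /(_ _ e0)[C C0 H]] := hb; exists C => // i j.
rewrite !aboveE -snormZ; last by rewrite mulr_ge0 ?expR_ge0 ?(ltW C0).
apply: snorm_mono => k; rewrite /cut; case: ifP => _; last by rewrite mule0.
rewrite -EFinM lee_fin; apply: (le_trans (H _ (k + j)%:~R)).
by rewrite mul0r add0r -intrB -intr_norm (_ : k + i - (k + j) = i - j)%R//; lia.
Qed.

Let above_tnorm : exists2 C : R, (0 < C)%R & forall u, (0 < u)%R ->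
  above (logfloor u) <= C%:E * tnorm E `]u, +oo[ (EFin \o b) /\
  tnorm E `]u, +oo[ (EFin \o b) <= C%:E * above (logfloor u).
Proof.
have [C C0 HC] := regular_cell 0 hb; have [D D0 HD] := regular_cell (-1) hb.
exists (C + D)%R => [|u u0]; first by rewrite addr_gt0.
split.
  apply: (@le_trans _ _ (D%:E * tnorm E `]u, +oo[ (EFin \o b))); last first.
    by apply: lee_wpmul2r; [exact: tnorm_ge0|rewrite lee_fin lerDr ltW].
  rewrite /above /wnorm -(@snorm_shift _ E _ (-1)%R); last first.
    by move=> j; rewrite /cut mule1; case: ifP => // _; rewrite lee_fin ltW.
  apply: snorm_le_tnorm => // [k|t t0].
    by rewrite /cut mule1; case: ifP => // _; rewrite lee_fin ltW.
  rewrite /cut mule1; case: ifPn => [ut _|_]; last by rewrite ltxx.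
  split; first by rewrite /= in_itv/= (logfloor_lt u0 t0)//; lia.
  by rewrite -EFinM lee_fin; have [] := HD _ t0.
apply: (@le_trans _ _ (C%:E * above (logfloor u))); last first.
  by apply: lee_wpmul2r; [exact: wnorm_ge0|rewrite lee_fin lerDl ltW].
apply: tnorm_le_snorm => // [k|t t0].
  by rewrite /cut mule1; case: ifP => // _; rewrite lee_fin ltW.
rewrite /= in_itv/= andbT => ut; rewrite /cut mule1 logfloor_mono ?(ltW ut)//.
rewrite -EFinM !lee_fin (ltW (bp t0))/=.
by have [] := HC _ t0; rewrite addr0.
Qed.

(** The hypothesis gives finiteness at u = 1, that is at k = 0, and [above_le] carries it to every
    k; hence [fine] in [tail_norm] loses nothing. *)
Let above_fin k : above k < +oo.
Proof.
have [C C0 HC] := above_tnorm; have [D D0 HD] := above_le ltr01.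
apply: (le_lt_trans (HD k 0%R)); apply: lte_mul_pinfty => //.
  by rewrite lee_fin mulr_ge0 ?expR_ge0 ?(ltW D0).
have [] := HC 1%R ltr01; rewrite /logfloor ln1 floor0 => h _.
by apply: (le_lt_trans h); apply: lte_mul_pinfty => //; rewrite lee_fin ltW.
Qed.

Let above_gt0 k : 0 < above k.
Proof. by apply: wnorm1_gt0 => //; exists k. Qed.

Let tailE u : (0 < u)%R -> (tail_norm E b u)%:E = tnorm E `]u, +oo[ (EFin \o b).
Proof.
move=> u0; apply: fineK; rewrite ge0_fin_numE; last exact: tnorm_ge0.
have [C C0 HC] := above_tnorm; have [_ h] := HC u u0; apply: (le_lt_trans h).
by apply: lte_mul_pinfty; [rewrite lee_fin ltW| |exact: above_fin].
Qed.

Lemma tail_norm_gt0 u : (0 < u)%R -> (0 < tail_norm E b u)%R.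
Proof.
move=> u0; rewrite -lte_fin tailE// lt_neqAle tnorm_ge0 andbT eq_sym; apply/eqP => t0.
have [C C0 HC] := above_tnorm; have [h _] := HC u u0; move: h; rewrite t0 mule0.
by rewrite leNgt above_gt0.
Qed.

Lemma regular_tail : regular 0 (tail_norm E b \o expR).
Proof.
split=> [x|e e0]; first by rewrite /= tail_norm_gt0 ?expR_gt0.
have [D D0 HD] := above_le e0; have [C C0 HC] := above_tnorm.
exists (C * C * D * expR e)%R => [|x y]; first by rewrite !mulr_gt0 ?expR_gt0.
have := HC _ (expR_gt0 x); have := HC _ (expR_gt0 y).
rewrite -!tailE ?expR_gt0// => -[y1 _] [_ x2].
rewrite -lee_fin; apply: (le_trans x2).
rewrite -!mulrA EFinM; apply: lee_wpmul2l; first by rewrite lee_fin ltW.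
apply: (le_trans (HD _ (logfloor (expR y)))); rewrite [leRHS]EFinM.
apply: le_trans (lee_wpmul2l _ y1) _; first by rewrite lee_fin mulr_ge0 ?expR_ge0// ltW.
rewrite /= -!EFinM lee_fin !mulrA (mulrC (D * _)%R) ler_pM2r ?tail_norm_gt0 ?expR_gt0//.
rewrite -!mulrA ler_pM2l// ler_pM2l// -expRD ler_expR mul0r add0r.
rewrite -[leRHS]mulr1 -?mulrDr.
(* Rounding to cells costs at most 1 in the distance, hence the factor [expR e] in the constant. *)
have : (`|logfloor (expR x) - logfloor (expR y)|%:~R <= 1 + `|x - y| :> R)%R.
  rewrite intr_norm intrB /logfloor !expRK.
  have /andP[] := floor_itv x; have /andP[] := floor_itv y; rewrite !intrD.
  have := ler_norm (x - y); have := ler_norm (- (x - y)); rewrite normrN => *.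
  by rewrite ler_norml; apply/andP; split; lra.
by move/(ler_wpM2l (ltW e0)); rewrite mulrDr mulr1; lra.
Qed.

Lemma above_le_tail :
  (fun k : int => wnorm E (b \o expR) (fun j => k <= j)%R (fun=> 1)) <~
  (fun k => ((tail_norm E b \o expR) k%:~R)%:E).
Proof.
have [C C0 HC] := above_tnorm; exists C => // k.
by have [] := HC _ (expR_gt0 k%:~R); rewrite logfloor_expR -tailE ?expR_gt0.
Qed.

Lemma tail_le_above :
  (fun k => ((tail_norm E b \o expR) k%:~R)%:E) <~
  (fun k : int => wnorm E (b \o expR) (fun j => k <= j)%R (fun=> 1)).
Proof.
have [C C0 HC] := above_tnorm; exists C => // k.
by have [] := HC _ (expR_gt0 k%:~R); rewrite logfloor_expR -tailE ?expR_gt0.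
Qed.

End tail.
End bridge_above.

(** * Change of variables and the K-functional *)

Section change_of_variable.
Variable R : realType.
Local Open Scope ereal_scope.
Variables (T : Type) (E : ri_space R) (W : R -> R) (d : R) (g : T -> R -> \bar R).
Hypotheses (hW : regular d W) (d0 : (0 < d)%R) (g0 : forall i x, 0 <= g i x).
Hypothesis gM : forall M : R, exists2 C : R, (0 < C)%R &
  forall i (x y : R), (`|x - y| <= M)%R -> g i x <= C%:E * g i y.

Let L x : R := ln (W x).

Let L_coarse : exists2 C : R, (0 < C)%R & forall x y : R, (x <= y)%R ->
  (L x + d / 2 * (y - x) <= L y + C)%R.
Proof.
have [W0 H] := hW; have [|C C0 HC] := H (d / 2)%R; first by rewrite divr_gt0.
exists (`|ln C| + 1)%R => [|x y xy]; first by rewrite ltr_wpDl.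
have := HC x y; rewrite -ler_ln ?posrE ?mulr_gt0 ?expR_gt0//.
rewrite !lnM ?posrE ?mulr_gt0 ?expR_gt0// expRK -/(L x) -/(L y) ler0_norm ?subr_le0//.
by have := ler_norm (ln C); lra.
Qed.

(** Replace ln W at k by its integer part m k. As ln W grows at rate at least d / 2 up to a
    constant, the fibres of m are bounded and [snorm_coarse] applies. *)
Lemma change_var_le : (fun i => snorm E (fun k => g i (ln (W k%:~R)))) <~
  (fun i => snorm E (fun k => g i k%:~R)).
Proof.
have [C C0 HC] := gM 1; have [D D0 HD] := L_coarse.
pose m (k : int) : int := Num.floor (L k%:~R).
(* If a <= b have the same image, L grows by less than 1 between them, so d / 2 (b - a) <= 1 + D. *)
pose A := (2 / d * (1 + D))%R.
have A0 : (0 < A)%R by rewrite mulr_gt0 ?divr_gt0// addr_gt0.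
have mc i j : m i = m j -> (`|i - j| < (Num.truncn A).+1%:Z)%R.
  move=> mij; suff H (a b : int) : m a = m b -> (a <= b)%R -> (b - a < (Num.truncn A).+1%:Z)%R.
    have [ij|/ltW ij] := leP i j; first by have := H _ _ mij ij; lia.
    by have := H _ _ (esym mij) ij; lia.
  move=> mab ab; rewrite -(ltr_int R) intrB.
  have /andP[_ At] := truncn_itv (ltW A0).
  apply: le_lt_trans At.
  have abR : (a%:~R <= b%:~R :> R)%R by rewrite ler_int.
  have := HD _ _ abR; have := floor_itv (L a%:~R); have := floor_itv (L b%:~R).
  rewrite -/(m a) -/(m b) mab !intrD => /andP[h1 h2] /andP[h3 h4] h5.
  have : (d / 2 * (b%:~R - a%:~R) <= 1 + D)%R by lra.
  by rewrite -ler_pdivlMl ?divr_gt0// invf_div.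
exists (C * (Num.truncn A).+1%:R)%R => [|i]; first by rewrite mulr_gt0.
apply: (@le_trans _ _ (C%:E * snorm E (fun k => g i (m k)%:~R))).
  rewrite -snormZ ?(ltW C0)//; apply: snorm_mono => k; apply: HC.
  have /andP[] := floor_itv (L k%:~R); rewrite -/(m k) !intrD => h1 h2.
  by rewrite -/(L _) ler_norml; apply/andP; split; lra.
rewrite EFinM -muleA; apply: lee_wpmul2l; first by rewrite lee_fin ltW.
exact: (snorm_coarse E (x := fun k => g i k%:~R)).
Qed.

(** Conversely, each integer k lies within a bounded distance of some value of L at an integer m k:
    L tends to both infinities and its increments over unit steps are bounded, so a discrete
    intermediate value argument finds it. *)
Lemma change_var_ge : (fun i => snorm E (fun k => g i k%:~R)) <~
  (fun i => snorm E (fun k => g i (ln (W k%:~R)))).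
Proof.
have [D D0 HD] := L_coarse; have [D' D'0 HD'] := regular_lip hW.
have ex k : exists j : int, (`|k%:~R - L j%:~R| <= D' * 2)%R.
  (* Large enough for L (- N1) <= k < L (N1 + 1); the first n at which L exceeds k is then positive,
     and its predecessor lies below. *)
  pose N1 := (Num.truncn (2 / d * (`|L 0| + D + `|k%:~R|))).+1.
  have N1A : (`|L 0| + D + `|k%:~R| <= d / 2 * N1%:R)%R.
    have A0 : (0 <= 2 / d * (`|L 0| + D + `|k%:~R|))%R.
      by rewrite mulr_ge0 ?divr_ge0 ?addr_ge0// ltW.
    have /andP[_ /ltW] := truncn_itv A0.
    by rewrite -ler_pdivlMl ?divr_gt0// invf_div.
  have lo : (L (- N1%:R) <= k%:~R)%R.
    have := HD (- N1%:R)%R 0%R; rewrite lerNl oppr0 ler0n => /(_ isT).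
    have := ler_norm (L 0); have := ler_norm (- (k%:~R : R)); rewrite normrN.
    have := ler_norm (- D)%R.
    by lra.
  have hi : (k%:~R < L (N1%:R + 1))%R.
    have := HD 0%R (N1%:R + 1)%R; rewrite addr_ge0 ?ler0n// => /(_ isT).
    have := ler_norm (- L 0); have := ler_norm (k%:~R : R); rewrite normrN.
    have dd : (0 < d / 2)%R by rewrite divr_gt0.
    by lra.
  pose P (n : nat) := (k%:~R < L (- N1%:R + n%:R))%R.
  have exP : exists n, P n.
    exists (N1 + N1 + 1)%N; rewrite /P !natrD (_ : - N1%:R + _ = N1%:R + 1)%R//; ring.
  case: (ex_minnP exP) => -[|n]; rewrite /P; first by rewrite addr0 ltNge lo.
  move=> kn /(_ n)/contra; rewrite -ltnNge -leNgt => /(_ (ltnSn n)) nk.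
  exists (- (N1%:Z) + (n.+1)%:Z)%R.
  have -> : ((- (N1%:Z) + (n.+1)%:Z)%:~R = - N1%:R + n.+1%:R :> R)%R by rewrite intrD intrN.
  have := HD' (- N1%:R + n.+1%:R)%R (- N1%:R + n%:R)%R.
  rewrite -/(L _) -/(L _) (_ : - N1%:R + n.+1%:R - _ = 1)%R; last by rewrite -natr1; ring.
  rewrite normr1 => h; have h2 := ler_norm (L (- N1%:R + n.+1%:R) - L (- N1%:R + n%:R))%R.
  by rewrite ltr0_norm ?subr_lt0//; lra.
have [m Hm] := choice ex.
have [C C0 HC] := gM (D' * 2).
(* Integers with the same image under m lie within D' * 2 of one value of L, hence within twice that
   of each other. *)
pose r := (Num.truncn (D' * 2 + D' * 2)).+1.
exists (C * r%:R)%R => [|i]; first by rewrite mulr_gt0.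
apply: (@le_trans _ _ (C%:E * snorm E (fun k => g i (L (m k)%:~R)))).
  by rewrite -snormZ ?(ltW C0)//; apply: snorm_mono => k; exact: HC.
rewrite EFinM -muleA; apply: lee_wpmul2l; first by rewrite lee_fin ltW.
apply: (snorm_coarse E (x := fun k => g i (L k%:~R))) => // a b mab.
rewrite -(ltr_int R) intr_norm intrB.
have A0 : (0 <= D' * 2 + D' * 2)%R by rewrite addr_ge0// mulr_ge0// ltW.
have /andP[_] := truncn_itv A0; apply: le_lt_trans.
have := Hm b; have := Hm a; rewrite mab !ler_norml => /andP[h1 h2] /andP[h3 h4].
by apply/andP; split; lra.
Qed.

End change_of_variable.

(** * The K-functional of a quasi-normed couple *)

Section K_functional.
Variables (R : realType) (V : lmodType R) (X0 X1 : V -> \bar R).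
Hypotheses (X0_ge0 : forall f, (0 <= X0 f)%E) (X1_ge0 : forall f, (0 <= X1 f)%E).
Local Open Scope ereal_scope.

Definition kseq (f : V) (k : int) : \bar R := Kfun X0 X1 (expR k%:~R) f.

Lemma Kfun_ge0 t f : (0 <= t)%R -> 0 <= Kfun X0 X1 t f.
Proof.
move=> t0; apply: le_ereal_inf_tmp => _ [fs _ <-].
by rewrite adde_ge0// mule_ge0// lee_fin.
Qed.

Lemma Kfun_le t f0 f1 : dom X0 f0 -> dom X1 f1 ->
  Kfun X0 X1 t (f0 + f1)%R <= X0 f0 + t%:E * X1 f1.
Proof. by move=> d0 d1; apply: ereal_inf_lbound; exists (f0, f1). Qed.

Lemma Kfun_mono s t f : (s <= t)%R -> Kfun X0 X1 s f <= Kfun X0 X1 t f.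
Proof.
move=> st; apply: le_ereal_inf_tmp => _ [fs [d0 d1 fE] <-].
apply: (@le_trans _ _ (X0 fs.1 + s%:E * X1 fs.2)).
  by apply: ereal_inf_lbound; exists fs.
by apply: leeD => //; apply: lee_wpmul2r => //; rewrite lee_fin.
Qed.

Lemma Kfun_scale (c s t : R) f : (1 <= c)%R -> (0 <= s)%R -> (t <= c * s)%R ->
  Kfun X0 X1 t f <= c%:E * Kfun X0 X1 s f.
Proof.
move=> c1 s0 ts; have c0 : (0 < c)%R by exact: lt_le_trans c1.
rewrite -lee_pdivrMl//; apply: le_ereal_inf_tmp => _ [fs [d0 d1 fE] <-].
rewrite lee_pdivrMl//; apply: (@le_trans _ _ (X0 fs.1 + t%:E * X1 fs.2)).
  by apply: ereal_inf_lbound; exists fs.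
rewrite ge0_muleDr ?mule_ge0 ?lee_fin//.
apply: leeD.
  by rewrite -[leLHS]mul1e; apply: lee_wpmul2r.
by rewrite muleA -EFinM; apply: lee_wpmul2r.
Qed.

Lemma tame_K : tame (fun f t => Kfun X0 X1 t f) kseq.
Proof.
split=> [f k|f t t0|]; [exact: Kfun_ge0 (expR_ge0 _)|exact: Kfun_ge0 (ltW t0)|].
have e1 : (1 <= expR (1 : R))%R by rewrite -expR0 ler_expR.
exists (expR 1); first exact: expR_gt0.
move=> f; split => [t t0|t t0|k].
- have [_ /ltW h] := logfloor_itv t0; apply: (Kfun_scale f e1 (expR_ge0 _)).
  by apply: (le_trans h); rewrite -expRD intrD addrC.
- have [h _] := logfloor_itv t0; apply: (le_trans (Kfun_mono f h)).
  by rewrite -[leLHS]mul1e; apply: lee_wpmul2r; rewrite ?lee_fin// Kfun_ge0 ?(ltW t0).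
- by apply: (Kfun_scale f e1 (expR_ge0 _)); rewrite -expRD intrD addrC.
Qed.

Lemma kseq_mono f i j : (i <= j)%R -> kseq f i <= kseq f j.
Proof. by move=> ij; apply: Kfun_mono; rewrite ler_expR ler_int. Qed.

Lemma kseq_scale f i j : (i <= j)%R -> (expR (i%:~R - j%:~R))%:E * kseq f j <= kseq f i.
Proof.
move=> ij; rewrite -opprB expRN lee_pdivrMl ?expR_gt0//; apply: Kfun_scale (expR_ge0 _) _.
  by rewrite -[leLHS]expR0 ler_expR subr_ge0 ler_int.
by rewrite -expRD subrK.
Qed.

Lemma Kfun_notin t f : f \notin sum_space X0 X1 -> Kfun X0 X1 t f = +oo.
Proof.
move=> fX; rewrite /Kfun [X in ereal_inf X](_ : _ = set0) ?ereal_inf0//.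
rewrite -subset0 => y [fs [d0 d1 fE] _]; move: fX; rewrite notin_setE; apply.
by exists fs.1 => //; exists fs.2.
Qed.

Lemma Kfun_fin t f : f \in sum_space X0 X1 -> (0 <= t)%R -> Kfun X0 X1 t f < +oo.
Proof.
move=> /set_mem[f0 d0 [f1 d1 <-]] t0; apply: (le_lt_trans (Kfun_le t d0 d1)).
by apply: lte_add_pinfty => //; apply: lte_mul_pinfty.
Qed.

End K_functional.

Section quasi_norm.
Variables (R : realType) (V : lmodType R) (X0 X1 : V -> \bar R).
Hypotheses (q0 : quasi_Banach X0) (q1 : quasi_Banach X1).
Local Open Scope ereal_scope.

Lemma le_addinf (A B : set (\bar R)) (a : \bar R) :
  (forall u, A u -> 0 <= u) -> (forall v, B v -> 0 <= v) ->
  (forall u v, A u -> B v -> a <= u + v) -> a <= ereal_inf A + ereal_inf B.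
Proof.
move=> A0 B0 H.
have iA : 0 <= ereal_inf A by exact: le_ereal_inf_tmp.
have iB : 0 <= ereal_inf B by exact: le_ereal_inf_tmp.
have [fA|] := boolP (ereal_inf A \is a fin_num); last first.
  by rewrite ge0_fin_numE// -leNgt leye_eq => /eqP ->; rewrite addye ?leey// gt_eqF// (lt_le_trans _ iB).
have [fB|] := boolP (ereal_inf B \is a fin_num); last first.
  by rewrite ge0_fin_numE// -leNgt leye_eq => /eqP ->; rewrite addey ?leey// gt_eqF// (lt_le_trans _ iA).
apply/lee_addgt0Pr => e e0; have e2 : (0 < e / 2)%R by rewrite divr_gt0.
have [u Au uA] := lb_ereal_inf_adherent e2 fA.
have [v Bv vB] := lb_ereal_inf_adherent e2 fB.
apply: (le_trans (H _ _ Au Bv)); apply: (le_trans (leeD (ltW uA) (ltW vB))).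
by rewrite addeACA -EFinD -splitr.
Qed.

Lemma Kfun_quasi : exists2 C : R, (1 <= C)%R & forall t f g, (0 <= t)%R ->
  Kfun X0 X1 t (f + g)%R <= C%:E * (Kfun X0 X1 t f + Kfun X0 X1 t g).
Proof.
have [C0 C01 H0] := qB_triangle q0; have [C1 C11 H1] := qB_triangle q1.
pose C := Num.max C0 C1.
have Cge1 : (1 <= C)%R by rewrite le_max C01.
have Cgt0 : (0 < C)%R by exact: lt_le_trans Cge1.
exists C => // t f g t0.
have X0p := qB_ge0 q0; have X1p := qB_ge0 q1.
have le0 u v : X0 (u + v)%R <= C%:E * (X0 u + X0 v).
  apply: (le_trans (H0 _ _)); apply: lee_wpmul2r; first by rewrite adde_ge0.
  by rewrite lee_fin le_max lexx.
have le1 u v : X1 (u + v)%R <= C%:E * (X1 u + X1 v).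
  apply: (le_trans (H1 _ _)); apply: lee_wpmul2r; first by rewrite adde_ge0.
  by rewrite lee_fin le_max lexx orbT.
rewrite -lee_pdivrMl//; apply: le_addinf.
- by move=> _ [fs _ <-]; rewrite adde_ge0// mule_ge0// lee_fin.
- by move=> _ [fs _ <-]; rewrite adde_ge0// mule_ge0// lee_fin.
move=> _ _ [[f0 f1] /= [d0 d1 ->] <-] [[g0 g1] /= [e0 e1 ->] <-].
rewrite lee_pdivrMl// addrACA.
have h0 : dom X0 (f0 + g0)%R.
  apply: (le_lt_trans (le0 _ _)); apply: lte_mul_pinfty => //; first by rewrite lee_fin ltW.
  exact: lte_add_pinfty.
have h1 : dom X1 (f1 + g1)%R.
  apply: (le_lt_trans (le1 _ _)); apply: lte_mul_pinfty => //; first by rewrite lee_fin ltW.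
  exact: lte_add_pinfty.
apply: (le_trans (Kfun_le t h0 h1)); rewrite addeACA ge0_muleDr ?adde_ge0 ?mule_ge0 ?lee_fin//.
apply: leeD; first exact: le0.
rewrite -ge0_muleDr// muleCA; apply: lee_wpmul2l; first by rewrite lee_fin.
exact: le1.
Qed.

Lemma Kfun_opp t f : Kfun X0 X1 t (- f)%R <= Kfun X0 X1 t f.
Proof.
have n0 u : X0 (- u)%R = X0 u by rewrite -scaleN1r (qB_homogeneous q0) normrN1 mul1e.
have n1 u : X1 (- u)%R = X1 u by rewrite -scaleN1r (qB_homogeneous q1) normrN1 mul1e.
apply: le_ereal_inf_tmp => _ [[f0 f1] /= [d0 d1 ->] <-].
rewrite -(n0 f0) -(n1 f1) opprD; apply: Kfun_le; rewrite /dom/=.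
  by rewrite n0.
by rewrite n1.
Qed.

End quasi_norm.

(** If K vanishes, f = f0 + f1 with both parts arbitrarily small. Then f0 = f - f1 lies in any given
    neighbourhoods of 0 and of f, and separation gives f = 0. *)
Lemma Kfun_eq0 (R : realType) (V : topologicalLmodType R) (X0 X1 : V -> \bar R) t f :
  compatible_couple X0 X1 -> 0 < t -> (Kfun X0 X1 t f = 0)%E -> f = 0.
Proof.
move=> [hH q0 q1 em0 em1] t0 K0; apply/esym; apply: hH => A B nA nB.
have [d0 d0_gt0 dA] := em0 _ nA.
have nB' : nbhs (0 : V) [set y | B (f - y)].
  have : (fun y : V => f - y) y @[y --> (0 : V)] --> f - 0.
    by apply: (@continuous_comp _ _ _ (fun y : V => (f, y)) (fun z : V * V => z.1 - z.2));
      [apply: cvg_pair; [exact: cvg_cst|exact: cvg_id]|exact: sub_continuous].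
  by rewrite subr0; apply.
have [d1 d1_gt0 dB] := em1 _ nB'.
pose e := Num.min d0 (t * d1).
have e0 : 0 < e by rewrite lt_min d0_gt0 mulr_gt0.
have Kfin : (Kfun X0 X1 t f \is a fin_num)%E by rewrite K0.
have [_ [[f0 f1] /= [D0 D1 fE] <-]] := lb_ereal_inf_adherent e0 Kfin.
rewrite -/(Kfun X0 X1 t f) K0 add0e => le.
exists f0; split.
  apply: dA => /=; apply: (@le_lt_trans _ _ (X0 f0 + t%:E * X1 f1)%E).
    by rewrite leeDl// mule_ge0 ?lee_fin ?(ltW t0)// (qB_ge0 q1).
  by apply: (lt_le_trans le); rewrite lee_fin ge_min lexx.
suff : B (f - f1) by rewrite fE addrK.
apply: dB => /=; rewrite -(@lte_pmul2l _ t%:E) ?lte_fin//.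
apply: (@le_lt_trans _ _ (X0 f0 + t%:E * X1 f1)%E); first by rewrite leeDr// (qB_ge0 q0).
by apply: (lt_le_trans le); rewrite -EFinM lee_fin ge_min lexx orbT.
Qed.

Section norm_equiv.
Variables (R : realType) (T : Type).
Implicit Types (u v w : T -> \bar R).
Local Open Scope ereal_scope.

Definition norm_equiv u v := u <~ v /\ v <~ u.

Lemma norm_equiv_sym u v : norm_equiv u v -> norm_equiv v u.
Proof. by case. Qed.

Lemma norm_equiv_trans v u w : norm_equiv u v -> norm_equiv v w -> norm_equiv u w.
Proof.
by move=> [uv vu] [vw wv]; split; [exact: ls_trans uv vw|exact: ls_trans wv vu].
Qed.

Lemma norm_equiv_refl u : norm_equiv u u.
Proof. by split; exact: ls_le. Qed.

End norm_equiv.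

Lemma norm_equiv_same_space (R : realType) (V : lmodType R) (N N' : V -> \bar R) :
  (forall f, (0 <= N f)%E) -> (forall f, (0 <= N' f)%E) ->
  norm_equiv N N' -> same_space N N'.
Proof.
move=> N0 N'0 [[C C0 H] [D D0 H']]; split.
  apply/seteqP; split=> f; rewrite /dom/= => fN.
    by apply: (le_lt_trans (H' f)); apply: lte_mul_pinfty => //; rewrite lee_fin ltW.
  by apply: (le_lt_trans (H f)); apply: lte_mul_pinfty => //; rewrite lee_fin ltW.
exists (C + D) => [|f _]; first by rewrite addr_gt0.
split; [apply: (le_trans (H f))|apply: (le_trans (H' f))]; apply: lee_wpmul2r => //;
  by rewrite lee_fin ?lerDl ?lerDr ltW.
Qed.

(** * Discrete forms of the four interpolation norms *)

Section discretization.
Variables (R : realType) (V : lmodType R) (X0 X1 : V -> \bar R).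
Hypotheses (X0_ge0 : forall f, (0 <= X0 f)%E) (X1_ge0 : forall f, (0 <= X1 f)%E).
Local Open Scope ereal_scope.
Implicit Types (a b c : R -> R) (E F G : ri_space R).

Definition power_weight (theta : R) a (s : R) : R := (s `^ (- theta) * a s)%R.

Lemma regular_power_weight theta a : regular 0 (a \o expR) -> regular (- theta) (power_weight theta a \o expR).
Proof.
move=> ha; have := regularM (regular_expR (- theta)) ha; rewrite addr0.
rewrite [X in regular _ X -> _](_ : _ = power_weight theta a \o expR)//.
by apply/funext => x; rewrite /power_weight /= /powR gt_eqF ?expR_gt0// expRK.
Qed.

Lemma wnorm_infty F (w : R -> R) (p : pred int) (x : int -> \bar R) k : (forall t, 0 < w t)%R -> p k ->
  x k = +oo -> wnorm F w p x = +oo.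
Proof.
move=> w0 pk xk; have := wnorm_term F w x pk; rewrite xk gt0_muley ?lte_fin//.
have := wnorm_ge0 F w p x; have u0 := unit_norm_gt0 F.
by case: (wnorm F w p x) => [r| |].
Qed.

(** Outside the sum space K is the infimum of the empty set, +oo, and so are the discrete norms; the
    guard [on_sum] therefore agrees with them. *)
Lemma on_sum_norm_equiv (N D : V -> \bar R) : norm_equiv N D ->
  (forall f, f \notin sum_space X0 X1 -> D f = +oo) -> norm_equiv (on_sum X0 X1 N) D.
Proof.
move=> [[C C0 H] [C' C'0 H']] Doo; split; [exists C => // f|exists C' => // f];
  rewrite /on_sum; case: ifPn => [_|/Doo ->].
- exact: H.
- by rewrite gt0_muley ?lte_fin.
- exact: H'.
- by rewrite gt0_muley ?lte_fin.
Qed.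

Lemma on_sum_ge0 (N : V -> \bar R) f : (forall f, 0 <= N f) -> 0 <= on_sum X0 X1 N f.
Proof. by move=> N0; rewrite /on_sum; case: ifP. Qed.

Let Kseq_nn := kseq X0 X1.

Let kap_oo f : f \notin sum_space X0 X1 -> forall k, Kseq_nn f k = +oo.
Proof. by move=> fX k; exact: Kfun_notin. Qed.

Lemma interp_discrete theta b E : regular 0 (b \o expR) ->
  norm_equiv (interp X0 X1 theta b E) (fun f => wnorm E (power_weight theta b \o expR) predT (Kseq_nn f)).
Proof.
move=> hb; have hw := regular_power_weight theta hb; have [w0 _] := hw.
apply: on_sum_norm_equiv; first exact: (tame_pos (tame_K X0_ge0 X1_ge0) hw E).
by move=> f fX; apply: (@wnorm_infty _ _ _ _ 0%R) => //; exact: kap_oo.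
Qed.

Lemma interpL_discrete theta b E a F : regular 0 (b \o expR) -> regular 0 (a \o expR) ->
  norm_equiv (interpL X0 X1 theta b E a F)
    (fun f => wnorm E (b \o expR) predT
      (fun k => wnorm F (power_weight theta a \o expR) (fun j => j <= k)%R (Kseq_nn f))).
Proof.
move=> hb ha; have hw := regular_power_weight theta ha; have [w0 _] := hw; have [b0 _] := hb.
apply: on_sum_norm_equiv.
  exact: (tame_pos (tame_below (tame_K X0_ge0 X1_ge0) hw F) hb E).
move=> f fX; apply: (@wnorm_infty _ _ _ _ 0%R) => //.
by apply: (@wnorm_infty _ _ _ _ 0%R) => //; exact: kap_oo.
Qed.

Lemma interpLL_discrete theta c E b F a G :
  regular 0 (c \o expR) -> regular 0 (b \o expR) -> regular 0 (a \o expR) ->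
  norm_equiv (interpLL X0 X1 theta c E b F a G)
    (fun f => wnorm E (c \o expR) predT (fun l => wnorm F (b \o expR) (fun k => k <= l)%R
      (fun k => wnorm G (power_weight theta a \o expR) (fun j => j <= k)%R (Kseq_nn f)))).
Proof.
move=> hc hb ha; have hw := regular_power_weight theta ha; have [w0 _] := hw.
have [b0 _] := hb; have [c0 _] := hc.
apply: on_sum_norm_equiv.
  exact: (tame_pos (tame_below (tame_below (tame_K X0_ge0 X1_ge0) hw G) hb F) hc E).
move=> f fX; do 3!apply: (@wnorm_infty _ _ _ _ 0%R) => //; exact: kap_oo.
Qed.

Lemma interpLR_discrete theta c E b F a G :
  regular 0 (c \o expR) -> regular 0 (b \o expR) -> regular 0 (a \o expR) ->
  norm_equiv (interpLR X0 X1 theta c E b F a G)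
    (fun f => wnorm E (c \o expR) predT (fun k => wnorm F (b \o expR) (fun j => k <= j)%R
      (fun j => wnorm G (power_weight theta a \o expR) (fun l => k <= l <= j)%R (Kseq_nn f)))).
Proof.
move=> hc hb ha; have hw := regular_power_weight theta ha; have [w0 _] := hw.
have [b0 _] := hb; have [c0 _] := hc.
apply: on_sum_norm_equiv.
  apply: (tame_pos (tame_between (tame_K X0_ge0 X1_ge0) hw hb _ F G) hc E).
  by move=> f k; apply: kseq_mono => //; lia.
move=> f fX; do 3!apply: (@wnorm_infty _ _ _ _ 0%R) => //; exact: kap_oo.
Qed.

Lemma interp_ge0 theta b E f : 0 <= interp X0 X1 theta b E f.
Proof. by apply: on_sum_ge0 => g; exact: tnorm_ge0. Qed.

Lemma interpL_ge0 theta b E a F f : 0 <= interpL X0 X1 theta b E a F f.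
Proof. by apply: on_sum_ge0 => g; exact: tnorm_ge0. Qed.

Lemma interpLL_ge0 theta c E b F a G f : 0 <= interpLL X0 X1 theta c E b F a G f.
Proof. by apply: on_sum_ge0 => g; exact: tnorm_ge0. Qed.

Lemma interpLR_ge0 theta c E b F a G f : 0 <= interpLR X0 X1 theta c E b F a G f.
Proof. by apply: on_sum_ge0 => g; exact: tnorm_ge0. Qed.

End discretization.

(** * Reiteration *)

Section wnorm_sub.
Variables (R : realType).
Local Open Scope ereal_scope.
Implicit Types (x y z : int -> \bar R) (p : pred int).

Lemma wnorm_sub F (w : R -> R) p (c : R) x y z : (forall t, 0 < w t)%R -> (0 < c)%R ->
  (forall k, 0 <= y k) -> (forall k, 0 <= z k) ->
  (forall k, p k -> x k <= c%:E * (y k + z k)) ->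
  wnorm F w p x <= c%:E * (wnorm F w p y + wnorm F w p z).
Proof.
move=> w0 c0 y0 z0 xyz.
apply: (@le_trans _ _ (wnorm F w p (fun k => c%:E * (y k + z k)))).
  by apply: wnorm_mono => // k; rewrite mule_ge0 ?adde_ge0// lee_fin ltW.
rewrite wnormZ ?(ltW c0)//; apply: lee_wpmul2l; first by rewrite lee_fin ltW.
exact: wnormD.
Qed.

End wnorm_sub.

(** * Holmstedt formula for the couple of limiting spaces *)

Section K_of_interpolation_spaces.
Variables (R : realType) (V : topologicalLmodType R) (X0 X1 : V -> \bar R).
Variables (th0 th1 : R) (E0 E1 F0 F1 : ri_space R) (a0 a1 b0 b1 : R -> R).
Hypothesis hX : compatible_couple X0 X1.
Hypotheses (h0 : 0 < th0) (h01 : th0 < th1) (h1 : th1 < 1).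
Hypotheses (ha0 : regular 0 (a0 \o expR)) (ha1 : regular 0 (a1 \o expR)).
Hypotheses (hb0 : regular 0 (b0 \o expR)) (hb1 : regular 0 (b1 \o expR)).
Hypotheses (hb0E0 : (tnorm E0 `]1%R, +oo[ (EFin \o b0) < +oo)%E)
  (hb1E1 : (tnorm E1 `]1%R, +oo[ (EFin \o b1) < +oo)%E).
Local Open Scope ereal_scope.

Let w0 := power_weight th0 a0 \o expR.
Let w1 := power_weight th1 a1 \o expR.
Let B0 := tail_norm E0 b0 \o expR.
Let B1 := tail_norm E1 b1 \o expR.
Let Y0 := interpL X0 X1 th0 b0 E0 a0 F0.
Let Y1 := interpL X0 X1 th1 b1 E1 a1 F1.
Let rho := rho_log w0 w1 B0 B1.
Let hl := holmstedt E0 E1 F0 F1 w0 w1 (b0 \o expR) (b1 \o expR) B0 B1.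

Let hw0 : regular (- th0) w0. Proof. exact: regular_power_weight. Qed.
Let hw1 : regular (- th1) w1. Proof. exact: regular_power_weight. Qed.
Let hB0 : regular 0 B0. Proof. exact: regular_tail. Qed.
Let hB1 : regular 0 B1. Proof. exact: regular_tail. Qed.
Let B0u := above_le_tail hb0 hb0E0.
Let B0l := tail_le_above hb0 hb0E0.
Let B1u := above_le_tail hb1 hb1E1.
Let B1l := tail_le_above hb1 hb1E1.
Let w0p t : (0 < w0 t)%R. Proof. by have [] := hw0. Qed.
Let w1p t : (0 < w1 t)%R. Proof. by have [] := hw1. Qed.
Let B0p t : (0 < B0 t)%R. Proof. by have [] := hB0. Qed.
Let b0p t : (0 < (b0 \o expR) t)%R. Proof. by have [] := hb0. Qed.
Let b1p t : (0 < (b1 \o expR) t)%R. Proof. by have [] := hb1. Qed.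
Let q0 := couple_qB0 hX.
Let q1 := couple_qB1 hX.
Let X0_ge0 := qB_ge0 q0.
Let X1_ge0 := qB_ge0 q1.

Let rho_gt0 t : (0 < rho t)%R.
Proof. exact: (rho_log_gt0 hw0 hw1 hB0 hB1). Qed.

Definition Kseq_nn (f : V) : nnseq R :=
  exist (fun x : int -> \bar R => forall k, 0 <= x k) (kseq X0 X1 f) (fun k => Kfun_ge0 X0_ge0 X1_ge0 f (expR_ge0 k%:~R)).

Let Y0E : norm_equiv Y0 (fun f => y0norm E0 F0 w0 (b0 \o expR) (kseq X0 X1 f)).
Proof. exact: interpL_discrete. Qed.

Let Y1E : norm_equiv Y1 (fun f => y1norm E1 F1 w1 (b1 \o expR) (kseq X0 X1 f)).
Proof. exact: interpL_discrete. Qed.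

Let hl_ge0 x k : 0 <= hl x k.
Proof.
rewrite /hl /holmstedt !adde_ge0 ?mule_ge0 ?wnorm_ge0 ?lee_fin// ltW//; exact: rho_gt0.
Qed.

(** The functional is built from monotone, homogeneous and subadditive norms, so it inherits the
    quasi-triangle inequality of K with the same constant c. *)
Let hl_sub (c : R) x y z k : (0 < c)%R -> (forall k, 0 <= y k) -> (forall k, 0 <= z k) ->
  (forall k, x k <= c%:E * (y k + z k)) -> hl x k <= c%:E * (hl y k + hl z k).
Proof.
move=> c0 y0 z0 xyz; rewrite /hl /holmstedt.
have Q j : qnorm F0 w0 x j <= c%:E * (qnorm F0 w0 y j + qnorm F0 w0 z j) by exact: wnorm_sub.
have P0 : p0norm E0 F0 w0 (b0 \o expR) x k <=
    c%:E * (p0norm E0 F0 w0 (b0 \o expR) y k + p0norm E0 F0 w0 (b0 \o expR) z k).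
  by apply: wnorm_sub => // j; exact: wnorm_ge0.
have P1 : p1norm E1 F1 w1 (b1 \o expR) x k <=
    c%:E * (p1norm E1 F1 w1 (b1 \o expR) y k + p1norm E1 F1 w1 (b1 \o expR) z k).
  by apply: wnorm_sub => // [j|j|j _]; rewrite ?wnorm_ge0//; exact: wnorm_sub.
have sc (r : R) (u v v' : \bar R) : (0 < r)%R -> 0 <= v -> 0 <= v' ->
    u <= c%:E * (v + v') -> r%:E * u <= c%:E * (r%:E * v + r%:E * v').
  move=> r0 v0 v'0 uv; rewrite -ge0_muleDr// muleCA; apply: lee_wpmul2l => //.
  by rewrite lee_fin ltW.
have rk := rho_gt0 k%:~R; have Bk := B0p k%:~R.
have := sc _ _ _ _ Bk (wnorm_ge0 _ _ _ _) (wnorm_ge0 _ _ _ _) (Q k).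
have := sc _ _ _ _ rk (wnorm_ge0 _ _ _ _) (wnorm_ge0 _ _ _ _) P1.
move=> /[swap] h2 h3; apply: (le_trans (leeD (leeD P0 h2) h3)).
have ge (r : R) F w p s : (0 < r)%R -> 0 <= r%:E * @wnorm R F w p s.
  by move=> r0; rewrite mule_ge0 ?wnorm_ge0// lee_fin ltW.
rewrite -!ge0_muleDr ?adde_ge0 ?mule_ge0 ?wnorm_ge0 ?lee_fin ?(ltW rk) ?(ltW Bk)//.
rewrite addeACA [in leRHS]addeACA lee_wpmul2l ?lee_fin ?(ltW c0)//.
rewrite !ge0_muleDr ?adde_ge0 ?mule_ge0 ?wnorm_ge0 ?lee_fin ?(ltW rk) ?(ltW Bk)//.
by rewrite addeACA [X in X + _ <= _]addeACA lexx.
all: by rewrite adde_ge0 ?wnorm_ge0.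
Qed.

(** For any decomposition f = f0 + f1 the functional of f is at most c times the sum of those of f0
    and f1, which [holmstedt_y0] and [holmstedt_y1] bound by the two quasi-norms; then take the
    infimum. *)
Lemma holmstedt_le_K : (fun z : V * int => hl (kseq X0 X1 z.1) z.2) <~
  (fun z => Kfun Y0 Y1 (rho z.2%:~R) z.1).
Proof.
have [c c1 Hc] := Kfun_quasi q0 q1; have c0 : (0 < c)%R by exact: lt_le_trans c1.
have [C0 C00 H0] := holmstedt_y0 F0 F1 h0 h01 h1 hw0 hw1 hb0 hb1 hB0 hB1 B0l B1u.
have [C1 C10 H1] := holmstedt_y1 F0 F1 h01 hw0 hw1 hb0 hb1 hB0 hB1 B0u B1l.
have [_ [D0 D00 G0]] := Y0E; have [_ [D1 D10 G1]] := Y1E.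
exists (c * (C0 * D0 + C1 * D1))%R => [|[f k]/=].
  by rewrite mulr_gt0// addr_gt0 ?mulr_gt0.
rewrite -lee_pdivrMl; last by rewrite mulr_gt0// addr_gt0 ?mulr_gt0.
apply: le_ereal_inf_tmp => _ [[f0 f1] /= [_ _ ->] <-].
rewrite lee_pdivrMl; last by rewrite mulr_gt0// addr_gt0 ?mulr_gt0.
apply: (@le_trans _ _ (c%:E * (hl (kseq X0 X1 f0) k + hl (kseq X0 X1 f1) k))).
  apply: hl_sub => // [j|j|j]; first exact: (svalP (Kseq_nn f0)).
    exact: (svalP (Kseq_nn f1)).
  by apply: Hc; exact: expR_ge0.
rewrite EFinM -muleA; apply: lee_wpmul2l; first by rewrite lee_fin ltW.
have rk := rho_gt0 k%:~R.
have Y00 : 0 <= Y0 f0 by exact: interpL_ge0.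
have Y10 : 0 <= Y1 f1 by exact: interpL_ge0.
have rY : 0 <= (rho k%:~R)%:E * Y1 f1 by rewrite mule_ge0// lee_fin ltW.
apply: leeD_scale; rewrite ?mulr_gt0//.
  apply: (le_trans (H0 (Kseq_nn f0, k))); rewrite EFinM -muleA; apply: lee_wpmul2l; first by rewrite lee_fin ltW.
  apply: (le_trans (G0 f0)); apply: lee_wpmul2l; first by rewrite lee_fin ltW.
  exact: leeDl.
apply: (le_trans (H1 (Kseq_nn f1, k))); rewrite [X in _ <= X * _]EFinM -[leRHS]muleA; apply: lee_wpmul2l; first by rewrite lee_fin ltW.
apply: le_trans (lee_wpmul2l _ (G1 f1)) _; first by rewrite lee_fin ltW.
rewrite muleCA; apply: lee_wpmul2l; first by rewrite lee_fin ltW.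
exact: leeDr.
Qed.

Let hl_infty f k : f \notin sum_space X0 X1 -> hl (kseq X0 X1 f) k = +oo.
Proof.
move=> fX; have : qnorm F0 w0 (kseq X0 X1 f) k = +oo.
  apply: (@wnorm_infty _ _ _ _ _ k) => //=.
  exact: Kfun_notin.
move=> qoo; rewrite /hl /holmstedt qoo gt0_muley ?lte_fin//.
rewrite addey ?addye// gt_eqF// (@lt_le_trans _ _ 0) ?wnorm_ge0//.
by rewrite mule_ge0 ?wnorm_ge0// lee_fin ltW// rho_gt0.
Qed.

Let Kfun_Y0 k : Kfun Y0 Y1 (rho k%:~R) 0%R <= 0.
Proof.
have X00 : X0 0%R = 0 by apply/(qB_eq0 q0).
have X10 : X1 0%R = 0 by apply/(qB_eq0 q1).
have K0 j : kseq X0 X1 0%R j = 0%E.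
  apply/eqP; rewrite eq_le (svalP (Kseq_nn 0%R)) andbT.
  have := @Kfun_le _ _ X0 X1 (expR j%:~R) 0%R 0%R; rewrite /dom/= X00 X10 addr0 mule0 adde0.
  by apply; exact: ltry.
have [[D0 D00 G0] _] := Y0E; have [[D1 D10 G1] _] := Y1E.
have z F w p : wnorm F w p (fun=> 0%E) = 0 :> \bar R.
  transitivity (wnorm F w p (fun _ : int => 0%:E * (0 : \bar R))).
    by congr wnorm; apply/funext => j; rewrite mul0e.
  by rewrite wnormZ// mul0e.
have kE : kseq X0 X1 0%R = fun=> 0%E by apply/funext.
have y0 : Y0 0%R <= 0.
  apply: (le_trans (G0 _)); rewrite kE /y0norm /qnorm.
  by under eq_fun do rewrite z; rewrite z mule0.
have y1 : Y1 0%R <= 0.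
  apply: (le_trans (G1 _)); rewrite kE /y1norm.
  by under eq_fun do rewrite z; rewrite z mule0.
have := @Kfun_le _ _ Y0 Y1 (rho k%:~R) 0%R 0%R; rewrite addr0 => h.
apply: (le_trans (h _ _)); rewrite /dom/=.
- by apply: le_lt_trans y0 _; rewrite ltry.
- by apply: le_lt_trans y1 _; rewrite ltry.
rewrite -[leRHS]adde0; apply: leeD => //.
by rewrite mule_ge0_le0// lee_fin ltW// rho_gt0.
Qed.

Lemma K_le_holmstedt : (fun z : V * int => Kfun Y0 Y1 (rho z.2%:~R) z.1) <~
  (fun z => hl (kseq X0 X1 z.1) z.2).
Proof.
have [c c1 Hc] := Kfun_quasi q0 q1; have c0 : (0 < c)%R by exact: lt_le_trans c1.
have [C0 C00 H0] := y0norm_le_holmstedt E1 F0 F1 (b1 \o expR) h0 hw0 hw1 hb0 hB0 hB1 B0u.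
have [C1 C10 H1] := y1norm_le_p1norm F1 h1 hw1 hb1 B1u B1l.
have [[D0 D00 G0] _] := Y0E; have [[D1 D10 G1] _] := Y1E.
(* From the quasi-triangle inequality for f0 = f - f1 and f1 = f - f0, where the subtracted part is
   bounded by 2 x j. *)
pose M := (c * (1 + 2))%R.
have M0 : (0 < M)%R by rewrite /M; lra.
have DC : (0 < D0 * C0 + D1 * C1)%R by rewrite addr_gt0 ?mulr_gt0.
pose K := ((D0 * C0 + D1 * C1) * (M * 2))%R.
have Kp : (0 < K)%R by rewrite !mulr_gt0.
exists K => // -[f k] /=.
have [fX|fX] := boolP (f \in sum_space X0 X1); last first.
  by rewrite hl_infty// gt0_muley ?leey// lte_fin.
pose x := kseq X0 X1 f.
have x0 j : 0 <= x j by exact: (svalP (Kseq_nn f)).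
have xfin j : x j < +oo by apply: Kfun_fin => //; exact: expR_ge0.
have [hoo|hfin] := eqVneq (hl x k) +oo.
  by rewrite hoo gt0_muley ?leey// lte_fin.
(* A near-optimal decomposition exists only if K is positive; otherwise f = 0. *)
have [xk0|xkn0] := eqVneq (x k) 0.
  have -> : f = 0%R by apply: (Kfun_eq0 hX (expR_gt0 k%:~R)); exact: xk0.
  by apply: (le_trans (Kfun_Y0 k)); rewrite mule_ge0// lee_fin ltW.
have xk_gt0 : 0 < x k by rewrite lt_neqAle eq_sym xkn0 x0.
have xkfin : x k \is a fin_num by rewrite ge0_fin_numE.
have e0 : (0 < fine (x k))%R by rewrite fine_gt0// xk_gt0 xfin.
(* The tolerance is x k itself, so the decomposition costs less than 2 x k. *)
have [_ [[f0 f1] /= [d0 d1 fE] <-]] := lb_ereal_inf_adherent e0 xkfin.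
rewrite -/(Kfun X0 X1 (expR k%:~R) f) -/(kseq X0 X1 f k) -/x fineK// => le.
have ek : 0 < (expR k%:~R)%:E :> \bar R by rewrite lte_fin expR_gt0.
have X0f : X0 f0 <= 2%:E * x k.
  apply: (@le_trans _ _ (X0 f0 + (expR k%:~R)%:E * X1 f1)); first by rewrite leeDl// mule_ge0// ltW.
  by apply: (le_trans (ltW le)); rewrite (_ : 2 = 1 + 1)%R// EFinD ge0_muleDl ?lee_fin// mul1e.
have X1f : (expR k%:~R)%:E * X1 f1 <= 2%:E * x k.
  apply: (@le_trans _ _ (X0 f0 + (expR k%:~R)%:E * X1 f1)); first by rewrite leeDr.
  by apply: (le_trans (ltW le)); rewrite (_ : 2 = 1 + 1)%R// EFinD ge0_muleDl ?lee_fin// mul1e.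
have kf0 j : kseq X0 X1 f0 j <= 2%:E * x k.
  have := @Kfun_le _ _ X0 X1 (expR j%:~R) f0 0%R d0; rewrite addr0.
  have X10 : X1 0%R = 0 by apply/(qB_eq0 q1).
  rewrite /dom/= X10 mule0 adde0 => h; apply: le_trans X0f; apply: h; exact: ltry.
have kf1 j : kseq X0 X1 f1 j <= 2%:E * ((expR (j%:~R - k%:~R))%:E * x k).
  have X00 : X0 0%R = 0 by apply/(qB_eq0 q0).
  have h : kseq X0 X1 f1 j <= (expR j%:~R)%:E * X1 f1.
    have := @Kfun_le _ _ X0 X1 (expR j%:~R) 0%R f1; rewrite add0r /dom/= X00 add0e.
    by apply => //; exact: ltry.
  apply: (le_trans h).
  rewrite muleCA -[in leLHS](subrK (k%:~R) (j%:~R : R)) expRD EFinM -muleA.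
  by apply: lee_wpmul2l => //; rewrite lee_fin expR_ge0.
have M3 (u v : \bar R) : 0 <= v -> u <= c%:E * (v + 2%:E * v) -> u <= M%:E * v.
  move=> v0 uv; apply: (le_trans uv); rewrite /M EFinM -muleA; apply: lee_wpmul2l; first by rewrite lee_fin ltW.
  by apply: leeD_scale; rewrite ?mul1e.
have M2 : (2 <= M)%R by rewrite /M; lra.
have y_le j : (j <= k)%R -> kseq X0 X1 f0 j <= M%:E * x j.
  move=> jk; apply: M3 => //.
  have -> : f0 = (f + (- f1))%R by rewrite fE addrK.
  apply: (le_trans (Hc _ f (- f1)%R (expR_ge0 _))); apply: lee_wpmul2l; first by rewrite lee_fin ltW.
  apply: leeD; first exact: lexx.
  apply: (le_trans (Kfun_opp q0 q1 _ _)); apply: (le_trans (kf1 j)).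
  by apply: lee_wpmul2l => //; exact: kseq_scale.
have z_ge j : (k <= j)%R -> kseq X0 X1 f1 j <= M%:E * x j.
  move=> kj; apply: M3 => //.
  have -> : f1 = (f + (- f0))%R by rewrite fE addrC addKr.
  apply: (le_trans (Hc _ f (- f0)%R (expR_ge0 _))); apply: lee_wpmul2l; first by rewrite lee_fin ltW.
  apply: leeD; first exact: lexx.
  apply: (le_trans (Kfun_opp q0 q1 _ _)); apply: (le_trans (kf0 j)).
  by apply: lee_wpmul2l => //; exact: kseq_mono.
pose Mx j := M%:E * x j.
have Mx0 j : 0 <= Mx j by rewrite mule_ge0// lee_fin ltW.
have A0 : Y0 f0 <= (D0 * C0)%:E * hl Mx k.
  apply: (le_trans (G0 f0)); rewrite EFinM -muleA; apply: lee_wpmul2l; first by rewrite lee_fin ltW.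
  apply: H0 => // [j|j kj]; first exact: (svalP (Kseq_nn f0)).
  by apply: (le_trans (kf0 j)); apply: lee_wpmul2r.
have rk := rho_gt0 k%:~R.
have A1 : (rho k%:~R)%:E * Y1 f1 <= (D1 * C1)%:E * hl Mx k.
  apply: (@le_trans _ _ ((rho k%:~R)%:E * ((D1 * C1)%:E * p1norm E1 F1 w1 (b1 \o expR) Mx k))).
    apply: lee_wpmul2l; first by rewrite lee_fin ltW.
    apply: (le_trans (G1 f1)); rewrite EFinM -muleA; apply: lee_wpmul2l; first by rewrite lee_fin ltW.
    apply: H1 => // [j|j jk]; first exact: (svalP (Kseq_nn f1)).
    apply: (le_trans (kf1 j)); rewrite /Mx [leRHS]muleCA; apply: lee_wpmul2r => //.
    by rewrite mule_ge0// lee_fin expR_ge0.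
  rewrite muleCA; apply: lee_wpmul2l; first by rewrite lee_fin ltW ?mulr_gt0.
  by rewrite /hl /holmstedt leeDr// adde_ge0 ?mule_ge0 ?wnorm_ge0// lee_fin ltW.
(* Homogeneity up to a factor is extracted from [hl_sub]: first with z = 0, then with constant 1 / 2
   to bound the functional of 0 by that of x. *)
have A2 : hl Mx k <= (M * 2)%:E * hl x k.
  apply: (le_trans (@hl_sub M Mx x (fun=> 0) k M0 x0 _ _)) => // [j|].
    by rewrite adde0.
  rewrite [X in _ <= X * _]EFinM -[leRHS]muleA; apply: lee_wpmul2l; first by rewrite lee_fin ltW.
  rewrite (_ : 2 = 1 + 1)%R// EFinD ge0_muleDl ?lee_fin// mul1e; apply: leeD => //.
  apply: (le_trans (@hl_sub (2^-1)%R (fun=> 0) x x k _ x0 x0 _)) => // [j|].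
    by rewrite mule_ge0 ?lee_fin// adde_ge0.
  rewrite (_ : hl x k + hl x k = 2%:E * hl x k); first by rewrite muleA -EFinM mulVf// mul1e.
  by rewrite (_ : 2 = 1 + 1)%R// EFinD ge0_muleDl ?lee_fin// mul1e.
(* Finiteness puts f0 and f1 in the two limiting spaces, as required of a decomposition in
   [Kfun Y0 Y1]. *)
have Mxfin : hl Mx k < +oo.
  apply: (le_lt_trans A2); apply: lte_mul_pinfty => //; first by rewrite lee_fin ltW ?mulr_gt0.
  by rewrite ltey.
have dY0 : dom Y0 f0.
  by apply: (le_lt_trans A0); apply: lte_mul_pinfty => //; rewrite lee_fin ltW ?mulr_gt0.
have dY1 : dom Y1 f1.
  rewrite /dom/= -(@lte_pmul2l _ (rho k%:~R)%:E) ?lte_fin// gt0_muley ?lte_fin//.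
  by apply: (le_lt_trans A1); apply: lte_mul_pinfty => //; rewrite lee_fin ltW ?mulr_gt0.
rewrite fE; apply: (le_trans (Kfun_le _ dY0 dY1)).
apply: (@le_trans _ _ ((D0 * C0 + D1 * C1)%:E * hl Mx k)).
  by apply: leeD_scale; rewrite ?mulr_gt0.
rewrite /K [X in _ <= X * _]EFinM -[leRHS]muleA; apply: lee_wpmul2l; last exact: A2.
by rewrite lee_fin ltW.
Qed.


(** * The three identities *)

Section reiteration.
Variables (E : ri_space R) (b : R -> R).
Hypothesis hb : regular 0 (b \o expR).

Let rhoS (u : R) : R := (u `^ (th1 - th0) *
  ((a0 u * tail_norm E0 b0 u) / (a1 u * tail_norm E1 b1 u)))%R.

Let hrho : regular (th1 - th0) rho.
Proof. exact: regular_rho_log. Qed.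

Let powR_expR (x r : R) : (expR x `^ r = expR (r * x))%R.
Proof. by rewrite /powR gt_eqF ?expR_gt0// expRK. Qed.

Let a0p x : (0 < a0 (expR x))%R. Proof. by have [H _] := ha0; exact: H. Qed.
Let a1p x : (0 < a1 (expR x))%R. Proof. by have [H _] := ha1; exact: H. Qed.
Let B1p x : (0 < B1 x)%R. Proof. by have [] := hB1. Qed.

Let rhoE x : rho x = rhoS (expR x).
Proof.
rewrite /rho /rho_log /w0 /w1 /power_weight /rhoS /= !powR_expR.
rewrite (_ : (th1 - th0) * x = - th0 * x - (- th1 * x))%R; last by ring.
rewrite expRD expRN -[tail_norm E0 b0 (expR x)]/(B0 x) -[tail_norm E1 b1 (expR x)]/(B1 x).
by field; rewrite !gt_eqF ?expR_gt0.
Qed.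

Let hbrho : regular 0 ((b \o rhoS) \o expR).
Proof.
rewrite [X in regular _ X](_ : _ = fun x => (b \o expR) (ln (rho x))).
  exact: (regular_comp hrho hb).
by apply/funext => x; rewrite /= lnK -?rhoE// posrE rho_gt0.
Qed.

Let v theta x : R := (power_weight theta b \o expR) (ln (rho x)).

Let vE theta x : v theta x = (rho x `^ (- theta) * (b \o rhoS \o expR) x)%R.
Proof. by rewrite /v /power_weight /= lnK -?rhoE// posrE rho_gt0. Qed.

Let hv theta : regular (- theta * (th1 - th0)) (v theta).
Proof.
have := regularM (regular_powR (- theta) hrho) hbrho; rewrite addr0.
by rewrite [X in regular _ X -> _](_ : _ = v theta)//; apply/funext => x; rewrite vE.
Qed.

(** Sample at e^k, move the sampling points to rho(e^k), then replace K by its Holmstedt equivalent.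
    The outer weight becomes rho^(- theta) b(rho), of exponent - theta (theta1 - theta0). *)
Lemma interp_holmstedt theta :
  norm_equiv (interp Y0 Y1 theta b E) (fun f => vnorm E (v theta) hl (Kseq_nn f)).
Proof.
have Y0p f : 0 <= Y0 f by exact: interpL_ge0.
have Y1p f : 0 <= Y1 f by exact: interpL_ge0.
apply: (norm_equiv_trans (interp_discrete Y0p Y1p theta E hb)).
pose g (f : V) (x : R) := ((power_weight theta b \o expR) x)%:E * Kfun Y0 Y1 (expR x) f.
have hpw := regular_power_weight theta hb; have [pw0 _] := hpw.
have g0 f x : 0 <= g f x by rewrite mule_ge0 ?lee_fin ?(ltW (pw0 x))// Kfun_ge0 ?expR_ge0.
have gM (M : R) : exists2 C : R, (0 < C)%R &
    forall f (x y : R), (`|x - y| <= M)%R -> g f x <= C%:E * g f y.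
  have [C C0 HC] := regular_near M hpw.
  exists (C * expR `|M|)%R => [|f x y xy]; first by rewrite mulr_gt0 ?expR_gt0.
  apply: scale_le; [exact: ltW|exact: HC|exact: Kfun_ge0 (expR_ge0 _)|].
  apply: (Kfun_scale Y0p Y1p f _ (expR_ge0 y)); first by rewrite -[leLHS]expR0 ler_expR.
  rewrite -expRD ler_expR; have := ler_norm (x - y); have := ler_norm M; lra.
have dd : (0 < th1 - th0)%R by rewrite subr_gt0.
apply: (@norm_equiv_trans _ _ (fun f => snorm E (fun k => g f (ln (rho k%:~R))))).
  split; [exact: (change_var_ge E hrho dd g0 gM)|exact: (change_var_le E hrho dd g0 gM)].
have lnrho x : expR (ln (rho x)) = rho x by rewrite lnK// posrE rho_gt0.
have [vp _] := hv theta.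
have K1 := lsM (f := fun z : V * int => v theta z.2%:~R) (fun z => ltW (vp _)) K_le_holmstedt.
have K2 := lsM (f := fun z : V * int => v theta z.2%:~R) (fun z => ltW (vp _)) holmstedt_le_K.
split; apply: lesssim_snorm; [apply: ls_trans K1|apply: (ls_trans K2)];
  by apply: ls_le => z; rewrite /g lnrho.
Qed.

Lemma reiteration_mid theta : (0 < theta)%R -> (theta < 1)%R ->
  norm_equiv (interp Y0 Y1 theta b E)
    (interp X0 X1 ((1 - theta) * th0 + theta * th1)
      (fun u => (a0 u * tail_norm E0 b0 u) `^ (1 - theta) *
                (a1 u * tail_norm E1 b1 u) `^ theta * b (rhoS u))%R E).
Proof.
move=> theta0 theta1; apply: (norm_equiv_trans (interp_holmstedt theta)).
set Bt := (fun u : R => _ in X in norm_equiv _ X).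
have hBt : regular 0 (Bt \o expR).
  have := regularM (regularM (regular_powR (1 - theta) (regularM ha0 hB0))
    (regular_powR theta (regularM ha1 hB1))) hbrho.
  by rewrite !addr0 !mulr0 addr0.
apply: norm_equiv_trans; last first.
  exact: norm_equiv_sym (interp_discrete X0_ge0 X1_ge0 _ E hBt).
have c0 : (- theta * (th1 - th0) < 0)%R by rewrite mulNr oppr_lt0 mulr_gt0// subr_gt0.
have c1 : (0 < - theta * (th1 - th0) + (th1 - th0))%R.
  rewrite (_ : _ + _ = (1 - theta) * (th1 - th0))%R; last by ring.
  by rewrite mulr_gt0 ?subr_gt0.
have [H1 H2] := vnorm_hol_mid F0 F1 h0 h01 h1 hw0 hw1 hb0 hb1 hB0 hB1 B0u B1u E (hv theta) c0 c1.
apply: (@norm_equiv_trans _ _ (fun f => vnorm E (v theta) (fun x k => (B0 k%:~R)%:E * ((w0 k%:~R)%:E * x k)) (Kseq_nn f))).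
  by split; [exact: (ls_comp Kseq_nn H1)|exact: (ls_comp Kseq_nn H2)].
rewrite [X in norm_equiv X _](_ : _ = (fun f => wnorm E (power_weight ((1 - theta) * th0 + theta * th1) Bt \o expR) predT (kseq X0 X1 f))).
  exact: norm_equiv_refl.
apply/funext => f; congr snorm; apply/funext => k; rewrite /cut/= !muleA -!EFinM; congr (_%:E * _).
(* The weights agree because rho is the quotient of B0 w0 by B1 w1: rho^(- theta) B0 w0 = (B0 w0)^(1
   - theta) (B1 w1)^theta. Written as exponentials, this is a linear identity between exponents. *)
move: (k%:~R : R) => x; rewrite vE /power_weight /Bt /= rhoE !powR_expR.
rewrite -rhoE -[tail_norm E0 b0 (expR x)]/(B0 x) -[tail_norm E1 b1 (expR x)]/(B1 x).
have tp : (0 < a0 (expR x) * B0 x)%R by rewrite mulr_gt0.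
have tq : (0 < a1 (expR x) * B1 x)%R by rewrite mulr_gt0.
set bb := b _; set p := (a0 (expR x) * B0 x)%R in tp *; set q := (a1 (expR x) * B1 x)%R in tq *.
have pE (r : R) : (p `^ r = expR (r * ln p))%R by rewrite /powR gt_eqF.
have qE (r : R) : (q `^ r = expR (r * ln q))%R by rewrite /powR gt_eqF.
have w0E : (B0 x * w0 x = expR (- th0 * x + ln p))%R.
  by rewrite expRD lnK// /w0 /power_weight /= powR_expR /p; ring.
have w1E : (B1 x * w1 x = expR (- th1 * x + ln q))%R.
  by rewrite expRD lnK// /w1 /power_weight /= powR_expR /q; ring.
have -> : rho x = expR ((- th0 * x + ln p) - (- th1 * x + ln q)).
  by rewrite [RHS]expRD expRN -w0E -w1E /rho /rho_log (mulrC (w0 x)) (mulrC (w1 x)).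
rewrite powR_expR pE qE -[LHS]mulrA w0E mulrAC -expRD !mulrA -!expRD.
by congr (expR _ * _)%R; ring.
Qed.

(** The terms with [qnorm] and [p0norm] are the discrete norms of the two spaces on the right, and
    their sum is equivalent to the maximum that defines the intersection. *)
Lemma reiteration_left :
  norm_equiv (interp Y0 Y1 0 b E)
    (inter_space
      (interpL X0 X1 th0 (fun u => tail_norm E0 b0 u * b (rhoS u))%R E a0 F0)
      (interpLL X0 X1 th0 (b \o rhoS) E b0 E0 a0 F0)).
Proof.
apply: (norm_equiv_trans (interp_holmstedt 0)).
have v0 x : v 0 x = (b \o rhoS \o expR) x by rewrite vE oppr0 powRr0 mul1r.
have hc : regular 0 ((fun u => tail_norm E0 b0 u * b (rhoS u))%R \o expR).
  by have := regularM hB0 hbrho; rewrite addr0.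
have [L1 L2] := interpL_discrete X0_ge0 X1_ge0 th0 E F0 hc ha0.
have [M1 M2] := interpLL_discrete X0_ge0 X1_ge0 th0 E E0 F0 hbrho hb0 ha0.
have c1 : (0 < - 0 * (th1 - th0) + (th1 - th0))%R by rewrite oppr0 mul0r add0r subr_gt0.
have [H1 H2] := vnorm_hol_left E0 F0 F1 (b0 \o expR) h0 h01 h1 hw0 hw1 hb1 hB0 hB1 B1u E (hv 0) c1.
apply: (@norm_equiv_trans _ _ (fun f => vnorm E (v 0) (fun x k => (B0 k%:~R)%:E * qnorm F0 w0 x k) (Kseq_nn f) +
    vnorm E (v 0) (p0norm E0 F0 w0 (b0 \o expR)) (Kseq_nn f))).
  by split; [exact: (ls_comp Kseq_nn H1)|exact: (ls_comp Kseq_nn H2)].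
have LE : (fun f => vnorm E (v 0) (fun x k => (B0 k%:~R)%:E * qnorm F0 w0 x k) (Kseq_nn f)) =
    (fun f => wnorm E ((fun u => tail_norm E0 b0 u * b (rhoS u))%R \o expR) predT
      (fun k => wnorm F0 (power_weight th0 a0 \o expR) (fun j => j <= k)%R (kseq X0 X1 f))).
  apply/funext => f; congr snorm; apply/funext => k; rewrite /cut/= muleA -EFinM.
  by rewrite v0 mulrC.
have ME : (fun f => vnorm E (v 0) (p0norm E0 F0 w0 (b0 \o expR)) (Kseq_nn f)) =
    (fun f => wnorm E ((b \o rhoS) \o expR) predT (fun l => wnorm E0 (b0 \o expR) (fun k => k <= l)%R
      (fun k => wnorm F0 (power_weight th0 a0 \o expR) (fun j => j <= k)%R (kseq X0 X1 f)))).
  by apply/funext => f; congr snorm; apply/funext => k; rewrite /cut/= v0.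
rewrite -LE in L1 L2; rewrite -ME in M1 M2.
split.
  apply: ls_add.
    by apply: (ls_trans L2); apply: ls_le => f; rewrite /inter_space le_max lexx.
  by apply: (ls_trans M2); apply: ls_le => f; rewrite /inter_space le_max lexx orbT.
apply: (@ls_trans _ _ (fun f => interpL X0 X1 th0 (fun u => tail_norm E0 b0 u * b (rhoS u))%R E a0 F0 f +
    interpLL X0 X1 th0 (b \o rhoS) E b0 E0 a0 F0 f)).
  apply: ls_le => f; rewrite /inter_space ge_max leeDl ?leeDr//.
    exact: interpL_ge0.
  exact: interpLL_ge0.
apply: ls_add; [apply: ls_addr L1 => f; exact: vnorm_ge0|apply: ls_addl M1 => f; exact: vnorm_ge0].
Qed.

Lemma reiteration_right :
  norm_equiv (interp Y0 Y1 1 b E) (interpLR X0 X1 th1 (b \o rhoS) E b1 E1 a1 F1).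
Proof.
apply: (norm_equiv_trans (interp_holmstedt 1)).
have c0 : (- 1 * (th1 - th0) < 0)%R by rewrite mulN1r oppr_lt0 subr_gt0.
have [H1 H2] := vnorm_hol_right F0 F1 hw0 hw1 hb0 hb1 hB0 hB1 B0u B1l E (hv 1) c0.
apply: norm_equiv_trans; last first.
  exact: norm_equiv_sym (interpLR_discrete X0_ge0 X1_ge0 th1 E E1 F1 hbrho hb1 ha1).
apply: (@norm_equiv_trans _ _ (fun f => vnorm E (v 1) (fun x k => (rho k%:~R)%:E * p1norm E1 F1 w1 (b1 \o expR) x k) (Kseq_nn f))).
  by split; [exact: (ls_comp Kseq_nn H1)|exact: (ls_comp Kseq_nn H2)].
rewrite [X in norm_equiv X _](_ : _ = (fun f => wnorm E ((b \o rhoS) \o expR) predT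
    (fun k => wnorm E1 (b1 \o expR) (fun j => k <= j)%R
      (fun j => wnorm F1 (power_weight th1 a1 \o expR) (fun l => k <= l <= j)%R (kseq X0 X1 f))))).
  exact: norm_equiv_refl.
apply/funext => f; congr snorm; apply/funext => k; rewrite /cut/= muleA -EFinM.
(* The factor rho^(-1) of the outer weight cancels the rho in front of [p1norm]. *)
congr (_%:E * _); rewrite vE powR_inv1 ?(ltW (rho_gt0 _))//.
by rewrite mulrAC mulVf ?mul1r// gt_eqF.
Qed.

End reiteration.
End K_of_interpolation_spaces.

Theorem theorem4p4 (R : realType) (V : topologicalLmodType R)
    (X0 X1 : V -> \bar R) (hX : compatible_couple X0 X1)
    (theta0 theta1 : R) (h0 : 0 < theta0) (h01 : theta0 < theta1)
    (h1 : theta1 < 1)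
    (E E0 E1 F0 F1 : ri_space R) (a0 a1 b b0 b1 : R -> R)
    (ha0 : SV a0) (ha1 : SV a1) (hb : SV b) (hb0 : SV b0) (hb1 : SV b1)
    (hb0E0 : (tnorm E0 `]1%R, +oo[ (EFin \o b0) < +oo)%E)
    (hb1E1 : (tnorm E1 `]1%R, +oo[ (EFin \o b1) < +oo)%E) :
  let rho := fun u : R => u `^ (theta1 - theta0) *
    ((a0 u * tail_norm E0 b0 u) / (a1 u * tail_norm E1 b1 u)) in
  let Y0 := interpL X0 X1 theta0 b0 E0 a0 F0 in
  let Y1 := interpL X0 X1 theta1 b1 E1 a1 F1 in
  [/\ forall theta : R, 0 < theta -> theta < 1 ->
        same_space (interp Y0 Y1 theta b E)
          (interp X0 X1 ((1 - theta) * theta0 + theta * theta1)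
             (fun u : R => (a0 u * tail_norm E0 b0 u) `^ (1 - theta) *
                           (a1 u * tail_norm E1 b1 u) `^ theta * b (rho u)) E),
      (tnorm E `]1%R, +oo[ (EFin \o b) < +oo)%E ->
        same_space (interp Y0 Y1 0 b E)
          (inter_space
             (interpL X0 X1 theta0 (fun u : R => tail_norm E0 b0 u * b (rho u))
                E a0 F0)
             (interpLL X0 X1 theta0 (b \o rho) E b0 E0 a0 F0))
    & (tnorm E `]0%R, 1%R[ (EFin \o b) < +oo)%E ->
        same_space (interp Y0 Y1 1 b E)
          (interpLR X0 X1 theta1 (b \o rho) E b1 E1 a1 F1)].
Proof.
move=> rho Y0 Y1.
have [ra0 ra1 rb] := And3 (SV_regular ha0) (SV_regular ha1) (SV_regular hb).
have [rb0 rb1] := conj (SV_regular hb0) (SV_regular hb1).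
have max_ge0 (N N' : V -> \bar R) f : (0 <= N f -> 0 <= inter_space N N' f)%E.
  by move=> Nf; rewrite /inter_space le_max Nf.
split=> [theta theta_gt0 theta_lt1|_|_].
- apply: norm_equiv_same_space; [exact: interp_ge0|exact: interp_ge0|].
  exact: (reiteration_mid F0 F1 hX h0 h01 h1 ra0 ra1 rb0 rb1 hb0E0 hb1E1).
- apply: norm_equiv_same_space; [exact: interp_ge0| |].
    by move=> f; apply: max_ge0; exact: interpL_ge0.
  exact: (reiteration_left F0 F1 hX h0 h01 h1 ra0 ra1 rb0 rb1 hb0E0 hb1E1).
- apply: norm_equiv_same_space; [exact: interp_ge0|exact: interpLR_ge0|].
  exact: (reiteration_right F0 F1 hX h0 h01 h1 ra0 ra1 rb0 rb1 hb0E0 hb1E1).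
Qed.
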